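(* Let $(M,g)$ be a three-dimensional strongly spin Lorentzian manifold. Then $(M,g)$ admits a skew-torsion parallel spinor if and only if it admits a null coframe $(u,v,n)\in\mathcal{P}_u$ satisfying, for some function $\mathfrak{f}\in C^{\infty}(M)$ and some one-form $\kappa\in\Omega^1(M)$, the equations $$\nabla^gu=\mathfrak{f}\,n\wedge u,\qquad\nabla^gv=\kappa\otimes n-\mathfrak{f}\,n\otimes v,\qquad\nabla^gn=\mathfrak{f}\,u\otimes v-\kappa\otimes u,$$ or, equivalently, the equations $$\tfrac12\mathrm{d}u=\mathfrak{f}\,n\wedge u,\qquad\mathrm{d}v=(\mathfrak{f}v+\kappa)\wedge n,\qquad\mathrm{d}n=u\wedge(\mathfrak{f}v+\kappa).$$
   Context: $(M,g)$ is connected, oriented and time-oriented of signature $(2,1)$; strongly spin means spin and such that every spin structure reduces to the identity component of the spin group. $\nabla^g$ is the Levi-Civita connection, with $(\nabla^g\alpha)(w,\cdot)=\nabla^g_w\alpha$, and $a\wedge b=a\otimes b-b\otimes a$ for one-forms. The Hodge star satisfies $\alpha\wedge\ast_g\beta=g(\alpha,\beta)\nu_g$. Given a nowhere vanishing isotropic one-form $u$, $\mathcal{P}_u$ is the set of null coframes $(u,v,n)$: $v$ is an isotropic one-form with $g(u,v)=1$ and $n=-\ast_g(u\wedge v)$; then $g=u\otimes v+v\otimes u+n\otimes n$ and $\ast_gu=n\wedge u$. An irreducible paired spinor bundle on $(M,g)$ is a rank-two real bundle $S$ of irreducible Clifford modules over $\mathrm{Cl}(T^{\ast}M,g^{\ast})$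 (convention $v^2=g^{\ast}(v,v)$) with a non-degenerate skew-symmetric pairing for which one-forms act skew-adjointly; it is associated to a spin structure, so metric connections lift to $S$. A skew-torsion parallel spinor is a non-zero section of such an $S$ that is parallel with respect to the lift to $S$ of some metric connection on $(M,g)$ with totally skew-symmetric torsion. *)

(* Defs.v *)
From HB Require Import structures.
From mathcomp Require Import all_boot all_order all_algebra.
From mathcomp Require Import all_classical all_reals all_analysis.

Set Implicit Arguments.
Unset Strict Implicit.
Unset Printing Implicit Defensive.

Import Order.TTheory GRing.Theory Num.Theory.
Import numFieldNormedType.Exports.

Local Open Scope classical_set_scope.
Local Open Scope ring_scope.

(* R : realType is the real line.

   Tangent spaces follow the convention of the preferred chart: an atlas comes
   with a choice of a chart [chart_at p] around each point p, and T_pM (resp.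
   T*_pM) is R^3 through the coordinate basis of [chart_at p].  So the value at
   p of a tensor field is the array of its components in [chart_at p]; the
   components at q in another chart c are recovered with the Jacobian of the
   change of coordinates from [chart_at q] to c, and smoothness and derivatives
   always refer to components in one fixed chart.  Vectors and covectors are
   row vectors.

   A local section over an open set U is a section defined on all of M of which
   only the values on U matter. *)

Section Smooth.
Variable R : realType.

Definition pderiv (h : 'rV[R]_3 -> R) (i : 'I_3) (x : 'rV[R]_3) : R :=
  'D_(delta_mx 0 i : 'rV[R]_3) h x.

Fixpoint Ck_on (k : nat) (V : set 'rV[R]_3) (h : 'rV[R]_3 -> R) : Prop :=
  match k with
  | 0 => forall x, V x -> {for x, continuous h}
  | k'.+1 => (forall x, V x -> differentiable h x) /\
             (forall i, Ck_on k' V (pderiv h i))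
  end.

Definition Cinf_on (V : set 'rV[R]_3) (h : 'rV[R]_3 -> R) : Prop :=
  forall k, Ck_on k V h.

Record chart (M : topologicalType) := Chart {
  cdom : set M;
  cmap : M -> 'rV[R]_3;
  cinv : 'rV[R]_3 -> M }.

Definition is_chart (M : topologicalType) (c : chart M) : Prop :=
  [/\ open (cdom c), open (cmap c @` cdom c),
      (forall p, cdom c p -> cinv c (cmap c p) = p),
      (forall p, cdom c p -> {for p, continuous (cmap c)}) &
      (forall x, (cmap c @` cdom c) x -> {for x, continuous (cinv c)})].

(* jac c c' p i j is the derivative of the j-th coordinate of c' along the i-th
   coordinate of c. *)
Definition jac (M : topologicalType) (c c' : chart M) (p : M) : 'M[R]_3 :=
  \matrix_(i, j) pderiv (fun x => cmap c' (cinv c x) 0 j) i (cmap c p).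

(* Connected oriented smooth 3-manifolds; the orientation is carried by an
   atlas whose coordinate changes have positive Jacobian determinant. *)
Record oriented_manifold := OrientedManifold {
  mcarrier :> topologicalType;
  mhausdorff : hausdorff_space mcarrier;
  msecond_countable : second_countable (T := mcarrier);
  mnonempty : [set: mcarrier] !=set0;
  mconnected : connected [set: mcarrier];
  atlas : set (chart mcarrier);
  chart_at : mcarrier -> chart mcarrier;
  atlas_chart : forall c, atlas c -> is_chart c;
  chart_at_atlas : forall p, atlas (chart_at p);
  chart_at_dom : forall p, cdom (chart_at p) p;
  atlas_smooth : forall c c', atlas c -> atlas c' -> forall j : 'I_3,
    Cinf_on (cmap c @` (cdom c `&` cdom c'))
            (fun x => cmap c' (cinv c x) 0 j);
  atlas_oriented : forall c c', atlas c -> atlas c' ->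
    forall p, cdom c p -> cdom c' p -> 0 < \det (jac c c' p) }.

End Smooth.

Section Tensors.
Variables (R : realType) (M : oriented_manifold R).

Implicit Types (c : chart R M) (U : set M).

Definition vfield := M -> 'rV[R]_3.
Definition oneform := M -> 'rV[R]_3.
Definition bilin := M -> 'M[R]_3.

Definition smooth_on U (f : M -> R) : Prop :=
  forall c, atlas c -> Cinf_on (cmap c @` (U `&` cdom c)) (f \o cinv c).

Definition vf_in c (X : vfield) : M -> 'rV[R]_3 :=
  fun q => X q *m jac (chart_at q) c q.
Definition form_in c (a : oneform) : M -> 'rV[R]_3 :=
  fun q => a q *m (jac c (chart_at q) q)^T.
Definition bilin_in c (b : bilin) : M -> 'M[R]_3 :=
  fun q => jac c (chart_at q) q *m b q *m (jac c (chart_at q) q)^T.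
(* Sections of T*M (x) TM: rows are covariant, columns contravariant. *)
Definition endo_in c (A : M -> 'M[R]_3) : M -> 'M[R]_3 :=
  fun q => jac c (chart_at q) q *m A q *m jac (chart_at q) c q.

Definition smooth_vf U (X : vfield) : Prop :=
  forall c, atlas c -> forall j,
    smooth_on (U `&` cdom c) (fun q => vf_in c X q 0 j).
Definition smooth_form U (a : oneform) : Prop :=
  forall c, atlas c -> forall j,
    smooth_on (U `&` cdom c) (fun q => form_in c a q 0 j).
Definition smooth_bilin U (b : bilin) : Prop :=
  forall c, atlas c -> forall i j,
    smooth_on (U `&` cdom c) (fun q => bilin_in c b q i j).
Definition smooth_endo U (A : M -> 'M[R]_3) : Prop :=
  forall c, atlas c -> forall i j,
    smooth_on (U `&` cdom c) (fun q => endo_in c A q i j).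

(* Partial derivative at p along the i-th coordinate of [chart_at p]. *)
Definition pd (p : M) (f : M -> R) (i : 'I_3) : R :=
  pderiv (f \o cinv (chart_at p)) i (cmap (chart_at p) p).

Definition dfun (f : M -> R) : oneform := fun p => \row_i pd p f i.

Definition dform (a : oneform) : bilin := fun p => \matrix_(i, j)
  (pd p (fun q => form_in (chart_at p) a q 0 j) i -
   pd p (fun q => form_in (chart_at p) a q 0 i) j).

Definition lie (X Y : vfield) : vfield := fun p => \row_j \sum_i
  (X p 0 i * pd p (fun q => vf_in (chart_at p) Y q 0 j) i -
   Y p 0 i * pd p (fun q => vf_in (chart_at p) X q 0 j) i).

Definition coord_vf c (j : 'I_3) : vfield :=
  fun q => (delta_mx 0 j : 'rV[R]_3) *m jac c (chart_at q) q.

(* (a (x) b)(w, w') = a(w) b(w'), as the bilinear form (w, w') |-> w T w'^T. *)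
Definition tens (a b : 'rV[R]_3) : 'M[R]_3 := a^T *m b.
Definition wedge (a b : 'rV[R]_3) : 'M[R]_3 := tens a b - tens b a.

(* Coefficient of dx0 /\ dx1 /\ dx2 in the wedge of a two-form (a skew matrix)
   with a one-form. *)
Definition wedge21 (b : 'M[R]_3) (a : 'rV[R]_3) : R :=
  b 0 1 * a 0 2%:R + b 1 2%:R * a 0 0 + b 2%:R 0 * a 0 1.

Definition eta : 'M[R]_3 :=
  diag_mx (\row_(i < 3) (if i == 2%:R then -1 else 1)).

Definition lorentzian (g : bilin) : Prop :=
  [/\ smooth_bilin setT g, (forall p, (g p)^T = g p) &
      (forall p, exists2 P : 'M[R]_3, P \in unitmx &
         P *m g p *m P^T = eta)].

Variable g : bilin.

Definition gdot (p : M) (x y : 'rV[R]_3) : R := (x *m g p *m y^T) 0 0.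
Definition cogdot (p : M) (a b : 'rV[R]_3) : R :=
  (a *m invmx (g p) *m b^T) 0 0.
(* Induced inner product on two-forms:
   <a /\ b, c /\ d> = g(a,c) g(b,d) - g(a,d) g(b,c). *)
Definition cogdot2 (p : M) (a b : 'M[R]_3) : R :=
  2%:R^-1 * \tr (a *m invmx (g p) *m b^T *m invmx (g p)).
Definition vol (p : M) : R := Num.sqrt `|\det (g p)|.

Definition time_orientation (t : vfield) : Prop :=
  smooth_vf setT t /\ forall p, gdot p (t p) (t p) < 0.

(* eta0 is the Hodge dual of the two-form b. *)
Definition is_hodge2 (b : bilin) (eta0 : oneform) : Prop :=
  forall p (a : 'M[R]_3), a^T = - a ->
    wedge21 a (eta0 p) = cogdot2 p a (b p) * vol p.

Definition null_coframe (u v n : oneform) : Prop :=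
  [/\ [/\ smooth_form setT u, smooth_form setT v & smooth_form setT n],
      (forall p, u p != 0) /\ (forall p, cogdot p (u p) (u p) = 0),
      (forall p, cogdot p (v p) (v p) = 0),
      (forall p, cogdot p (u p) (v p) = 1) &
      is_hodge2 (fun p => wedge (u p) (v p)) (fun p => - n p)].

(* Row i of [D X p] is the covariant derivative of X at p along the i-th
   coordinate vector, so that D_w X = w *m D X p. *)
Definition is_connection (D : vfield -> M -> 'M[R]_3) : Prop :=
  forall U, open U ->
  [/\ (forall X, smooth_vf U X -> smooth_endo U (D X)),
      (forall X Y, smooth_vf U X -> smooth_vf U Y -> forall p, U p ->
         D (fun q => X q + Y q) p = D X p + D Y p) &
      (forall f X, smooth_on U f -> smooth_vf U X -> forall p, U p ->
         D (fun q => f q *: X q) p = tens (dfun f p) (X p) + f p *: D X p)].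

Definition metric_connection (D : vfield -> M -> 'M[R]_3) : Prop :=
  is_connection D /\
  forall U, open U -> forall X Y, smooth_vf U X -> smooth_vf U Y ->
  forall p, U p -> forall w : 'rV[R]_3,
    (w *m (dfun (fun q => gdot q (X q) (Y q)) p)^T) 0 0 =
    gdot p (w *m D X p) (Y p) + gdot p (X p) (w *m D Y p).

Definition torsion (D : vfield -> M -> 'M[R]_3) (X Y : vfield) : vfield :=
  fun p => X p *m D Y p - Y p *m D X p - lie X Y p.

Definition skew_torsion (D : vfield -> M -> 'M[R]_3) : Prop :=
  forall U, open U -> forall X Y Z,
    smooth_vf U X -> smooth_vf U Y -> smooth_vf U Z -> forall p, U p ->
    gdot p (torsion D X Y p) (Z p) = - gdot p (torsion D X Z p) (Y p).

Definition levi_civita (D : vfield -> M -> 'M[R]_3) : Prop :=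
  metric_connection D /\
  forall U, open U -> forall X Y, smooth_vf U X -> smooth_vf U Y ->
  forall p, U p -> torsion D X Y p = 0.

(* Dual connection on one-forms, (D_w a)(Y) = w(a(Y)) - a(D_w Y), with w and Y
   coordinate fields; as a bilinear form, (D a)(w, .) = D_w a. *)
Definition dual_conn (D : vfield -> M -> 'M[R]_3) (a : oneform) : bilin :=
  fun p => \matrix_(i, j)
    (pd p (fun q => form_in (chart_at p) a q 0 j) i -
     \sum_k D (coord_vf (chart_at p) j) p i k * a p 0 k).

End Tensors.

(* The irreducible representation of Cl(2,1) on R^2 sends x to
   slash x = sum_a x_a gamma_a, with (slash x)^2 = eta(x, x); it restricts to an
   isomorphism of the even subalgebra with M_2(R). *)
Section Spin.
Variable R : realType.

Definition gam (a : 'I_3) : 'M[R]_2 := \matrix_(i, j)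
  (if a == 0 then (if i == j then (if i == 0 then 1 else -1) else 0)
   else if a == 1 then (if i == j then 0 else 1)
   else (if i == j then 0 else if i == 0 then 1 else -1)).

Definition slash (x : 'rV[R]_3) : 'M[R]_2 := \sum_a x 0 a *: gam a.

(* Products of an even number of unit vectors. *)
Definition spin21 : set 'M[R]_2 := [set A | exists s : seq 'rV[R]_3,
  [/\ ~~ odd (size s),
      {in s, forall x, `|(x *m eta R *m x^T) 0 0| = 1} &
      A = \prod_(x <- s) slash x]].

Definition spin21_id : set 'M[R]_2 := connected_component spin21 1%:M.

(* L is the image of A under the covering Spin(2,1) -> SO(2,1); row a of L is
   the image of the a-th basis vector. *)
Definition spin_covers (A : 'M[R]_2) (L : 'M[R]_3) : Prop :=
  forall a, A *m gam a *m invmx A = slash (row a L).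

Variables (M : oriented_manifold R) (g : bilin M).

Definition orthonormal (p : M) (e : 'M[R]_3) : Prop :=
  e *m invmx (g p) *m e^T = eta R.

(* A spin structure: a principal Spin(2,1)-bundle Q, given by its fibres (right
   torsors) and a covering family of local sections with smooth transition
   functions, with an equivariant smooth map Lam to the bundle of oriented
   orthonormal coframes of T*M (the covectors are the rows of Lam q). *)
Record spin_structure := SpinStructure {
  Qfib : M -> Type;
  Qact : forall p, Qfib p -> 'M[R]_2 -> Qfib p;
  Qact1 : forall p (q : Qfib p), Qact q 1%:M = q;
  QactM : forall p (q : Qfib p) A B, spin21 A -> spin21 B ->
    Qact q (A *m B) = Qact (Qact q A) B;
  Qtorsor : forall p (q q' : Qfib p), exists! A, spin21 A /\ q' = Qact q A;
  Qidx : Type;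
  Qdom : Qidx -> set M;
  Qsec : Qidx -> forall p, Qfib p;
  Qdom_open : forall j, open (Qdom j);
  Qdom_cover : forall p, exists j, Qdom j p;
  Qsec_smooth : forall j k, exists A : M -> 'M[R]_2,
    (forall i l, smooth_on (Qdom j `&` Qdom k) (fun p => A p i l)) /\
    (forall p, Qdom j p -> Qdom k p ->
       spin21 (A p) /\ Qsec k p = Qact (Qsec j p) (A p));
  Lam : forall p, Qfib p -> 'M[R]_3;
  Lam_orthonormal : forall p (q : Qfib p), orthonormal p (Lam q);
  Lam_oriented : forall p (q : Qfib p), 0 < \det (Lam q);
  Lam_equiv : forall p (q : Qfib p) A L, spin21 A -> spin_covers A L ->
    Lam (Qact q A) = L *m Lam q;
  Lam_smooth : forall j (a : 'I_3),
    smooth_form (Qdom j) (fun p => row a (Lam (Qsec j p))) }.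

Definition smooth_Qsec (s : spin_structure) (U : set M)
    (t : forall p, Qfib s p) : Prop :=
  forall j, exists A : M -> 'M[R]_2,
    (forall i l, smooth_on (U `&` @Qdom s j) (fun p => A p i l)) /\
    (forall p, U p -> @Qdom s j p ->
       spin21 (A p) /\ t p = Qact (Qsec j p) (A p)).

Definition reduces_to_id (s : spin_structure) : Prop :=
  exists Q0 : forall p, set (Qfib s p),
  [/\ (forall p q A, Q0 p q -> spin21_id A -> Q0 p (Qact q A)),
      (forall p q q', Q0 p q -> Q0 p q' ->
         exists2 A, spin21_id A & q' = Qact q A) &
      (forall p, exists U (t : forall q, Qfib s q),
         [/\ open U, U p, smooth_Qsec U t & forall q, U q -> Q0 q (t q)])].

Definition strongly_spin : Prop :=
  inhabited spin_structure /\ forall s : spin_structure, reduces_to_id s.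

End Spin.

Section Spinors.
Variables (R : realType) (M : oriented_manifold R) (g : bilin M).

(* Vector bundles of rank two: fibres and a covering family of local frames
   with smooth transition functions. *)
Record plane_bundle := PlaneBundle {
  fib : M -> lmodType R;
  bidx : Type;
  bdom : bidx -> set M;
  bframe : bidx -> 'I_2 -> forall p, fib p;
  bdom_open : forall j, open (bdom j);
  bdom_cover : forall p, exists j, bdom j p;
  bframe_basis : forall j p, bdom j p -> forall s : fib p,
    exists! a : 'rV[R]_2, s = \sum_i a 0 i *: bframe j i p;
  bframe_smooth : forall j k, exists A : M -> 'M[R]_2,
    (forall i l, smooth_on (bdom j `&` bdom k) (fun p => A p i l)) /\
    (forall p, bdom j p -> bdom k p -> forall i,
       bframe j i p = \sum_l A p i l *: bframe k l p) }.

Definition smooth_sec (S : plane_bundle) (U : set M)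
    (s : forall p, fib S p) : Prop :=
  forall j, exists a : M -> 'rV[R]_2,
    (forall i, smooth_on (U `&` @bdom S j) (fun p => a p 0 i)) /\
    (forall p, U p -> @bdom S j p -> s p = \sum_i a p 0 i *: bframe j i p).

Definition irreducible_module (V : lmodType R) (cl : 'rV[R]_3 -> V -> V) :
    Prop :=
  forall W : set V, W 0 -> (forall s t, W s -> W t -> W (s + t)) ->
    (forall (a : R) s, W s -> W (a *: s)) ->
    (forall a s, W s -> W (cl a s)) -> W = [set 0] \/ W = setT.

Record paired_spinor_bundle := PairedSpinorBundle {
  sbundle :> plane_bundle;
  cl : forall p, 'rV[R]_3 -> fib sbundle p -> fib sbundle p;
  cl_linearl : forall p (x : R) a b (s : fib sbundle p),
    cl (x *: a + b) s = x *: cl a s + cl b s;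
  cl_linearr : forall p (x : R) a (s t : fib sbundle p),
    cl a (x *: s + t) = x *: cl a s + cl a t;
  cl_sq : forall p a (s : fib sbundle p),
    cl a (cl a s) = cogdot g p a a *: s;
  cl_irreducible : forall p, irreducible_module (@cl p);
  cl_smooth : forall U, open U -> forall a (s : forall p, fib sbundle p),
    smooth_form U a -> smooth_sec U s -> smooth_sec U (fun p => cl (a p) (s p));
  pairing : forall p, fib sbundle p -> fib sbundle p -> R;
  pairing_linear : forall p (x : R) (s s' t : fib sbundle p),
    pairing (x *: s + s') t = x * pairing s t + pairing s' t;
  pairing_skew : forall p (s t : fib sbundle p), pairing s t = - pairing t s;
  pairing_nondeg : forall p (s : fib sbundle p),
    (forall t, pairing s t = 0) -> s = 0;
  pairing_smooth : forall U, open U -> forall s t : forall p, fib sbundle p,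
    smooth_sec U s -> smooth_sec U t ->
    smooth_on U (fun p => pairing (s p) (t p));
  cl_skew : forall p a (s t : fib sbundle p),
    pairing (cl a s) t = - pairing s (cl a t) }.

(* [DS s p w] is the covariant derivative of the section s along w in T_pM. *)
Definition is_connection_on (S : plane_bundle)
    (DS : (forall p, fib S p) -> forall p, 'rV[R]_3 -> fib S p) : Prop :=
  forall U, open U ->
  [/\ (forall s X, smooth_sec U s -> smooth_vf U X ->
         smooth_sec U (fun p => DS s p (X p))),
      (forall s, smooth_sec U s -> forall p, U p -> forall (x : R) w w',
         DS s p (x *: w + w') = x *: DS s p w + DS s p w'),
      (forall s t, smooth_sec U s -> smooth_sec U t -> forall p, U p ->
         forall w, DS (fun q => s q + t q) p w = DS s p w + DS t p w) &
      (forall f s, smooth_on U f -> smooth_sec U s -> forall p, U p ->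
         forall w, DS (fun q => f q *: s q) p w =
           (w *m (dfun f p)^T) 0 0 *: s p + f p *: DS s p w)].

(* Local sections of the Spin_0(2,1) = SL(2,R) bundle to which S is associated:
   symplectic frames b of S in which an orthonormal coframe e acts by the
   gamma matrices. *)
Definition spin_frame (S : paired_spinor_bundle) (U : set M)
    (b : 'I_2 -> forall p, fib S p) (e : M -> 'M[R]_3) : Prop :=
  [/\ (forall i, smooth_sec U (b i)),
      (forall a, smooth_form U (fun p => row a (e p))),
      (forall p, U p -> orthonormal g p (e p)),
      (forall p, U p -> pairing (b 0 p) (b 1 p) = 1) &
      (forall p, U p -> forall a j,
         cl (row a (e p)) (b j p) = \sum_i gam R a i j *: b i p)].

(* DS is the lift of the metric connection D.  In a spin frame over a
   neighbourhood of each point, O is the so(2,1)-valued connection form of D,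
   evaluated at w, and W the one of DS; W lies in the Lie algebra of Spin(2,1),
   which is sl(2,R), and lies over O for the differential
   W |-> (gamma |-> [W, gamma]) of the covering map. *)
Definition is_lift (S : paired_spinor_bundle) (D : vfield M -> M -> 'M[R]_3)
    (DS : (forall p, fib S p) -> forall p, 'rV[R]_3 -> fib S p) : Prop :=
  is_connection_on DS /\
  forall p0, exists U b e, [/\ open U, U p0, spin_frame (S := S) U b e &
    forall p, U p -> forall w : 'rV[R]_3,
    exists (O : 'M[R]_3) (W : 'M[R]_2),
    [/\ (forall a, w *m dual_conn D (fun q => row a (e q)) p =
                   row a O *m e p),
        \tr W = 0,
        (forall a, W *m gam R a - gam R a *m W = slash (row a O)) &
        (forall j, DS (b j) p w = \sum_i W i j *: b i p)]].

Definition admits_skew_torsion_parallel_spinor : Prop :=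
  exists (S : paired_spinor_bundle) (D : vfield M -> M -> 'M[R]_3)
    (DS : (forall p, fib S p) -> forall p, 'rV[R]_3 -> fib S p)
    (s : forall p, fib S p),
  [/\ metric_connection g D, skew_torsion g D, is_lift D DS,
      smooth_sec setT s /\ (exists p, s p != 0) &
      forall p w, DS s p w = 0].

Definition covariant_system (D : vfield M -> M -> 'M[R]_3)
    (u v n : oneform M) (f : M -> R) (kappa : oneform M) : Prop :=
  forall p,
  [/\ dual_conn D u p = f p *: wedge (n p) (u p),
      dual_conn D v p = tens (kappa p) (n p) - f p *: tens (n p) (v p) &
      dual_conn D n p = f p *: tens (u p) (v p) - tens (kappa p) (u p)].

Definition exterior_system
    (u v n : oneform M) (f : M -> R) (kappa : oneform M) : Prop :=
  forall p,
  [/\ 2%:R^-1 *: dform u p = f p *: wedge (n p) (u p),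
      dform v p = wedge (f p *: v p + kappa p) (n p) &
      dform n p = wedge (u p) (f p *: v p + kappa p)].

End Spinors.

(* Main.v *)
(* A spinor s parallel for the lift of a metric connection D is nowhere zero,
   since the manifold is connected, and its Dirac current u, given by
   g(u, a) = <s, a.s>, is null, nowhere zero and D-parallel.  As D and the
   Levi-Civita connection differ by a three-form, the covariant derivative of u
   is skew-symmetric; it annihilates u, so it is a multiple of n /\ u, and metric
   compatibility then determines the derivatives of v and n.  The conjugate null
   form v exists globally thanks to the time orientation.  Conversely, a null
   coframe trivialises the spinor bundle, and adding a multiple of f nu_g to the
   Levi-Civita connection makes u parallel, along with the constant spinor whose
   Dirac current is a multiple of u.  The exterior system is equivalent to
   the covariant one because a tensor that is symmetric in one pair of slots and
   skew in another vanishes. *)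

From HB Require Import structures.
Require Import Defs.
From mathcomp Require Import all_boot all_order all_algebra.
From mathcomp Require Import all_classical all_reals all_analysis.
From mathcomp Require Import ring lra.
Import Order.TTheory GRing.Theory Num.Theory.
Import numFieldNormedType.Exports.
Set Implicit Arguments.
Unset Strict Implicit.
Unset Printing Implicit Defensive.
Local Open Scope classical_set_scope.
Local Open Scope ring_scope.

(** * Smooth functions on R^3 *)

(** Components of a tensor refer to a chart that changes with the point, so derivatives are taken in
    one fixed chart and transported by Jacobians. A local section is a global function of which only
    a part matters, so the locality of connections has to be derived from the Leibniz rule.

    The parallel spinor is assumed nonzero at one point only. In a spin frame its components solve a
    homogeneous linear first-order system, and a Gronwall estimate along segments makes its zero set
    open. For components (x, y), the current has components (-2xy, x^2 - y^2, x^2 + y^2) in the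
    coframe, an equivariant quadratic map; hence it is null, nonzero and parallel.

    In the converse direction the multiple of the volume form is dictated by the cancellation of f n
    /\ u. The remaining connection form takes its values in the line of so(2,1) that annihilates u,
    which corresponds to the nilpotent matrices killing b_0 and sending b_1 to a multiple of b_0.
    The spinor connection can therefore be written down outright in the orthonormal coframe n, u/2 +
    v, u/2 - v, with kappa - f v as its only coefficient. *)

Lemma near_eq_differentiable (R : realType) (V W : normedModType R)
    (f h : V -> W) (x : V) :
  {near x, f =1 h} -> differentiable f x -> differentiable h x.
Proof.
move=> fh df.
(* Since [h - f] vanishes near [x], the zero map satisfies the little-o condition that characterises
   its differential. *)
have dz : differentiable (h - f) x.
  have e0 : (h - f) \o shift x = cst ((h - f) x) + 0 +o_ 0 id.
    apply: eqaddoE; apply/eqaddoP => _/posnumP[e].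
    have fhx : (h - f) x = 0.
      by rewrite !fctE (nbhs_singleton fh) subrr.
    have : \forall y \near (0 : V), f (y + x) = h (y + x).
      have := cvg_comp_shift x (0 : V) id; rewrite add0r.
      move=> /(congr1 (fun F : set_system V => F [set y | f y = h y])) E.
      by have : nbhs x [set y | f y = h y] by []; rewrite -[nbhs _ _]E.
    apply: filterS => y fhy.
    rewrite !fctE (_ : h x - f x = 0) ?addr0 //=.
    by rewrite fhy subrr subrr normr0 mulr_ge0.
  have c0 : continuous (\0 : {linear V -> W}) by exact: cst_continuous.
  have d0 := diff_unique c0 e0.
  by apply/diff_locallyP; rewrite d0.
by have := differentiableD df dz; rewrite addrC subrK.
Qed.

Section Calculus.
Variable R : realType.
Local Notation E := 'rV[R]_3.
Implicit Types (V W : set E) (f h : E -> R) (phi : E -> E) (x : E) (k : nat).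

Lemma Ck_on_ext k V f h : open V -> (forall x, V x -> f x = h x) ->
  Ck_on k V f -> Ck_on k V h.
Proof.
move=> oV; elim: k f h => [|k IH] f h fh /=.
  move=> cf x Vx; have fhx : \near x, f x = h x.
    by apply: filterS (open_nbhs_nbhs (conj oV Vx)) => y; exact: fh.
  have E : f x = h x by exact: fh.
  have : h @ x --> f x; last by rewrite E => H; exact: H.
  by apply: cvg_trans (cf x Vx); exact: near_eq_cvg fhx.
move=> [df cf]; have fhx x : V x -> \near x, f x = h x.
  by move=> Vx; apply: filterS (open_nbhs_nbhs (conj oV Vx)) => y; exact: fh.
split=> [x Vx|i]; first exact: (near_eq_differentiable (fhx x Vx) (df x Vx)).
by apply: IH (cf i) => x Vx; apply: near_eq_derive; exact: fhx.
Qed.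

Lemma Ck_on_sub k V W f : V `<=` W -> Ck_on k W f -> Ck_on k V f.
Proof.
move=> VW; elim: k f => [|k IH] f /=; first by move=> cf x /VW; exact: cf.
by move=> [df cf]; split=> [x /VW|i]; [exact: df|exact: IH].
Qed.

Lemma Ck_onS k V f : Ck_on k.+1 V f -> Ck_on k V f.
Proof.
elim: k f => [|k IH] f [df cf].
  by move=> x Vx; exact/differentiable_continuous/df.
by split=> // i; exact: IH.
Qed.

Lemma pderivD f h i x : differentiable f x -> differentiable h x ->
  pderiv (fun y => f y + h y) i x = pderiv f i x + pderiv h i x.
Proof. by move=> df dh; apply: deriveD; exact: diff_derivable. Qed.

Lemma pderivM f h i x : differentiable f x -> differentiable h x ->
  pderiv (fun y => f y * h y) i x = f x * pderiv h i x + h x * pderiv f i x.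
Proof. by move=> df dh; apply: deriveM; exact: diff_derivable. Qed.

Lemma pderiv_cst (a : R) i x : pderiv (fun=> a) i x = 0.
Proof. exact: derive_cst. Qed.

Lemma derive_pderiv f x (v : E) : differentiable f x ->
  'D_v f x = \sum_j v 0 j * pderiv f j x.
Proof.
move=> df; rewrite deriveE // {1}[v]row_sum_delta linear_sum.
by apply: eq_bigr => j _; rewrite linearZ /= /pderiv deriveE.
Qed.

Lemma row_fun_sum phi : phi = \sum_j (fun y => phi y 0 j *: delta_mx 0 j).
Proof.
by apply/funext => y; rewrite fct_sumE; exact: row_sum_delta.
Qed.

Lemma differentiable_row phi x :
  (forall j, differentiable (fun y => phi y 0 j) x) -> differentiable phi x.
Proof.
move=> dphi; rewrite [phi]row_fun_sum; apply: differentiable_sum => j.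
exact: differentiableZl.
Qed.

Lemma pderiv_comp phi h x i :
  (forall j, differentiable (fun y => phi y 0 j) x) ->
  differentiable h (phi x) ->
  pderiv (h \o phi) i x =
  \sum_j pderiv (fun y => phi y 0 j) i x * pderiv h j (phi x).
Proof.
move=> dphi dh; have df := differentiable_row dphi.
rewrite {1}/pderiv deriveE; last exact: differentiable_comp.
rewrite diff_comp //= -deriveE // derive_pderiv //.
apply: eq_bigr => j _; congr (_ * _).
rewrite -deriveE //; set v := delta_mx 0 i.
have dZ l : derivable (fun y => phi y 0 l *: (delta_mx 0 l : E)) x v.
  exact/diff_derivable/differentiableZl.
rewrite {1}[phi]row_fun_sum derive_sum // summxE (bigD1 j) //= big1 => [|l lj].
  rewrite deriveE; last exact: differentiableZl.
  by rewrite diffZl // !mxE !eqxx mulr1 addr0 /pderiv deriveE.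
rewrite deriveE; last exact: differentiableZl.
by rewrite diffZl // !mxE eqxx /= eq_sym (negbTE lj) mulr0.
Qed.

Lemma continuous_row phi x :
  (forall j, {for x, continuous (fun y => phi y 0 j)}) ->
  {for x, continuous phi}.
Proof.
move=> cphi.
have cs (s : seq 'I_3) :
    {for x, continuous (fun y => \sum_(j <- s) phi y 0 j *: (delta_mx 0 j : E))}.
  elim: s => [|j s IH].
    have -> : (fun y => \sum_(j <- [::]) phi y 0 j *: (delta_mx 0 j : E)) = cst 0.
      by apply/funext => y; rewrite big_nil.
    exact: cst_continuous.
  have -> : (fun y => \sum_(l <- j :: s) phi y 0 l *: (delta_mx 0 l : E)) =
     (fun y => phi y 0 j *: (delta_mx 0 j : E) +
               \sum_(l <- s) phi y 0 l *: (delta_mx 0 l : E)).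
    by apply/funext => y; rewrite big_cons.
  exact: (cvgD (cvgZr_tmp (cphi j)) IH).
have -> : phi = (fun y => \sum_j phi y 0 j *: (delta_mx 0 j : E)).
  by apply/funext => y; exact: row_sum_delta.
exact: cs.
Qed.

Lemma Ck_on_cst k V (a : R) : Ck_on k V (fun=> a).
Proof.
elim: k a => [|k IH] a /=; first by move=> x _; exact: (@cst_continuous E R a x).
split=> [x _|i]; first exact: differentiable_cst.
suff -> : pderiv (fun=> a) i = (fun=> 0 : R) by [].
by apply/funext => x; exact: pderiv_cst.
Qed.

Lemma pderiv_coord i j x : pderiv (fun y : E => y 0 j) i x = (i == j)%:R.
Proof.
have lf : linear (fun y : E => y 0 j : R) by move=> a y z; rewrite !mxE.
pose l : {linear E -> R} := HB.pack (fun y : E => y 0 j : R)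
  (GRing.isLinear.Build _ _ _ _ _ lf).
rewrite /pderiv deriveE; last exact: differentiable_coord.
rewrite (@diff_lin _ _ _ l) /=; last exact: (@coord_continuous R 1 3 0 j).
by rewrite mxE eqxx eq_sym.
Qed.

Lemma Ck_on_coord k V j : Ck_on k V (fun x => x 0 j).
Proof.
case: k => [|k] /=; first by move=> x _; exact: (@coord_continuous R 1 3 0 j x).
split=> [x _|i]; first exact: differentiable_coord.
suff -> : pderiv (fun x => x 0 j) i = (fun=> (i == j)%:R : R).
  exact: Ck_on_cst.
by apply/funext => x; exact: pderiv_coord.
Qed.

Lemma Ck_on_local k V f :
  (forall x, V x -> exists W, [/\ open W, W x & Ck_on k W f]) -> Ck_on k V f.
Proof.
elim: k f => [|k IH] f H.
  by move=> x /H[W [_ Wx]]; apply.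
split=> [x /H[W [_ Wx [df _]]]|i]; first exact: df.
by apply: IH => x /H[W [oW Wx [_ cf]]]; exists W; split=> //; exact: cf.
Qed.

Lemma Ck_onD k V f h : open V -> Ck_on k V f -> Ck_on k V h ->
  Ck_on k V (fun x => f x + h x).
Proof.
move=> oV; elim: k f h => [|k IH] f h /=.
  by move=> cf ch x Vx; exact: (cvgD (cf x Vx) (ch x Vx)).
move=> [df cf] [dh ch]; split=> [x Vx|i].
  by apply: differentiableD; [exact: df|exact: dh].
apply: Ck_on_ext (IH _ _ (cf i) (ch i)) => // x Vx.
by rewrite pderivD //; [exact: df|exact: dh].
Qed.

Lemma Ck_onM k V f h : open V -> Ck_on k V f -> Ck_on k V h ->
  Ck_on k V (fun x => f x * h x).
Proof.
move=> oV; elim: k f h => [|k IH] f h.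
  by move=> cf ch x Vx; exact: (cvgM (cf x Vx) (ch x Vx)).
move=> cf1 ch1; have [[df cf] [dh ch]] := (cf1, ch1); split=> [x Vx|i].
  by apply: differentiableM; [exact: df|exact: dh].
have := Ck_onD oV (IH _ _ (Ck_onS cf1) (ch i)) (IH _ _ (Ck_onS ch1) (cf i)).
by apply: Ck_on_ext => // x Vx; rewrite pderivM //; [exact: df|exact: dh].
Qed.

Lemma Ck_on_sum k V (I : Type) (r : seq I) (F : I -> E -> R) : open V ->
  (forall i, Ck_on k V (F i)) -> Ck_on k V (fun x => \sum_(i <- r) F i x).
Proof.
move=> oV cF; elim: r => [|i r IH].
  by apply: Ck_on_ext (Ck_on_cst k V 0) => // x _; rewrite big_nil.
by apply: Ck_on_ext (Ck_onD oV (cF i) IH) => // x _; rewrite big_cons.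
Qed.

(** The derivative of 1/f is - f' (1/f)^2, so order [k.+1] needs only order [k] of the reciprocal
    itself and the induction closes. *)
Lemma Ck_onV k V f : open V -> (forall x, V x -> f x != 0) ->
  Ck_on k V f -> Ck_on k V (fun x => (f x)^-1).
Proof.
move=> oV f0; elim: k => [|k IH].
  by move=> cf x Vx; exact: (cvgV (f0 x Vx) (cf x Vx)).
move=> cf1; have [df cf] := cf1; split=> [x Vx|i].
  by apply: differentiableV; [exact: df|exact: f0].
have IH' := IH (Ck_onS cf1).
have := Ck_onM oV (Ck_onM oV (Ck_on_cst k V (-1)) (cf i)) (Ck_onM oV IH' IH').
apply: Ck_on_ext => // x Vx; rewrite /pderiv deriveV.
- by rewrite -[RHS]/(- _ * _) expr2 invfM; ring.
- exact: f0.
- exact/diff_derivable/df.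
Qed.

(** Same scheme as for the reciprocal, with derivative f' / (2 sqrt f). It serves the volume density
    [vol]. *)
Lemma Ck_on_sqrt k V f : open V -> (forall x, V x -> 0 < f x) ->
  Ck_on k V f -> Ck_on k V (fun x => Num.sqrt (f x)).
Proof.
move=> oV f0; elim: k => [|k IH].
  move=> cf x Vx; apply: (@continuous_comp _ _ _ f (@Num.sqrt R)).
    exact: cf.
  exact: sqrt_continuous.
have dsq (y : R) : 0 < y -> differentiable (@Num.sqrt R : R -> R) y.
  by move=> /is_derive1_sqrt[ds _]; exact/derivable1_diffP.
move=> cf1; have [df cf] := cf1; split=> [x Vx|i].
  exact: (@differentiable_comp _ _ _ _ f (@Num.sqrt R) x (df x Vx) (dsq _ (f0 x Vx))).
have nz x : V x -> 2 * Num.sqrt (f x) != 0.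
  by move=> Vx; rewrite mulf_neq0 ?pnatr_eq0 // gt_eqF // sqrtr_gt0 f0.
have := Ck_onM oV (cf i)
  (Ck_onV oV nz (Ck_onM oV (Ck_on_cst k V 2) (IH (Ck_onS cf1)))).
apply: Ck_on_ext => // x Vx; have fx := f0 x Vx.
rewrite /pderiv [RHS]deriveE; last first.
  exact: (@differentiable_comp _ _ _ _ f (@Num.sqrt R) x (df x Vx) (dsq _ fx)).
rewrite (@diff_comp _ _ _ _ f (@Num.sqrt R) x (df x Vx) (dsq _ fx)) /=.
rewrite (diff1E (dsq _ fx)) /= derive1E -deriveE; last exact: df.
by case: (is_derive1_sqrt fx) => _ ->.
Qed.

Lemma Ck_on_comp k V W phi h : open V -> open W ->
  (forall x, V x -> W (phi x)) ->
  (forall j, Ck_on k V (fun x => phi x 0 j)) -> Ck_on k W h ->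
  Ck_on k V (h \o phi).
Proof.
move=> oV oW VW; elim: k h => [|k IH] h.
  move=> cphi ch x Vx; apply: continuous_comp; last exact/ch/VW.
  by apply: continuous_row => j; exact: cphi.
move=> cphi1 [dh ch].
have dphi x : V x -> forall j, differentiable (fun y => phi y 0 j) x.
  by move=> Vx j; have [+ _] := cphi1 j; apply.
split=> [x Vx|i].
  by apply: differentiable_comp; [exact/differentiable_row/dphi|exact/dh/VW].
have : Ck_on k V (fun x =>
    \sum_j pderiv (fun y => phi y 0 j) i x * (pderiv h j \o phi) x).
  apply: Ck_on_sum => // j; apply: Ck_onM => //; first exact: (cphi1 j).2.
  by apply: IH => [l|]; [exact: Ck_onS|exact: ch].
apply: Ck_on_ext => // x Vx; rewrite pderiv_comp //; first exact: dphi.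
exact/dh/VW.
Qed.

End Calculus.

(** * Smooth functions on a manifold *)

Section Manifold.
Variables (R : realType) (M : oriented_manifold R).
Implicit Types (c : chart R M) (U V : set M) (f h : M -> R) (p q : M).

Lemma cdom_open c : atlas c -> open (cdom c).
Proof. by case/atlas_chart. Qed.

Lemma cmapK c p : atlas c -> cdom c p -> cinv c (cmap c p) = p.
Proof. by case/atlas_chart => _ _ H _ _; exact: H. Qed.

Lemma near_cinv c U p : atlas c -> open U -> cdom c p -> U p ->
  \forall x \near cmap c p, [/\ U (cinv c x), cdom c (cinv c x) &
    cmap c (cinv c x) = x].
Proof.
move=> ac oU cp Up; have [oc om cK _ ci] := atlas_chart ac.
have mp : (cmap c @` cdom c) (cmap c p) by exists p.
have nU : nbhs (cinv c (cmap c p)) (U `&` cdom c).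
  rewrite cmapK //; apply: open_nbhs_nbhs; split=> //.
  exact: openI.
have := ci _ mp _ nU; rewrite nbhs_filterE => nV.
have nm := open_nbhs_nbhs (conj om mp).
near=> x; have [Ux cx] : (U `&` cdom c) (cinv c x) by near: x.
have [q cq xE] : (cmap c @` cdom c) x by near: x.
by move: Ux cx; rewrite -xE cK.
Unshelve. all: by end_near.
Qed.


Lemma chart_image_open c U : atlas c -> open U ->
  open (cmap c @` (U `&` cdom c)).
Proof.
move=> ac oU; rewrite openE => _ [p [Up cp] <-]; rewrite /interior.
apply: filterS (near_cinv ac oU cp Up) => x [Ux cx xE].
by exists (cinv c x).
Qed.

Lemma chart_imageP c U x : atlas c -> (cmap c @` (U `&` cdom c)) x ->
  [/\ U (cinv c x), cdom c (cinv c x) & cmap c (cinv c x) = x].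
Proof. by move=> ac [p [Up cp] <-]; rewrite cmapK. Qed.

Lemma smooth_on_chart U f :
  (forall p, U p -> exists c V, [/\ atlas c, open V, V p, V `<=` cdom c &
     Cinf_on (cmap c @` V) (f \o cinv c)]) -> smooth_on U f.
Proof.
move=> H c' ac' k; apply: Ck_on_local => _ [p [Up c'p] <-].
have [c [V [ac oV Vp Vc cf]]] := H p Up.
have oW := chart_image_open ac' oV.
have VE : V = V `&` cdom c.
  by apply/seteqP; split=> [q Vq|q []//]; split=> //; exact: Vc.
exists (cmap c' @` (V `&` cdom c')); split=> //; first by exists p.
have : Ck_on k (cmap c' @` (V `&` cdom c'))
    ((f \o cinv c) \o (cmap c \o cinv c')).
  apply: (@Ck_on_comp _ k _ (cmap c @` V)) => //.
  - by rewrite VE; exact: chart_image_open.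
  - by move=> x /(chart_imageP ac')[Vx _ _]; exists (cinv c' x).
  - move=> j; apply: Ck_on_sub (atlas_smooth ac' ac j k) => _ [q [Vq c'q] <-].
    by exists q => //; split=> //; exact: Vc.
apply: Ck_on_ext => // x /(chart_imageP ac')[Vx _ _] /=.
by rewrite cmapK //; exact: Vc.
Qed.

Lemma smooth_on_sub U V f : V `<=` U -> smooth_on U f -> smooth_on V f.
Proof.
move=> VU sf c ac k; apply: Ck_on_sub (sf c ac k) => _ [p [Vp cp] <-].
by exists p => //; split=> //; exact: VU.
Qed.

Lemma smooth_on_local U f :
  (forall p, U p -> exists V, [/\ open V, V p & smooth_on V f]) ->
  smooth_on U f.
Proof.
move=> H c ac k; apply: Ck_on_local => _ [p [Up cp] <-].
have [V [oV Vp sf]] := H p Up; exists (cmap c @` (V `&` cdom c)); split.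
- exact: chart_image_open.
- by exists p.
- exact: sf.
Qed.

Lemma smooth_on_ext U f h : open U -> (forall p, U p -> f p = h p) ->
  smooth_on U f -> smooth_on U h.
Proof.
move=> oU fh sf c ac k; apply: Ck_on_ext (sf c ac k).
  exact: chart_image_open.
by move=> x /(chart_imageP ac)[Ux _ _] /=; exact: fh.
Qed.

Lemma smooth_on_cst U (a : R) : smooth_on U (fun=> a : R).
Proof. by move=> c ac k; exact: Ck_on_cst. Qed.

Lemma smooth_onD U f h : open U -> smooth_on U f -> smooth_on U h ->
  smooth_on U (fun p => f p + h p).
Proof.
move=> oU sf sh c ac k.
exact: (Ck_onD (chart_image_open ac oU) (sf c ac k) (sh c ac k)).
Qed.

Lemma smooth_onM U f h : open U -> smooth_on U f -> smooth_on U h ->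
  smooth_on U (fun p => f p * h p).
Proof.
move=> oU sf sh c ac k.
exact: (Ck_onM (chart_image_open ac oU) (sf c ac k) (sh c ac k)).
Qed.

Lemma smooth_onZ U f (a : R) : open U -> smooth_on U f ->
  smooth_on U (fun p => a * f p).
Proof. by move=> oU; apply: smooth_onM => //; exact: smooth_on_cst. Qed.

Lemma smooth_onN U f : open U -> smooth_on U f -> smooth_on U (fun p => - f p).
Proof.
move=> oU /(smooth_onZ (-1) oU); apply: smooth_on_ext => // p _.
by rewrite mulN1r.
Qed.

Lemma smooth_onB U f h : open U -> smooth_on U f -> smooth_on U h ->
  smooth_on U (fun p => f p - h p).
Proof. by move=> oU sf sh; apply: smooth_onD => //; exact: smooth_onN. Qed.

Lemma smooth_on_sum U (I : Type) (r : seq I) (F : I -> M -> R) : open U ->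
  (forall i, smooth_on U (F i)) -> smooth_on U (fun p => \sum_(i <- r) F i p).
Proof.
move=> oU sF; elim: r => [|i r IH].
  by apply: smooth_on_ext (smooth_on_cst U 0) => // p _; rewrite big_nil.
by apply: smooth_on_ext (smooth_onD oU (sF i) IH) => // p _; rewrite big_cons.
Qed.

Lemma smooth_on_prod U (I : Type) (r : seq I) (F : I -> M -> R) : open U ->
  (forall i, smooth_on U (F i)) -> smooth_on U (fun p => \prod_(i <- r) F i p).
Proof.
move=> oU sF; elim: r => [|i r IH].
  by apply: smooth_on_ext (smooth_on_cst U 1) => // p _; rewrite big_nil.
by apply: smooth_on_ext (smooth_onM oU (sF i) IH) => // p _; rewrite big_cons.
Qed.

Lemma smooth_onV U f : open U -> (forall p, U p -> f p != 0) ->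
  smooth_on U f -> smooth_on U (fun p => (f p)^-1).
Proof.
move=> oU f0 sf c ac k; apply: Ck_onV (sf c ac k).
  exact: chart_image_open.
by move=> x /(chart_imageP ac)[Ux _ _]; exact: f0.
Qed.

Lemma smooth_on_sqrt U f : open U -> (forall p, U p -> 0 < f p) ->
  smooth_on U f -> smooth_on U (fun p => Num.sqrt (f p)).
Proof.
move=> oU f0 sf c ac k; apply: Ck_on_sqrt (sf c ac k).
  exact: chart_image_open.
by move=> x /(chart_imageP ac)[Ux _ _]; exact: f0.
Qed.

Lemma smooth_on_differentiable c U f p : atlas c -> cdom c p -> U p ->
  smooth_on U f -> differentiable (f \o cinv c) (cmap c p).
Proof. by move=> ac cp Up sf; apply: (sf c ac 1).1; exists p. Qed.

Lemma smooth_on_continuous U f p : open U -> U p -> smooth_on U f ->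
  {for p, continuous f}.
Proof.
move=> oU Up sf; have ac := chart_at_atlas p; have cp := chart_at_dom p.
have [_ _ _ cm _] := atlas_chart ac.
have cf : {for p, continuous ((f \o cinv (chart_at p)) \o cmap (chart_at p))}.
  apply: continuous_comp; first exact: cm.
  exact/differentiable_continuous/(smooth_on_differentiable ac cp Up sf).
suff nE : {near p, (f \o cinv (chart_at p)) \o cmap (chart_at p) =1 f}.
  have E : (f \o cinv (chart_at p) \o cmap (chart_at p)) p = f p.
    by rewrite /= cmapK.
  have {}cf : (f \o cinv (chart_at p) \o cmap (chart_at p)) @ p --> f p.
    by rewrite -E; exact: cf.
  by apply: cvg_trans cf; apply: near_eq_cvg; apply: filterS nE => q /= ->.
apply: filterS (open_nbhs_nbhs (conj (cdom_open ac) cp)) => q cq /=.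
by rewrite cmapK.
Qed.

(** The chart is kept fixed while the point varies, which makes the derivative a smooth function of
    the point; [pd] is the case where [c] is [chart_at p]. *)
Definition cpd c f (i : 'I_3) p : R := pderiv (f \o cinv c) i (cmap c p).

Lemma smooth_cpd c U f i : atlas c -> open U -> smooth_on U f ->
  smooth_on (U `&` cdom c) (cpd c f i).
Proof.
move=> ac oU sf; apply: smooth_on_chart => p [Up cp].
exists c, (U `&` cdom c); split=> //; first exact: openI (cdom_open ac).
move=> k; have := (sf c ac k.+1).2 i; apply: Ck_on_ext.
  exact: chart_image_open.
by move=> x /(chart_imageP ac)[_ _ xE]; rewrite /cpd /= xE.
Qed.

Lemma smooth_cmap c j : atlas c -> smooth_on (cdom c) (fun p => cmap c p 0 j).
Proof.
move=> ac; apply: smooth_on_chart => p cp; exists c, (cdom c); split=> //.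
  exact: cdom_open.
have oW := chart_image_open ac (cdom_open ac).
rewrite setIid in oW.
move=> k; apply: Ck_on_ext (Ck_on_coord k _ j) => // _ [q cq <-] /=.
by rewrite cmapK.
Qed.

Lemma jacE c c' p i j : jac c c' p i j = cpd c (fun q => cmap c' q 0 j) i p.
Proof. by rewrite mxE. Qed.

Lemma cpd_near c U f h i p : atlas c -> open U -> cdom c p -> U p ->
  (forall q, U q -> cdom c q -> f q = h q) -> cpd c f i p = cpd c h i p.
Proof.
move=> ac oU cp Up fh; apply: near_eq_derive.
by apply: filterS (near_cinv ac oU cp Up) => x [Ux cx _] /=; exact: fh.
Qed.

Lemma cpd_change c c' U f i p : atlas c -> atlas c' -> open U ->
  smooth_on U f -> U p -> cdom c p -> cdom c' p ->
  cpd c f i p = \sum_j jac c c' p i j * cpd c' f j p.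
Proof.
move=> ac ac' oU sf Up cp c'p; pose phi := cmap c' \o cinv c.
have phip : phi (cmap c p) = cmap c' p by rewrite /phi /= cmapK.
transitivity (pderiv ((f \o cinv c') \o phi) i (cmap c p)).
  apply: near_eq_derive.
  apply: filterS (near_cinv ac (cdom_open ac') cp c'p) => x [c'x _ _].
  by rewrite /phi /= cmapK.
rewrite pderiv_comp; first by rewrite phip; apply: eq_bigr => j _; rewrite mxE.
- move=> j; exact: (smooth_on_differentiable ac cp c'p (smooth_cmap j ac')).
- by rewrite phip; exact: (smooth_on_differentiable ac' c'p Up sf).
Qed.

(** The cocycle rule is [cpd_change] applied to the coordinate functions of [c'']. *)
Lemma jac_comp c c' c'' p : atlas c -> atlas c' -> atlas c'' ->
  cdom c p -> cdom c' p -> cdom c'' p ->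
  jac c c' p *m jac c' c'' p = jac c c'' p.
Proof.
move=> ac ac' ac'' cp c'p c''p; apply/matrixP => i j.
rewrite mxE jacE (cpd_change i ac ac' (cdom_open ac'') (smooth_cmap j ac'')) //.
by apply: eq_bigr => l _; rewrite -jacE.
Qed.

Lemma jac_id c p : atlas c -> cdom c p -> jac c c p = 1%:M.
Proof.
move=> ac cp; apply/matrixP => i j; rewrite !mxE -(pderiv_coord i j (cmap c p)).
apply: near_eq_derive.
by apply: filterS (near_cinv ac (cdom_open ac) cp cp) => x [_ _ ->].
Qed.

Lemma smooth_jac c c' i j : atlas c -> atlas c' ->
  smooth_on (cdom c' `&` cdom c) (fun p => jac c c' p i j).
Proof.
move=> ac ac'; have oU := openI (cdom_open ac') (cdom_open ac).
apply: smooth_on_ext (smooth_cpd i ac (cdom_open ac') (smooth_cmap j ac')) => //.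
by move=> p _; rewrite jacE.
Qed.

Section Cpd.
Variables (c : chart R M) (U : set M) (p : M).
Hypotheses (ac : atlas c) (cp : cdom c p) (Up : U p).

Lemma cpdD f h i : smooth_on U f -> smooth_on U h ->
  cpd c (fun q => f q + h q) i p = cpd c f i p + cpd c h i p.
Proof.
by move=> sf sh; apply: pderivD; exact: (smooth_on_differentiable ac cp Up).
Qed.

Lemma cpdM f h i : smooth_on U f -> smooth_on U h ->
  cpd c (fun q => f q * h q) i p = f p * cpd c h i p + h p * cpd c f i p.
Proof.
move=> sf sh; rewrite /cpd [LHS]pderivM /= ?cmapK //.
all: exact: (smooth_on_differentiable ac cp Up).
Qed.

End Cpd.

End Manifold.

(** * Tensor fields *)

Section MatrixFields.
Variables (R : realType) (M : oriented_manifold R) (U : set M).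
Hypothesis oU : open U.

Definition smooth_mx m n (A : M -> 'M[R]_(m, n)) : Prop :=
  forall i j, smooth_on U (fun q => A q i j).

Lemma smooth_mx_ext m n (A B : M -> 'M[R]_(m, n)) :
  (forall p, U p -> A p = B p) -> smooth_mx A -> smooth_mx B.
Proof.
by move=> AB sA i j; apply: smooth_on_ext (sA i j) => // p Up; rewrite AB.
Qed.

Lemma smooth_mx_cst m n (A : 'M[R]_(m, n)) : smooth_mx (fun=> A).
Proof. by move=> i j; exact: smooth_on_cst. Qed.

Lemma smooth_mxD m n (A B : M -> 'M[R]_(m, n)) :
  smooth_mx A -> smooth_mx B -> smooth_mx (fun p => A p + B p).
Proof.
move=> sA sB i j; apply: smooth_on_ext (smooth_onD oU (sA i j) (sB i j)) => //.
by move=> p _; rewrite mxE.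
Qed.

Lemma smooth_mxZ m n (f : M -> R) (A : M -> 'M[R]_(m, n)) :
  smooth_on U f -> smooth_mx A -> smooth_mx (fun p => f p *: A p).
Proof.
move=> sf sA i j; apply: smooth_on_ext (smooth_onM oU sf (sA i j)) => //.
by move=> p _; rewrite mxE.
Qed.

Lemma smooth_mxT m n (A : M -> 'M[R]_(m, n)) :
  smooth_mx A -> smooth_mx (fun p => (A p)^T).
Proof.
move=> sA i j; apply: smooth_on_ext (sA j i) => //.
by move=> p _; rewrite mxE.
Qed.

Lemma smooth_mxM m n l (A : M -> 'M[R]_(m, n)) (B : M -> 'M[R]_(n, l)) :
  smooth_mx A -> smooth_mx B -> smooth_mx (fun p => A p *m B p).
Proof.
move=> sA sB i j.
have := smooth_on_sum (index_enum 'I_n) oU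
  (fun k => smooth_onM oU (sA i k) (sB k j)).
by apply: smooth_on_ext => // p _; rewrite mxE.
Qed.

Lemma smooth_det n (A : M -> 'M[R]_n) :
  smooth_mx A -> smooth_on U (fun p => \det (A p)).
Proof.
move=> sA; apply: smooth_on_sum => // s; apply: smooth_onZ => //.
by apply: smooth_on_prod => // i; exact: sA.
Qed.

(** Cramer's rule: the entries of the inverse are cofactors divided by the determinant. *)
Lemma smooth_invmx n (A : M -> 'M[R]_n) : (forall p, U p -> A p \in unitmx) ->
  smooth_mx A -> smooth_mx (fun p => invmx (A p)).
Proof.
move=> uA sA; apply: (@smooth_mx_ext _ _
    (fun p => (\det (A p))^-1 *: \adj (A p))) => [p Up|].
  by rewrite /invmx uA.
apply: smooth_mxZ.
  apply: smooth_onV => //; last exact: smooth_det.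
  by move=> p Up; have := uA p Up; rewrite unitmxE unitfE.
move=> i j; have sC : smooth_on U (fun p => cofactor (A p) j i).
  apply: smooth_onZ => //; apply: smooth_det => k l.
  apply: smooth_on_ext (sA (lift j k) (lift i l)) => // p _.
  by rewrite !mxE.
by apply: smooth_on_ext sC => // p _; rewrite mxE.
Qed.

End MatrixFields.

(** * Vector fields, forms and bilinear forms in charts *)

Section Tensors.
Variables (R : realType) (M : oriented_manifold R).
Implicit Types (c : chart R M) (U : set M) (p q : M).

(** On vector components, [mto c q] passes from [c] to the preferred chart of [q], and [mof c q]
    passes back; on covectors their transposes act in the opposite directions. *)
Definition mto c q := jac c (chart_at q) q.
Definition mof c q := jac (chart_at q) c q.

Lemma mtoK c q : atlas c -> cdom c q -> mto c q *m mof c q = 1%:M.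
Proof.
move=> ac cq; rewrite /mto /mof jac_comp ?jac_id //.
  exact: chart_at_atlas.
exact: chart_at_dom.
Qed.

Lemma mofK c q : atlas c -> cdom c q -> mof c q *m mto c q = 1%:M.
Proof. by move=> ac cq; apply: mulmx1C; exact: mtoK. Qed.

Lemma mto_id p : mto (chart_at p) p = 1%:M.
Proof. by rewrite /mto jac_id //; [exact: chart_at_atlas|exact: chart_at_dom]. Qed.

Lemma mof_id p : mof (chart_at p) p = 1%:M.
Proof. by rewrite /mof jac_id //; [exact: chart_at_atlas|exact: chart_at_dom]. Qed.

Lemma form_in_id (a : oneform M) p : form_in (chart_at p) a p = a p.
Proof. by rewrite /form_in -/(mto _ _) mto_id trmx1 mulmx1. Qed.

Lemma vf_in_id (X : vfield M) p : vf_in (chart_at p) X p = X p.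
Proof. by rewrite /vf_in -/(mof _ _) mof_id mulmx1. Qed.

Lemma smooth_formP U (a : oneform M) : smooth_form U a <->
  forall c, atlas c -> smooth_mx (U `&` cdom c) (form_in c a).
Proof.
split=> sa c ac; first by move=> i j; rewrite ord1; exact: sa.
by move=> j; exact: (sa c ac).
Qed.

Lemma smooth_vfP U (X : vfield M) : smooth_vf U X <->
  forall c, atlas c -> smooth_mx (U `&` cdom c) (vf_in c X).
Proof.
split=> sX c ac; first by move=> i j; rewrite ord1; exact: sX.
by move=> j; exact: (sX c ac).
Qed.

Section OpenSet.
Variable U : set M.
Hypothesis oU : open U.

Let oUc c : atlas c -> open (U `&` cdom c).
Proof. by move=> ac; exact: openI oU (cdom_open ac). Qed.

Lemma smooth_formD (a b : oneform M) : smooth_form U a -> smooth_form U b ->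
  smooth_form U (fun p => a p + b p).
Proof.
move=> /smooth_formP sa /smooth_formP sb; apply/smooth_formP => c ac.
apply: (smooth_mx_ext (oUc ac) _ (smooth_mxD (oUc ac) (sa c ac) (sb c ac))).
by move=> p _; rewrite /form_in mulmxDl.
Qed.

Lemma smooth_formZ (f : M -> R) (a : oneform M) :
  smooth_on U f -> smooth_form U a -> smooth_form U (fun p => f p *: a p).
Proof.
move=> sf /smooth_formP sa; apply/smooth_formP => c ac.
have sf' : smooth_on (U `&` cdom c) f by apply: smooth_on_sub sf => q [].
apply: (smooth_mx_ext (oUc ac) _ (smooth_mxZ (oUc ac) sf' (sa c ac))).
by move=> p _; rewrite /form_in scalemxAl.
Qed.

Lemma smooth_form_ext (a b : oneform M) : (forall p, U p -> a p = b p) ->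
  smooth_form U a -> smooth_form U b.
Proof.
move=> ab /smooth_formP sa; apply/smooth_formP => c ac.
apply: (smooth_mx_ext (oUc ac) _ (sa c ac)).
by move=> p [Up _]; rewrite /form_in ab.
Qed.

Lemma smooth_vfD (X Y : vfield M) : smooth_vf U X -> smooth_vf U Y ->
  smooth_vf U (fun p => X p + Y p).
Proof.
move=> /smooth_vfP sX /smooth_vfP sY; apply/smooth_vfP => c ac.
apply: (smooth_mx_ext (oUc ac) _ (smooth_mxD (oUc ac) (sX c ac) (sY c ac))).
by move=> p _; rewrite /vf_in mulmxDl.
Qed.

Lemma smooth_vfZ (f : M -> R) (X : vfield M) :
  smooth_on U f -> smooth_vf U X -> smooth_vf U (fun p => f p *: X p).
Proof.
move=> sf /smooth_vfP sX; apply/smooth_vfP => c ac.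
have sf' : smooth_on (U `&` cdom c) f by apply: smooth_on_sub sf => q [].
apply: (smooth_mx_ext (oUc ac) _ (smooth_mxZ (oUc ac) sf' (sX c ac))).
by move=> p _; rewrite /vf_in scalemxAl.
Qed.

Lemma smooth_on_cover (f : M -> R) :
  (forall c, atlas c -> smooth_on (U `&` cdom c) f) -> smooth_on U f.
Proof.
move=> H; apply: smooth_on_local => p Up.
have ac := chart_at_atlas p.
exists (U `&` cdom (chart_at p)); split; [exact: oUc| |exact: H].
by split=> //; exact: chart_at_dom.
Qed.

Lemma contract_in c (a : oneform M) (X : vfield M) p : atlas c -> cdom c p ->
  form_in c a p *m (vf_in c X p)^T = a p *m (X p)^T.
Proof.
move=> ac cp; rewrite /form_in /vf_in trmx_mul mulmxA -(mulmxA (a p)) -trmx_mul.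
by rewrite -/(mto c p) -/(mof c p) mofK // trmx1 mulmx1.
Qed.

Lemma smooth_contract (a : oneform M) (X : vfield M) :
  smooth_form U a -> smooth_vf U X ->
  smooth_on U (fun p => (a p *m (X p)^T) 0 0).
Proof.
move=> /smooth_formP sa /smooth_vfP sX; apply: smooth_on_cover => c ac.
have := smooth_mxM (oUc ac) (sa c ac) (smooth_mxT (oUc ac) (sX c ac)).
move=> /(_ 0 0); apply: smooth_on_ext => // [|p [_ cp]]; first exact: oUc.
by rewrite contract_in.
Qed.

Lemma bilin_contract_in c (b : bilin M) (X : vfield M) p :
  atlas c -> cdom c p ->
  bilin_in c b p *m (vf_in c X p)^T = (form_in c (fun q => (b q *m (X q)^T)^T) p)^T.
Proof.
move=> ac cp; rewrite /form_in /bilin_in /vf_in !trmx_mul !trmxK !mulmxA.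
rewrite -/(mto c p) -/(mof c p).
move: (mto c p) (mof c p) (mofK ac cp) => J K KJ.
by rewrite -(mulmxA (J *m b p)) -trmx_mul KJ trmx1 mulmx1.
Qed.

Lemma smooth_bilin_contract (b : bilin M) (X : vfield M) :
  smooth_bilin U b -> smooth_vf U X ->
  smooth_form U (fun p => (b p *m (X p)^T)^T).
Proof.
move=> sb /smooth_vfP sX; apply/smooth_formP => c ac.
have := smooth_mxT (oUc ac) (smooth_mxM (oUc ac) (sb c ac)
  (smooth_mxT (oUc ac) (sX c ac))).
apply: smooth_mx_ext; first exact: oUc.
by move=> p [_ cp]; rewrite bilin_contract_in // trmxK.
Qed.

Lemma bilin_in_tens c (a b : oneform M) p :
  bilin_in c (fun q => tens (a q) (b q)) p = tens (form_in c a p) (form_in c b p).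
Proof. by rewrite /bilin_in /tens /form_in trmx_mul trmxK !mulmxA. Qed.

Lemma smooth_tens (a b : oneform M) : smooth_form U a -> smooth_form U b ->
  smooth_bilin U (fun p => tens (a p) (b p)).
Proof.
move=> /smooth_formP sa /smooth_formP sb c ac.
apply: (smooth_mx_ext (oUc ac) _
  (smooth_mxM (oUc ac) (smooth_mxT (oUc ac) (sa c ac)) (sb c ac))).
by move=> p _; rewrite bilin_in_tens.
Qed.

Lemma smooth_bilinD (a b : bilin M) : smooth_bilin U a -> smooth_bilin U b ->
  smooth_bilin U (fun p => a p + b p).
Proof.
move=> sa sb c ac.
apply: (smooth_mx_ext (oUc ac) _ (smooth_mxD (oUc ac) (sa c ac) (sb c ac))).
by move=> p _; rewrite /bilin_in mulmxDr mulmxDl.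
Qed.

Lemma smooth_bilinZ (f : M -> R) (a : bilin M) :
  smooth_on U f -> smooth_bilin U a -> smooth_bilin U (fun p => f p *: a p).
Proof.
move=> sf sa c ac.
have sf' : smooth_on (U `&` cdom c) f by apply: smooth_on_sub sf => q [].
apply: (smooth_mx_ext (oUc ac) _ (smooth_mxZ (oUc ac) sf' (sa c ac))).
by move=> p _; rewrite /bilin_in -scalemxAr -scalemxAl.
Qed.

Lemma smooth_dfun (f : M -> R) : smooth_on U f -> smooth_form U (dfun f).
Proof.
move=> sf; apply/smooth_formP => c ac i j.
apply: smooth_on_ext (smooth_cpd j ac oU sf); first exact: oUc.
move=> p [Up cp]; rewrite !mxE.
rewrite (cpd_change j ac (chart_at_atlas p) oU sf Up cp (chart_at_dom p)).
by apply: eq_bigr => l _; rewrite !mxE mulrC.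
Qed.

End OpenSet.

Lemma smooth_form_sub U V (a : oneform M) : V `<=` U ->
  smooth_form U a -> smooth_form V a.
Proof.
move=> VU sa c ac j; apply: smooth_on_sub (sa c ac j) => q [Vq cq].
by split=> //; exact: VU.
Qed.

Lemma smooth_vf_sub U V (X : vfield M) : V `<=` U ->
  smooth_vf U X -> smooth_vf V X.
Proof.
move=> VU sX c ac j; apply: smooth_on_sub (sX c ac j) => q [Vq cq].
by split=> //; exact: VU.
Qed.

Lemma smooth_coord_vf c j : atlas c -> smooth_vf (cdom c) (coord_vf c j).
Proof.
move=> ac; apply/smooth_vfP => c' ac' i l; rewrite ord1.
apply: smooth_on_ext (smooth_on_sub _ (smooth_jac j l ac ac')).
- exact: openI (cdom_open ac) (cdom_open ac').
- move=> p [cp c'p]; rewrite /vf_in /coord_vf -mulmxA jac_comp //.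
  + by rewrite -rowE /row [RHS]mxE.
  + exact: chart_at_atlas.
  + exact: chart_at_dom.
- by move=> q [].
Qed.

Lemma vf_in_coord c j p : atlas c -> cdom c p ->
  vf_in c (coord_vf c j) p = delta_mx 0 j.
Proof. by move=> ac cp; rewrite /vf_in /coord_vf -mulmxA mtoK // mulmx1. Qed.

Definition coord_form c (j : 'I_3) : oneform M :=
  fun q => (delta_mx 0 j : 'rV[R]_3) *m (jac (chart_at q) c q)^T.

Lemma smooth_coord_form c j : atlas c -> smooth_form (cdom c) (coord_form c j).
Proof.
move=> ac; apply/smooth_formP => c' ac' i l; rewrite ord1.
apply: smooth_on_ext (smooth_on_sub _ (smooth_jac l j ac' ac)).
- exact: openI (cdom_open ac) (cdom_open ac').
- move=> p [cp c'p]; rewrite /form_in /coord_form -mulmxA -trmx_mul jac_comp //.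
  + by rewrite -rowE /row [RHS]mxE [RHS]mxE.
  + exact: chart_at_atlas.
  + exact: chart_at_dom.
- by move=> q [].
Qed.

Lemma coord_vf_id p j : coord_vf (chart_at p) j p = delta_mx 0 j.
Proof. by rewrite /coord_vf -/(mto _ _) mto_id mulmx1. Qed.

End Tensors.

(** * The inverse of a Lorentzian metric *)

Section Metric.
Variables (R : realType) (M : oriented_manifold R) (g : bilin M).
Hypothesis lg : lorentzian g.
Implicit Types (c : chart R M) (U : set M) (p q : M).

Lemma lorentzian_sym p : (g p)^T = g p.
Proof. by case: lg. Qed.

Lemma det_eta : \det (eta R) = -1.
Proof.
rewrite det_diag !big_ord_recl big_ord0 !mxE /= !mul1r mulr1.
by [].
Qed.

(** Taking determinants in [P *m g p *m P^T = eta R] gives (det P)^2 det g = -1. *)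
Lemma det_lorentzian_lt0 p : \det (g p) < 0.
Proof.
have [_ _ /(_ p)[P uP gP]] := lg.
have := congr1 determinant gP; rewrite !det_mulmx det_tr det_eta => E.
rewrite -(@pmulr_rlt0 _ ((\det P) ^+ 2)).
  by rewrite expr2 mulrAC E oppr_lt0.
by rewrite exprn_even_gt0 //= -unitfE -unitmxE.
Qed.

Lemma lorentzian_unit p : g p \in unitmx.
Proof. by rewrite unitmxE unitfE lt_eqF // det_lorentzian_lt0. Qed.

Lemma lorentzian_inv_sym p : (invmx (g p))^T = invmx (g p).
Proof. by rewrite trmx_inv lorentzian_sym. Qed.

Lemma invmx_bilin_in c p : atlas c -> cdom c p ->
  invmx (bilin_in c g p) = (mof c p)^T *m invmx (g p) *m mof c p.
Proof.
move=> ac cp; have mm := mtoK ac cp; have mm' := mofK ac cp.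
rewrite /bilin_in -/(mto c p).
move: (mto c p) (mof c p) mm mm' (lorentzian_unit p) => J K JK KJ ug.
have AB : J *m g p *m J^T *m (K^T *m invmx (g p) *m K) = 1%:M.
  rewrite !mulmxA -(mulmxA (J *m g p)) -trmx_mul KJ trmx1 mulmx1.
  by rewrite -(mulmxA J) mulmxV // mulmx1.
have [uA _] := mulmx1_unit AB.
by rewrite -[RHS](mulKmx uA) AB mulmx1.
Qed.

End Metric.

(** * Connections *)

Lemma row_dotC (R : realType) n (x y : 'rV[R]_n) : x *m y^T = y *m x^T.
Proof.
apply/matrixP => i j; rewrite !ord1 !mxE.
by apply: eq_bigr => k _; rewrite !mxE mulrC.
Qed.

Section Connections.
Variables (R : realType) (M : oriented_manifold R).
Variable D : vfield M -> M -> 'M[R]_3.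
Implicit Types (c : chart R M) (U : set M) (p q : M) (a b : oneform M)
  (X Y : vfield M).

Lemma cpd_dfun f p i : dfun f p 0 i = cpd (chart_at p) f i p.
Proof. by rewrite mxE. Qed.

Lemma eq_dfun f h p : f =1 h -> @dfun _ M f p = dfun h p.
Proof. by move=> /funext ->. Qed.

Lemma dfun_near U f h p : open U -> U p -> (forall q, U q -> f q = h q) ->
  @dfun _ M f p = dfun h p.
Proof.
move=> oU Up fh; apply/rowP => i; rewrite !cpd_dfun.
apply: (cpd_near i (chart_at_atlas p) oU (chart_at_dom p) Up) => q Uq _.
exact: fh.
Qed.

Lemma dfunD U f h p : U p -> smooth_on U f -> smooth_on U h ->
  @dfun _ M (fun q => f q + h q) p = dfun f p + dfun h p.
Proof.
move=> Up sf sh; apply/rowP => i; rewrite [RHS]mxE !cpd_dfun.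
exact: (cpdD (chart_at_atlas p) (chart_at_dom p) Up).
Qed.

Lemma dfunM U f h p : U p -> smooth_on U f -> smooth_on U h ->
  @dfun _ M (fun q => f q * h q) p = f p *: dfun h p + h p *: dfun f p.
Proof.
move=> Up sf sh; apply/rowP => i; rewrite !mxE.
exact: (cpdM (chart_at_atlas p) (chart_at_dom p) Up).
Qed.

Lemma dfun_cst (x : R) p : @dfun _ M (fun=> x) p = 0.
Proof. by apply/rowP => i; rewrite !mxE; exact: pderiv_cst. Qed.

Lemma dual_conn_near U a b p : open U -> U p -> (forall q, U q -> a q = b q) ->
  dual_conn D a p = dual_conn D b p.
Proof.
move=> oU Up ab; apply/matrixP => i j; rewrite !mxE ab //; congr (_ - _).
apply: (cpd_near i (chart_at_atlas p) oU (chart_at_dom p) Up) => q Uq _.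
by rewrite /form_in ab.
Qed.

Lemma smooth_form_at U a p j : smooth_form U a ->
  smooth_on (U `&` cdom (chart_at p)) (fun q => form_in (chart_at p) a q 0 j).
Proof. by move=> sa; exact: (sa _ (chart_at_atlas p)). Qed.

Lemma dual_connD U a b p : U p -> smooth_form U a -> smooth_form U b ->
  dual_conn D (fun q => a q + b q) p = dual_conn D a p + dual_conn D b p.
Proof.
move=> Up sa sb; apply/matrixP => i j; rewrite !mxE.
have Up' : (U `&` cdom (chart_at p)) p by split=> //; exact: chart_at_dom.
under eq_bigr do rewrite mxE mulrDr.
have -> : (fun q => form_in (chart_at p) (fun q => a q + b q) q 0 j) =
   (fun q => form_in (chart_at p) a q 0 j + form_in (chart_at p) b q 0 j).
  by apply/funext => q; rewrite /form_in mulmxDl mxE.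
rewrite [pd _ _ _](cpdD (chart_at_atlas p) (chart_at_dom p) Up');
  [|exact: smooth_form_at..].
by rewrite big_split /= /cpd /pd; ring.
Qed.

Lemma dual_connZ U f a p : U p -> smooth_on U f -> smooth_form U a ->
  dual_conn D (fun q => f q *: a q) p =
  tens (dfun f p) (a p) + f p *: dual_conn D a p.
Proof.
move=> Up sf sa; apply/matrixP => i j; rewrite !mxE big_ord1 !mxE.
have Up' : (U `&` cdom (chart_at p)) p by split=> //; exact: chart_at_dom.
have sf' : smooth_on (U `&` cdom (chart_at p)) f.
  by apply: smooth_on_sub sf => q [].
under eq_bigr do rewrite mxE mulrCA.
have -> : (fun q => form_in (chart_at p) (fun q => f q *: a q) q 0 j) =
   (fun q => f q * form_in (chart_at p) a q 0 j).
  by apply/funext => q; rewrite /form_in -scalemxAl mxE.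
rewrite [pd _ _ _](cpdM (chart_at_atlas p) (chart_at_dom p) Up') //;
  last exact: smooth_form_at.
by rewrite form_in_id -mulr_sumr /cpd /pd; ring.
Qed.

Hypothesis cD : is_connection D.

(** The Leibniz rule yields locality. The difference [Z] vanishes on [U], so [Z = chi Z] with [chi]
    equal to 0 on [U] and 1 elsewhere. This cut-off may jump at the boundary of [U], but it is
    smooth on [U], which is all that the rule over [U] asks for. *)
Lemma conn_near U X Y p : open U -> U p -> smooth_vf U X -> smooth_vf U Y ->
  (forall q, U q -> X q = Y q) -> D X p = D Y p.
Proof.
move=> oU Up sX sY XY; have [_ DD DZ] := cD oU.
pose Z q := Y q + (-1) *: X q.
have sZ : smooth_vf U Z by apply: smooth_vfD => //; apply: smooth_vfZ => //;
  exact: smooth_on_cst.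
have Z0 q : U q -> Z q = 0 by move=> Uq; rewrite /Z XY // scaleN1r subrr.
pose chi q : R := if `[< U q >] then 0 else 1.
have chi0 q : U q -> chi q = 0 by rewrite /chi => Uq; case: asboolP.
have sc : smooth_on U chi.
  by apply: smooth_on_ext (smooth_on_cst U 0) => // q /chi0.
have ZE : Z = (fun q => chi q *: Z q).
  apply/funext => q; rewrite /chi; case: asboolP => [/Z0 ->|_].
    by rewrite scaler0.
  by rewrite scale1r.
have -> : Y = (fun q => X q + Z q).
  by apply/funext => q; rewrite /Z scaleN1r addrC subrK.
rewrite DD // {1}ZE DZ // Z0 // chi0 // scale0r addr0 /tens mulmx0 addr0.
by [].
Qed.

Lemma smooth_vf0 U : open U -> smooth_vf U (fun=> 0).
Proof.
move=> oU; apply/smooth_vfP => c ac.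
apply: smooth_mx_ext (smooth_mx_cst _ (0 : 'rV[R]_3)).
  exact: openI (cdom_open ac).
by move=> p _; rewrite /vf_in mul0mx.
Qed.

Lemma conn0 U p : open U -> U p -> D (fun=> 0) p = 0.
Proof.
move=> oU Up; have [_ _ DZ] := cD oU.
have := DZ (fun=> 0) (fun=> 0) (smooth_on_cst U 0) (smooth_vf0 oU) p Up.
under [X in D X]eq_fun do rewrite scaler0.
by rewrite /tens mulmx0 add0r scale0r.
Qed.

Lemma smooth_vf_sum U (r : seq 'I_3) (F : 'I_3 -> vfield M) : open U ->
  (forall j, smooth_vf U (F j)) -> smooth_vf U (fun q => \sum_(j <- r) F j q).
Proof.
move=> oU sF; elim: r => [|j r IH].
  rewrite (_ : (fun q => _) = (fun=> 0)); first exact: smooth_vf0.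
  by apply/funext => q; rewrite big_nil.
rewrite (_ : (fun q => _) = (fun q => F j q + \sum_(l <- r) F l q)).
  exact: smooth_vfD.
by apply/funext => q; rewrite big_cons.
Qed.

Lemma conn_sum U (r : seq 'I_3) (F : 'I_3 -> vfield M) p : open U -> U p ->
  (forall j, smooth_vf U (F j)) ->
  D (fun q => \sum_(j <- r) F j q) p = \sum_(j <- r) D (F j) p.
Proof.
move=> oU Up sF; elim: r => [|j r IH].
  rewrite big_nil -(conn0 oU Up); congr (D _ _).
  by apply/funext => q; rewrite big_nil.
have [_ DD _] := cD oU.
rewrite big_cons -IH -(DD _ _ (sF j) (smooth_vf_sum r oU sF) p Up).
by congr (D _ _); apply/funext => q; rewrite big_cons.
Qed.

Lemma vf_coord_sum c X q : atlas c -> cdom c q ->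
  X q = \sum_j vf_in c X q 0 j *: coord_vf c j q.
Proof.
move=> ac cq; have E := row_sum_delta (vf_in c X q).
have -> : X q = vf_in c X q *m jac c (chart_at q) q.
  by rewrite /vf_in -mulmxA -/(mto c q) -/(mof c q) mofK // mulmx1.
rewrite {1}E mulmx_suml; apply: eq_bigr => j _.
by rewrite -scalemxAl.
Qed.

Lemma smooth_vf_at U X p j : smooth_vf U X ->
  smooth_on (U `&` cdom (chart_at p)) (fun q => vf_in (chart_at p) X q 0 j).
Proof. by move=> sX; exact: (sX _ (chart_at_atlas p)). Qed.

(** Locality makes it legitimate to expand [X] in the coordinate fields, which are smooth only on
    the domain of the chart. *)
Lemma conn_coord U X p : open U -> U p -> smooth_vf U X ->
  D X p = \sum_j (tens (dfun (fun q => vf_in (chart_at p) X q 0 j) p)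
                   (delta_mx 0 j) + X p 0 j *: D (coord_vf (chart_at p) j) p).
Proof.
move=> oU Up sX; set c := chart_at p.
have ac : atlas c := chart_at_atlas p; have cp : cdom c p := chart_at_dom p.
have oV : open (U `&` cdom c) := openI oU (cdom_open ac).
have Vp : (U `&` cdom c) p by [].
have sc j : smooth_vf (U `&` cdom c) (coord_vf c j).
  by apply: smooth_vf_sub (smooth_coord_vf j ac) => q [].
have sx j := smooth_vf_at p j sX.
have sF j : smooth_vf (U `&` cdom c) (fun q => vf_in c X q 0 j *: coord_vf c j q).
  exact: smooth_vfZ.
rewrite (@conn_near _ X (fun q => \sum_j vf_in c X q 0 j *: coord_vf c j q)
  p oV Vp).
- rewrite (conn_sum _ oV Vp) //; apply: eq_bigr => j _.
  have [_ _ ->//] := cD oV.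
  by rewrite vf_in_id coord_vf_id.
- by apply: smooth_vf_sub sX => q [].
- exact: smooth_vf_sum.
- by move=> q [_ cq]; exact: vf_coord_sum.
Qed.

(** This frees [dual_conn] from the preferred chart used in its definition: the product rule for the
    pairing of a form and a field holds for every local field [Y], not only for coordinate
    fields. *)
Lemma dual_conn_contract U a Y p : open U -> U p ->
  smooth_form U a -> smooth_vf U Y ->
  dual_conn D a p *m (Y p)^T =
  (dfun (fun q => (a q *m (Y q)^T) 0 0) p)^T - D Y p *m (a p)^T.
Proof.
move=> oU Up sa sY; set c := chart_at p.
have ac : atlas c := chart_at_atlas p; have cp : cdom c p := chart_at_dom p.
have oV : open (U `&` cdom c) := openI oU (cdom_open ac).
have Vp : (U `&` cdom c) p by [].
pose al j q := form_in c a q 0 j; pose y j q := vf_in c Y q 0 j.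
have sal j : smooth_on (U `&` cdom c) (al j) := smooth_form_at p j sa.
have sy j : smooth_on (U `&` cdom c) (y j) := smooth_vf_at p j sY.
rewrite (conn_coord oU Up sY) -/c.
have -> : dfun (fun q => (a q *m (Y q)^T) 0 0) p =
    \sum_j (a p 0 j *: dfun (y j) p + Y p 0 j *: dfun (al j) p).
  rewrite (@dfun_near _ _ (fun q => \sum_j al j q * y j q) p oV Vp); last first.
    move=> q [_ cq]; rewrite -(contract_in a Y ac cq) mxE.
    by apply: eq_bigr => j _; congr (_ * _); rewrite mxE.
  transitivity (\sum_j dfun (fun q => al j q * y j q) p).
    elim: (index_enum _) => [|j r IH].
      rewrite big_nil -(dfun_cst 0 p); apply: eq_dfun => q.
      by rewrite big_nil.
    rewrite big_cons -IH -(dfunD Vp (smooth_onM oV (sal j) (sy j))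
      (smooth_on_sum r oV (fun l => smooth_onM oV (sal l) (sy l)))).
    by apply: eq_dfun => q; rewrite big_cons.
  apply: eq_bigr => j _; rewrite (dfunM Vp) //.
  by rewrite /al /y form_in_id vf_in_id.
rewrite mulmx_suml linear_sum /= -sumrB.
apply/colP => i; rewrite [LHS]mxE summxE.
apply: eq_bigr => j _; rewrite mulmxDl -scalemxAl !mxE.
have -> : \sum_k tens (dfun (y j) p) (delta_mx 0 j) i k * (a p)^T k 0 =
    pd p (y j) i * a p 0 j.
  rewrite (bigD1 j) //= big1 ?addr0 => [|l lj].
    by rewrite !mxE big_ord1 !mxE !eqxx mulr1.
  by rewrite !mxE big_ord1 !mxE (negbTE lj) andbF mulr0 mul0r.
have -> : \sum_k D (coord_vf c j) p i k * (a p)^T k 0 =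
    \sum_k D (coord_vf c j) p i k * a p 0 k.
  by apply: eq_bigr => k _; congr (_ * _); rewrite mxE.
by rewrite /al /y /pd; ring.
Qed.

Lemma bilin_mul_coord c (b : bilin M) q j :
  mto c q *m (b q *m (coord_vf c j q)^T) = col j (bilin_in c b q).
Proof.
by rewrite colE /bilin_in /coord_vf trmx_mul trmx_delta -/(mto c q) !mulmxA.
Qed.

(** The definition uses a chart that varies with the point. Contraction with the coordinate fields
    of a fixed chart [c] yields the columns of the components in [c], and [dual_conn_contract]
    expresses them through smooth data. *)
Lemma smooth_dual_conn U a : open U -> smooth_form U a ->
  smooth_bilin U (dual_conn D a).
Proof.
move=> oU sa c ac i j; have oV := openI oU (cdom_open ac).
set V := U `&` cdom c.
have sc : smooth_vf V (coord_vf c j).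
  by apply: smooth_vf_sub (smooth_coord_vf j ac) => q [].
have sa' : smooth_form V a by apply: smooth_form_sub sa => q [].
have sal := (smooth_formP V a).1 sa' c ac.
have VV : V `&` cdom c = V by rewrite /V -setIA setIid.
rewrite VV in sal.
have [DS _ _] := cD oV.
have sE : smooth_mx V (endo_in c (D (coord_vf c j))).
  by have := DS _ sc c ac; rewrite VV.
have /smooth_formP/(_ c ac) := smooth_dfun oV (sal 0 j).
rewrite VV => sd.
have := smooth_mxD oV (smooth_mxT oV sd) (smooth_mxZ oV (smooth_on_cst V (-1))
  (smooth_mxM oV sE (smooth_mxT oV sal))).
move=> /(_ i 0); apply: smooth_on_ext => // p Vp; have [Up cp] := Vp.
have -> : bilin_in c (dual_conn D a) p i j = col j (bilin_in c (dual_conn D a) p) i 0.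
  by rewrite [RHS]mxE.
rewrite -bilin_mul_coord (dual_conn_contract oV Vp sa' sc) mulmxBr scaleN1r.
congr (fun_of_matrix (_ - _) i 0).
  rewrite /form_in trmx_mul trmxK; congr (_ *m _^T).
  apply: (dfun_near oV Vp) => q [_ cq].
  rewrite -(contract_in a _ ac cq) vf_in_coord // trmx_delta -colE.
  by rewrite [RHS]mxE.
rewrite /endo_in /form_in trmx_mul trmxK -!mulmxA.
by rewrite (mulmxA (jac _ _ _) (jac _ _ _)) -/(mto c p) -/(mof c p) mofK // mul1mx.
Qed.

Lemma lie_coord i j p : lie (coord_vf (chart_at p) i) (coord_vf (chart_at p) j) p = 0.
Proof.
apply/rowP => k; rewrite !mxE big1 // => l _.
have H m : pd p (fun q => vf_in (chart_at p) (coord_vf (chart_at p) m) q 0 k) l = 0.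
  rewrite -(pderiv_cst ((delta_mx 0 m : 'rV[R]_3) 0 k) l (cmap (chart_at p) p)).
  have ac := chart_at_atlas p; have cp := chart_at_dom p.
  apply: (@cpd_near _ _ (chart_at p) _ _ (fun=> (delta_mx 0 m : 'rV[R]_3) 0 k)
    l p ac (cdom_open ac) cp cp) => q cq _.
  by rewrite vf_in_coord.
by rewrite !H !mulr0 subrr.
Qed.

Lemma torsion_coord i j p :
  torsion D (coord_vf (chart_at p) i) (coord_vf (chart_at p) j) p =
  row i (D (coord_vf (chart_at p) j) p) - row j (D (coord_vf (chart_at p) i) p).
Proof. by rewrite /torsion lie_coord subr0 !coord_vf_id -!rowE. Qed.

(** On coordinate fields, zero torsion is the symmetry of the Christoffel symbols, which therefore
    cancel under antisymmetrisation. *)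
Lemma torsion_free_dform a p :
  (forall U, open U -> forall X Y, smooth_vf U X -> smooth_vf U Y ->
   forall p, U p -> torsion D X Y p = 0) ->
  dual_conn D a p - (dual_conn D a p)^T = dform a p.
Proof.
move=> tf; apply/matrixP => i j; rewrite !mxE.
suff -> : \sum_k D (coord_vf (chart_at p) j) p i k * a p 0 k =
   \sum_k D (coord_vf (chart_at p) i) p j k * a p 0 k by ring.
have ac := chart_at_atlas p.
have := tf _ (cdom_open ac) _ _ (smooth_coord_vf i ac) (smooth_coord_vf j ac) p
  (chart_at_dom p).
rewrite torsion_coord => /rowP E; apply: eq_bigr => k _; congr (_ * _).
by have := E k; rewrite !mxE => /eqP; rewrite subr_eq0 => /eqP.
Qed.

End Connections.

(** * Metric connections and the raising of indices *)

Section MetricConnections.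
Variables (R : realType) (M : oriented_manifold R) (g : bilin M).
Hypothesis lg : lorentzian g.
Implicit Types (c : chart R M) (U : set M) (p q : M) (a b : oneform M).

Definition sharp a : vfield M := fun p => a p *m invmx (g p).

Lemma smooth_sharp U a : open U -> smooth_form U a -> smooth_vf U (sharp a).
Proof.
move=> oU /smooth_formP sa; apply/smooth_vfP => c ac.
have oV := openI oU (cdom_open ac).
have [sg _ _] := lg.
have ub p : (U `&` cdom c) p -> bilin_in c g p \in unitmx.
  move=> [_ cp]; rewrite /bilin_in -/(mto c p) !unitmx_mul unitmx_tr.
  by rewrite (lorentzian_unit lg) (mulmx1_unit (mtoK ac cp)).1.
have sg' : smooth_mx (U `&` cdom c) (bilin_in c g).
  by move=> i j; apply: smooth_on_sub (sg c ac i j) => q [].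
have := smooth_mxM oV (sa c ac) (smooth_invmx oV ub sg').
apply: smooth_mx_ext => // p [_ cp].
rewrite invmx_bilin_in // /form_in /vf_in /sharp -/(mto c p) -/(mof c p).
rewrite -!mulmxA (mulmxA (mto c p)^T) -trmx_mul mofK // trmx1 mul1mx.
by rewrite !mulmxA.
Qed.

Lemma smooth_flat U (X : vfield M) : open U -> smooth_vf U X ->
  smooth_form U (fun p => X p *m g p).
Proof.
move=> oU sX; have [sg _ _] := lg.
have sg' : smooth_bilin U g.
  by move=> c ac i j; apply: smooth_on_sub (sg c ac i j) => q [_ ].
apply: smooth_form_ext (smooth_bilin_contract oU sg' sX) => // p _.
by rewrite trmx_mul trmxK (lorentzian_sym lg).
Qed.

Lemma gdot_sharp a b p : gdot g p (sharp a p) (sharp b p) = cogdot g p (a p) (b p).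
Proof.
rewrite /gdot /cogdot /sharp trmx_mul (lorentzian_inv_sym lg) -!mulmxA.
by rewrite (mulmxA (invmx _) (g p)) mulVmx ?(lorentzian_unit lg) // mul1mx.
Qed.

Lemma smooth_cogdot U a b : open U -> smooth_form U a -> smooth_form U b ->
  smooth_on U (fun p => cogdot g p (a p) (b p)).
Proof.
move=> oU sa sb.
apply: smooth_on_ext (smooth_contract oU sa (smooth_sharp oU sb)) => // p _.
by rewrite /sharp trmx_mul (lorentzian_inv_sym lg) mulmxA.
Qed.

Variable D : vfield M -> M -> 'M[R]_3.
Hypothesis mD : metric_connection g D.

(** A metric connection commutes with lowering an index: the function a(Y) = g([sharp a], Y) is
    differentiated once by the dual rule and once by metric compatibility. *)
Lemma metric_dual_conn U a p : open U -> U p -> smooth_form U a ->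
  dual_conn D a p = D (sharp a) p *m g p.
Proof.
move=> oU Up sa; have [cD mm] := mD.
apply: trmx_inj; apply/row_matrixP => j.
rewrite -!tr_col !colE; congr trmx.
have ac := chart_at_atlas p; have cp := chart_at_dom p.
set V := U `&` cdom (chart_at p); have oV : open V := openI oU (cdom_open ac).
have Vp : V p by [].
have sY : smooth_vf V (coord_vf (chart_at p) j).
  by apply: smooth_vf_sub (smooth_coord_vf j ac) => q [].
have sa' : smooth_form V a by apply: smooth_form_sub sa => q [].
have := dual_conn_contract cD oV Vp sa' sY.
rewrite coord_vf_id trmx_delta => ->.
apply/matrixP => i k; rewrite ord1 {k}.
have := mm V oV _ _ (smooth_sharp oV sa') sY p Vp (delta_mx 0 i).
rewrite -rowE /gdot coord_vf_id => E.
have dE : dfun (fun q => (sharp a q *m g q *m (coord_vf (chart_at p) j q)^T) 0 0) p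
  = dfun (fun q => (a q *m (coord_vf (chart_at p) j q)^T) 0 0) p.
  apply: eq_dfun => q.
  by rewrite /sharp -(mulmxA (a q)) mulVmx ?(lorentzian_unit lg) // mulmx1.
move: E; rewrite dE [(row i _) 0 0]mxE => E.
rewrite mxE E [X in _ + X = _]mxE.
have -> : sharp a p *m g p = a p.
  by rewrite /sharp -mulmxA mulVmx ?(lorentzian_unit lg) // mulmx1.
have -> : (a p *m ((delta_mx 0 i : 'rV[R]_3) *m D (coord_vf (chart_at p) j) p)^T) 0 0 =
  (D (coord_vf (chart_at p) j) p *m (a p)^T) i 0.
  rewrite row_dotC -mulmxA -rowE.
  by rewrite /row [LHS]mxE.
rewrite addrK trmx_delta -rowE -!row_mul /row [LHS]mxE.
by [].
Qed.

(** Metric compatibility on covectors, obtained from that on vectors by raising both forms. *)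
Lemma metric_dual_connC U a b p : open U -> U p ->
  smooth_form U a -> smooth_form U b ->
  (dfun (fun q => cogdot g q (a q) (b q)) p)^T =
  dual_conn D a p *m invmx (g p) *m (b p)^T +
  dual_conn D b p *m invmx (g p) *m (a p)^T.
Proof.
move=> oU Up sa sb; have [cD mm] := mD.
rewrite (metric_dual_conn oU Up sa) (metric_dual_conn oU Up sb).
rewrite -!(mulmxA (D _ p) (g p)) mulmxV ?(lorentzian_unit lg) // !mulmx1.
have E w := mm U oU _ _ (smooth_sharp oU sa) (smooth_sharp oU sb) p Up w.
apply/colP => i; have := E (delta_mx 0 i).
have -> : (fun q => gdot g q (sharp a q) (sharp b q)) =
  (fun q => cogdot g q (a q) (b q)) by apply/funext => q; exact: gdot_sharp.
rewrite -rowE [(row i _) 0 0]mxE => ->.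
rewrite /gdot /sharp [RHS]mxE; congr (_ + _).
  rewrite trmx_mul (lorentzian_inv_sym lg) -!mulmxA (mulmxA (g p)).
  rewrite mulmxV ?(lorentzian_unit lg) // mul1mx -rowE.
  by rewrite /row [LHS]mxE.
rewrite -(mulmxA (a p)) mulVmx ?(lorentzian_unit lg) // mulmx1.
rewrite row_dotC -mulmxA -rowE.
by rewrite /row [LHS]mxE.
Qed.

End MetricConnections.

(** * Linear algebra in dimension three *)

Section Algebra3.
Variable R : realType.
Implicit Types (x y z a b w : 'rV[R]_3) (A B G h : 'M[R]_3).

Lemma sum3E (V : nmodType) (F : 'I_3 -> V) :
  \sum_i F i = F 0 + (F 1 + F 2%:R).
Proof.
rewrite !big_ord_recl big_ord0 addr0; congr (F _ + (F _ + F _)).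
all: exact: val_inj.
Qed.

Lemma ord3P (i : 'I_3) : [\/ i = 0, i = 1 | i = 2%:R].
Proof.
case: i => [[|[|[|//]]] ilt].
- by apply: Or31; exact: val_inj.
- by apply: Or32; exact: val_inj.
- by apply: Or33; exact: val_inj.
Qed.

Lemma row3P x y :
  x 0 0 = y 0 0 -> x 0 1 = y 0 1 -> x 0 2%:R = y 0 2%:R -> x = y.
Proof. by move=> *; apply/rowP => i; case: (ord3P i) => ->. Qed.

Lemma det3E A : \det A =
  A 0 0 * (A 1 1 * A 2%:R 2%:R - A 1 2%:R * A 2%:R 1)
  - A 0 1 * (A 1 0 * A 2%:R 2%:R - A 1 2%:R * A 2%:R 0)
  + A 0 2%:R * (A 1 0 * A 2%:R 1 - A 1 1 * A 2%:R 0).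
Proof.
rewrite (expand_det_row A 0) sum3E /cofactor.
have d2 (m : 'M[R]_2) : \det m = m 0 0 * m 1 1 - m 0 1 * m 1 0.
  rewrite (expand_det_row m 0) !big_ord_recl big_ord0 addr0 /cofactor !det_mx11.
  rewrite !mxE /= expr0 expr1 mul1r.
  rewrite (_ : lift 0 (0 : 'I_1) = 1); last exact: val_inj.
  rewrite (_ : lift 1 (0 : 'I_1) = 0); last exact: val_inj.
  by rewrite (_ : ord0 = 0) //; ring.
rewrite !d2 !mxE /=.
have l00 : lift (0 : 'I_3) (0 : 'I_2) = 1 by exact: val_inj.
have l01 : lift (0 : 'I_3) (1 : 'I_2) = 2%:R by exact: val_inj.
have l10 : lift (1 : 'I_3) (0 : 'I_2) = 0 by exact: val_inj.
have l11 : lift (1 : 'I_3) (1 : 'I_2) = 2%:R by exact: val_inj.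
have l20 : lift (2%:R : 'I_3) (0 : 'I_2) = 0 by exact: val_inj.
have l21 : lift (2%:R : 'I_3) (1 : 'I_2) = 1 by exact: val_inj.
rewrite !l00 !l01 !l10 !l11 !l20 !l21 /=.
rewrite (_ : (0 + 2 %% 3)%N = 2) // expr0 expr1 -signr_odd expr0.
ring.
Qed.

Definition cross x y : 'rV[R]_3 := \row_i
  (if i == 0 then x 0 1 * y 0 2%:R - x 0 2%:R * y 0 1
   else if i == 1 then x 0 2%:R * y 0 0 - x 0 0 * y 0 2%:R
   else x 0 0 * y 0 1 - x 0 1 * y 0 0).

(** The cofactor identity. With [A] a Jacobian it is the transformation law of the cross product;
    with [A] the metric it lowers its index. *)
Lemma cross_mul x y A :
  cross (x *m A) (y *m A) *m A^T = \det A *: cross x y.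
Proof. by apply: row3P; rewrite det3E !(mxE, sum3E) /=; ring. Qed.

Lemma cross_dot x y a b : (cross x y *m (cross a b)^T) 0 0 =
  (x *m a^T) 0 0 * (y *m b^T) 0 0 - (x *m b^T) 0 0 * (y *m a^T) 0 0.
Proof. by rewrite !(mxE, sum3E) /=; ring. Qed.

Lemma cross_orthl x y : (cross x y *m x^T) 0 0 = 0.
Proof. by rewrite !(mxE, sum3E) /=; ring. Qed.

Lemma cross_orthr x y : (cross x y *m y^T) 0 0 = 0.
Proof. by rewrite !(mxE, sum3E) /=; ring. Qed.

(** Both sides are the value B(x, y): wedging with the cross product amounts to contracting with the
    bivector of [x] and [y]. The trace form is the one that appears in [cogdot2]. *)
Lemma wedge21_skew (B : 'M[R]_3) x y : B^T = - B ->
  wedge21 B (cross x y) = 2^-1 * \tr (B *m (y^T *m x - x^T *m y)).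
Proof.
move=> /matrixP skB.
have E i j : B i j = - B j i by have := skB j i; rewrite !mxE.
have D i : B i i = 0 by have := E i i; lra.
rewrite /wedge21 /mxtrace !(mxE, sum3E, big_ord1) /= !D.
rewrite (E 1 0) (E 2%:R 1) (E 0 2%:R).
by field.
Qed.

Definition dot h x y : R := (x *m h *m y^T) 0 0.

Definition null_gram h x y z : Prop :=
  [/\ dot h x x = 0, dot h x y = 1 & dot h y y = 0] /\
  [/\ dot h z z = 1, dot h x z = 0 & dot h y z = 0].

Lemma dotC h x y : h^T = h -> dot h x y = dot h y x.
Proof. by move=> hs; rewrite /dot row_dotC trmx_mul hs mulmxA. Qed.

Definition frame3 x y z : 'I_3 -> 'rV[R]_3 :=
  fun i => if i == 0 then x else if i == 1 then y else z.

(** With [h] the inverse metric, this is the value of the covariant tensor [B] on the vectors dual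
    to the covectors [x] and [y]. For a covariant derivative, [x] is the direction of
    differentiation. *)
Definition bil h B x y : R := (x *m h *m B *m h *m y^T) 0 0.

Lemma bil_tens h a b x y : bil h (tens a b) x y = dot h x a * dot h b y.
Proof.
rewrite /bil /tens /dot !mulmxA -(mulmxA _ b h) -(mulmxA _ (b *m h)).
by rewrite [LHS]mxE big_ord1.
Qed.

Lemma bilD h A B x y : bil h (A + B) x y = bil h A x y + bil h B x y.
Proof. by rewrite /bil mulmxDr !mulmxDl mxE. Qed.

Lemma bilN h A x y : bil h (- A) x y = - bil h A x y.
Proof. by rewrite /bil mulmxN !mulNmx mxE. Qed.

Lemma bilZ h (k : R) A x y : bil h (k *: A) x y = k * bil h A x y.
Proof. by rewrite /bil -scalemxAr -!scalemxAl mxE. Qed.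

Lemma bilT h A x y : h^T = h -> bil h A^T x y = bil h A y x.
Proof.
by move=> hs; rewrite /bil row_dotC !trmx_mul !trmxK hs !mulmxA.
Qed.

Definition bilE := (bilD, bilN, bilZ).

Section NullFrame.
Variables (h : 'M[R]_3) (u v n : 'rV[R]_3).
Hypotheses (hs : h^T = h) (gr : null_gram h u v n).

Lemma null_frame_complete : h *m (tens v u + tens u v + tens n n) = 1%:M.
Proof.
have [[uu uv vv] [nn un vn]] := gr.
pose P : 'M[R]_3 := \matrix_i frame3 u v n i.
pose G0 : 'M[R]_3 := \matrix_i frame3 (delta_mx 0 1) (delta_mx 0 0) (delta_mx 0 2%:R) i.
have PE i j : (P *m h *m P^T) i j = dot h (frame3 u v n i) (frame3 u v n j).
  rewrite -[frame3 _ _ _ i]rowK -[frame3 _ _ _ j]rowK -/P /dot -row_mul.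
  by rewrite [LHS]mxE [RHS]mxE; apply: eq_bigr => k _; rewrite !mxE.
have PG : P *m h *m P^T = G0.
  apply/matrixP => i j; rewrite PE.
  by case: (ord3P i) => ->; case: (ord3P j) => ->; rewrite !mxE //= dotC.
have G02 : G0 *m G0 = 1%:M.
  apply/matrixP => i j; rewrite !mxE sum3E !mxE.
  case: (ord3P i) => ->; case: (ord3P j) => -> /=; rewrite !mxE /=; lra.
have -> : tens v u + tens u v + tens n n = P^T *m G0 *m P.
  apply/matrixP => i j; rewrite !(mxE, sum3E, big_ord1) /= /frame3 /=.
  ring.
have E : P *m h *m (P^T *m G0) = 1%:M by rewrite mulmxA PG.
by apply: mulmx1C; rewrite -(mulmxA _ P h); exact: (mulmx1C E).
Qed.

Lemma null_frame_ext (A B : 'M[R]_3) :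
  (forall i j, bil h A (frame3 u v n i) (frame3 u v n j) =
               bil h B (frame3 u v n i) (frame3 u v n j)) -> A = B.
Proof.
move=> AB.
pose P : 'M[R]_3 := \matrix_i frame3 u v n i.
have [uh _] := mulmx1_unit null_frame_complete.
have uP : P \in unitmx.
  (* Completeness, written with [u] and [v] exchanged in one factor, exhibits [P] as a factor of an
     invertible product. *)
  pose G0 : 'M[R]_3 := \matrix_i frame3 v u n i.
  have E : h *m (G0^T *m P) = 1%:M.
    rewrite -null_frame_complete; congr (_ *m _); apply/matrixP => i j.
    by rewrite !(mxE, sum3E, big_ord1) /= /frame3 /=; ring.
  by rewrite mulmxA in E; have [] := mulmx1_unit E.
have uPh : P *m h \in unitmx by rewrite unitmx_mul uP uh.
have uPt : h *m P^T \in unitmx by rewrite unitmx_mul unitmx_tr uP uh.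
have PE C i j : (P *m h *m C *m (h *m P^T)) i j =
    bil h C (frame3 u v n i) (frame3 u v n j).
  rewrite -[frame3 _ _ _ i]rowK -[frame3 _ _ _ j]rowK -/P /bil -!row_mul.
  rewrite mulmxA [LHS]mxE [RHS]mxE [RHS]mxE.
  by apply: eq_bigr => k _; congr (_ * _); rewrite [LHS]mxE [RHS]mxE [RHS]mxE.
have : P *m h *m A *m (h *m P^T) = P *m h *m B *m (h *m P^T).
  by apply/matrixP => i j; rewrite !PE.
by move=> /(can_inj (mulmxK uPt))/(can_inj (mulKmx uPh)).
Qed.

(** A skew form on three vectors has three components, and the two that involve [u] vanish; only the
    one on [n] and [v] is left. *)
Lemma skew_null_wedge (B : 'M[R]_3) : B^T = - B -> B *m h *m u^T = 0 ->
  B = bil h B n v *: wedge n u.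
Proof.
move=> skB Bu; have [[uu uv vv] [nn un vn]] := gr.
have sk x y : bil h B x y = - bil h B y x.
  by rewrite -(bilT B) // skB bilN.
have d x : bil h B x x = 0 by have := sk x x; lra.
have xu x : bil h B x u = 0 by rewrite /bil -!mulmxA (mulmxA B) Bu !mulmx0 mxE.
apply: null_frame_ext => i j; rewrite /wedge !bilE !bil_tens.
case: (ord3P i) => ->; case: (ord3P j) => ->; rewrite /frame3 /=.
all: rewrite ?(dotC v u hs) ?(dotC n u hs) ?(dotC n v hs) ?uu ?uv ?vv ?nn ?un ?vn.
all: rewrite ?d ?xu ?(sk u) ?xu; try ring.
by rewrite (sk v n); ring.
Qed.

(* Koszul's argument for the uniqueness of the Levi-Civita connection. *)
Lemma sym_skew_eq0 (t : 'I_3 -> 'I_3 -> 'I_3 -> R) :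
  (forall i j k, t i j k = t k j i) -> (forall i j k, t i j k = - t i k j) ->
  forall i j k, t i j k = 0.
Proof.
move=> ts tk i j k.
have := tk i j k; rewrite (ts i k j) (tk j k i) (ts j i k) (tk k i j) (ts k j i).
lra.
Qed.

(** The derivative of a constant inner product of two covector fields with values [x] and [y] at the
    point, [A] and [B] being their covariant derivatives there. *)
Definition metric_pair (A B : 'M[R]_3) (x y : 'rV[R]_3) : Prop :=
  forall w, bil h A w y + bil h B w x = 0.

(** The three tensors are read as one array with three indices: the direction, the member of the
    frame that is differentiated, and the member on which the result is evaluated. Symmetry
    exchanges the first and third indices, compatibility makes the array skew in the last two. *)
Lemma covariant_unique (Eu Ev En : 'M[R]_3) :
  Eu^T = Eu -> Ev^T = Ev -> En^T = En ->
  metric_pair Eu Eu u u -> metric_pair Ev Ev v v -> metric_pair En En n n ->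
  metric_pair Eu Ev u v -> metric_pair Eu En u n -> metric_pair Ev En v n ->
  [/\ Eu = 0, Ev = 0 & En = 0].
Proof.
move=> su sv sn muu mvv mnn muv mun mvn.
pose E (i : 'I_3) := if i == 0 then Eu else if i == 1 then Ev else En.
have Es i : (E i)^T = E i by rewrite /E; case: (ord3P i) => ->.
have Em c i j : bil h (E i) (frame3 u v n c) (frame3 u v n j) =
    - bil h (E j) (frame3 u v n c) (frame3 u v n i).
  apply/eqP; rewrite -addr_eq0; apply/eqP; move: (frame3 u v n c) => w.
  case: (ord3P i) => ->; case: (ord3P j) => ->; rewrite /frame3 /E /=;
    [ exact: muu | exact: muv | exact: mun | rewrite addrC; exact: muv
    | exact: mvv | exact: mvn | rewrite addrC; exact: mun
    | rewrite addrC; exact: mvn | exact: mnn ].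
have E0 i : E i = 0.
  apply: null_frame_ext => c j.
  rewrite (_ : bil h 0 _ _ = 0); last by rewrite /bil mulmx0 !mul0mx mxE.
  apply: (sym_skew_eq0 (t := fun i j k =>
    bil h (E j) (frame3 u v n i) (frame3 u v n k))) => [i' j' k'|i' j' k'].
    by rewrite -{1}(Es j') bilT.
  exact: Em.
by split; [exact: (E0 0)|exact: (E0 1)|exact: (E0 2%:R)].
Qed.

(** The compatibility relations leave one free covector, k(w) = h(D_w v, n); every other component
    of [Nv] and [Nn] is zero or is read off from [Nu] or [k]. *)
Lemma covariant_of_metric (Nu Nv Nn : 'M[R]_3) (f : R) :
  Nu = f *: wedge n u -> metric_pair Nv Nv v v -> metric_pair Nn Nn n n ->
  metric_pair Nu Nv u v -> metric_pair Nu Nn u n -> metric_pair Nv Nn v n ->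
  let k := (Nv *m h *m n^T)^T in
  Nv = tens k n - f *: tens n v /\ Nn = f *: tens u v - tens k u.
Proof.
move=> Nu_ mvv mnn muv mun mvn k; have [[uu uv vv] [nn un vn]] := gr.
have kE w : dot h w k = bil h Nv w n.
  by rewrite /dot /k trmxK /bil !mulmxA.
have Nux w x : bil h Nu w x = f * (dot h w n * dot h u x - dot h w u * dot h n x).
  by rewrite Nu_ /wedge !bilE !bil_tens.
have vE w : bil h Nv w v = 0 by have := mvv w; lra.
have nE w : bil h Nn w n = 0 by have := mnn w; lra.
have vuE w : bil h Nv w u = - bil h Nu w v by have := muv w; lra.
have nuE w : bil h Nn w u = - bil h Nu w n by have := mun w; lra.
have nvE w : bil h Nn w v = - bil h Nv w n by have := mvn w; lra.
split; apply: null_frame_ext => i j; rewrite !bilE !bil_tens kE;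
  move: (frame3 u v n i) => w; case: (ord3P j) => ->; rewrite /frame3 /=;
  rewrite ?(vE, nE, vuE, nuE, nvE) ?Nux ?uu ?uv ?vv ?nn ?un ?vn
    ?(dotC v u hs) ?(dotC n u hs) ?(dotC n v hs) ?uu ?uv ?vv ?nn ?un ?vn; ring.
Qed.

End NullFrame.

(** In an orthonormal basis, with [a] for [x] and [b] for [t], nullity and orthogonality turn
    Lagrange's identity into a2^2 (b2^2 - b0^2 - b1^2) = - (a0 b1 - a1 b0)^2. The bracket on the
    left is positive, so a2 = 0, and nullity then kills a0 and a1. *)
Lemma timelike_null_orth (G P : 'M[R]_3) (x t : 'rV[R]_3) : P \in unitmx ->
  P *m G *m P^T = eta R -> (x *m G *m x^T) 0 0 = 0 ->
  (x *m G *m t^T) 0 0 = 0 -> (t *m G *m t^T) 0 0 < 0 -> x = 0.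
Proof.
move=> uP PG.
have E y z : (y *m G *m z^T) 0 0 =
    ((y *m invmx P) *m eta R *m (z *m invmx P)^T) 0 0.
  rewrite -PG trmx_mul !mulmxA mulmxKV // -[in RHS](mulmxA _ P^T) -trmx_mul.
  by rewrite mulVmx // trmx1 mulmx1.
rewrite !E; set a := x *m _; set b := t *m _ => xx xt tt.
have etaE (y z : 'rV[R]_3) : (y *m eta R *m z^T) 0 0 =
    y 0 0 * z 0 0 + y 0 1 * z 0 1 - y 0 2%:R * z 0 2%:R.
  by rewrite !(mxE, sum3E) /=; ring.
move: xx xt tt; rewrite !etaE => xx xt tt.
have a2 : a 0 2%:R = 0.
  move: (a 0 0) (a 0 1) (a 0 2%:R) (b 0 0) (b 0 1) (b 0 2%:R) xx xt tt.
  move=> a0 a1 a2 b0 b1 b2 xx xt tt.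
  have H : a2 ^+ 2 * (b2 ^+ 2 - b0 ^+ 2 - b1 ^+ 2) <= 0.
    have -> : a2 ^+ 2 * (b2 ^+ 2 - b0 ^+ 2 - b1 ^+ 2) = - (a0 * b1 - a1 * b0) ^+ 2.
      have e1 : a2 ^+ 2 = a0 ^+ 2 + a1 ^+ 2 by rewrite !expr2; lra.
      have e2 : (a2 * b2) ^+ 2 = (a0 * b0 + a1 * b1) ^+ 2 by congr (_ ^+ 2); lra.
      rewrite exprMn in e2.
      rewrite !mulrBr e2 e1; ring.
    by rewrite oppr_le0 sqr_ge0.
  have pos : 0 < b2 ^+ 2 - b0 ^+ 2 - b1 ^+ 2 by rewrite !expr2; lra.
  rewrite pmulr_lle0 // in H.
  by apply/eqP; rewrite -(sqrf_eq0 a2) eq_le H sqr_ge0.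
rewrite a2 in xx.
have sq0 (r s : R) : r * r + s * s = 0 -> r = 0.
  move=> /eqP; rewrite paddr_eq0 ?mulf_eq0 ?orbb -?expr2 ?sqr_ge0 //.
  by move=> /andP[/eqP].
have a0 : a 0 0 = 0 by apply: (sq0 _ (a 0 1)); lra.
have a1 : a 0 1 = 0 by apply: (sq0 _ (a 0 0)); lra.
have a_0 : a = 0 by apply: row3P; rewrite [RHS]mxE.
by rewrite -[x](mulmxKV uP) -/a a_0 mul0mx.
Qed.

End Algebra3.

(** * Null coframes *)

Section TensAlgebra.
Variable R : realType.
Implicit Types (a b c : 'rV[R]_3).

Lemma tensT a b : (tens a b)^T = tens b a.
Proof. by rewrite /tens trmx_mul trmxK. Qed.

Lemma tensDl a b c : tens (a + b) c = tens a c + tens b c.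
Proof. by rewrite /tens linearD mulmxDl. Qed.

Lemma tensZl (k : R) a b : tens (k *: a) b = k *: tens a b.
Proof. by rewrite /tens linearZ /= scalemxAl. Qed.

Lemma wedgeT a b : (wedge a b)^T = - wedge a b.
Proof. by rewrite /wedge linearB /= !tensT opprB. Qed.

End TensAlgebra.

Lemma metric_pairB (R : realType) (h A B A' B' : 'M[R]_3) (x y : 'rV[R]_3) :
  metric_pair h A B x y -> metric_pair h A' B' x y ->
  metric_pair h (A - A') (B - B') x y.
Proof.
by move=> AB AB' w; rewrite !bilE; have := AB w; have := AB' w; lra.
Qed.

Section NullCoframes.
Variables (R : realType) (M : oriented_manifold R) (g : bilin M).
Hypothesis lg : lorentzian g.
Implicit Types (p q : M) (u v n a b : oneform M).

Let hs p : (invmx (g p))^T = invmx (g p) := lorentzian_inv_sym lg p.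

Lemma cogdot2_wedge p (B : 'M[R]_3) u v : B^T = - B ->
  cogdot2 g p B (wedge (u p) (v p)) = wedge21 B (cross (sharp g u p) (sharp g v p)).
Proof.
move=> sB; rewrite wedge21_skew // /cogdot2; congr (_ * \tr _).
rewrite -!mulmxA; congr (_ *m _).
rewrite /wedge linearB /= !tensT mulmxBl mulmxBr /tens /sharp !trmx_mul !hs.
by rewrite !mulmxA.
Qed.

(** The dual is defined implicitly. Wedging with the three coordinate two-forms reads off the
    components of a one-form, so testing on them determines it. *)
Lemma hodge2_wedgeP u v (m : oneform M) :
  is_hodge2 g (fun p => wedge (u p) (v p)) m <->
  forall p, m p = vol g p *: cross (sharp g u p) (sharp g v p).
Proof.
have w21Z (B : 'M[R]_3) (k : R) (x : 'rV[R]_3) :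
    wedge21 B (k *: x) = wedge21 B x * k by rewrite /wedge21 !mxE; ring.
split=> [H p|H p B sB]; last by rewrite H w21Z cogdot2_wedge.
have E (i j : 'I_3) : let B := wedge (delta_mx 0 i) (delta_mx 0 j) : 'M[R]_3 in
    wedge21 B (m p) = wedge21 B (vol g p *: cross (sharp g u p) (sharp g v p)).
  move=> B; have sB : B^T = - B by exact: wedgeT.
  by rewrite H // w21Z cogdot2_wedge.
have W (x : 'rV[R]_3) :
    [/\ wedge21 (wedge (delta_mx 0 1) (delta_mx 0 2%:R)) x = x 0 0,
        wedge21 (wedge (delta_mx 0 2%:R) (delta_mx 0 0)) x = x 0 1 &
        wedge21 (wedge (delta_mx 0 0) (delta_mx 0 1)) x = x 0 2%:R].
  by split; rewrite /wedge21 /wedge /tens !(mxE, big_ord1) /=; ring.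
have [W0 W1 W2] := W (m p).
have [W0' W1' W2'] := W (vol g p *: cross (sharp g u p) (sharp g v p)).
apply: row3P.
- by rewrite -W0 E W0'.
- by rewrite -W1 E W1'.
- by rewrite -W2 E W2'.
Qed.

Lemma sqr_vol p : vol g p ^+ 2 = - \det (g p).
Proof.
have d := det_lorentzian_lt0 lg p.
by rewrite /vol sqr_sqrtr ?normr_ge0 // ltr0_norm.
Qed.

(** Two signs cancel in the norm of the third form: Lagrange's identity gives u.u v.v - (u.v)^2 =
    -1, and the square of [vol] is - det g. Orthogonality is that of the cross product to its
    factors. *)
Lemma cross_gram p u v :
  dot (invmx (g p)) (u p) (u p) = 0 -> dot (invmx (g p)) (u p) (v p) = 1 ->
  dot (invmx (g p)) (v p) (v p) = 0 ->
  null_gram (invmx (g p)) (u p) (v p)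
    (- (vol g p *: cross (sharp g u p) (sharp g v p))).
Proof.
move=> uu uv vv; have d := det_lorentzian_lt0 lg p.
set c := cross _ _; have d0 : \det (g p) != 0 by rewrite lt_eqF.
have sE a : sharp g a p *m g p = a p.
  by rewrite /sharp -mulmxA mulVmx ?(lorentzian_unit lg) // mulmx1.
have dE a b : (a p *m (sharp g b p)^T) 0 0 = dot (invmx (g p)) (a p) (b p).
  by rewrite /sharp trmx_mul hs mulmxA.
have ch : c *m invmx (g p) = (\det (g p))^-1 *: cross (u p) (v p).
  have := cross_mul (sharp g u p) (sharp g v p) (g p).
  rewrite !sE (lorentzian_sym lg) -/c => /(congr1 (fun x => x *m invmx (g p))).
  rewrite -mulmxA mulmxV ?(lorentzian_unit lg) // mulmx1 -scalemxAl => ->.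
  by rewrite scalerA mulVf // scale1r.
split; first by split.
split.
- rewrite /dot mulNmx linearN /= mulNmx mulmxN opprK -!scalemxAl linearZ /=.
  rewrite -scalemxAr ch -scalemxAl !mxE -/(cross _ _).
  have := cross_dot (u p) (v p) (sharp g u p) (sharp g v p).
  rewrite !dE uu uv vv (dotC _ _ (hs p)) uv mxE => ->.
  rewrite mul0r mulr1 sub0r mulrN1 mulrN mulrN mulrA -expr2 sqr_vol.
  by rewrite mulNr opprK divff.
- rewrite dotC // /dot mulNmx -scalemxAl mulNmx -!scalemxAl -(mulmxA c).
  have -> : invmx (g p) *m (u p)^T = (sharp g u p)^T by rewrite /sharp trmx_mul hs.
  by rewrite mxE [X in - X]mxE cross_orthl mulr0 oppr0.
- rewrite dotC // /dot mulNmx -scalemxAl mulNmx -!scalemxAl -(mulmxA c).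
  have -> : invmx (g p) *m (v p)^T = (sharp g v p)^T by rewrite /sharp trmx_mul hs.
  by rewrite mxE [X in - X]mxE cross_orthr mulr0 oppr0.
Qed.

Lemma null_coframe_gram u v n p : null_coframe g u v n ->
  null_gram (invmx (g p)) (u p) (v p) (n p).
Proof.
move=> [_ [_ uu] vv uv /hodge2_wedgeP H].
have -> : n p = - (vol g p *: cross (sharp g u p) (sharp g v p)).
  by rewrite -H opprK.
by apply: cross_gram; [exact: uu|exact: uv|exact: vv].
Qed.

(** [vol] is a density, not a function independent of the chart. In a chart [c] it becomes the
    square root of - det g, which differs from [vol] by the factor [\det (mto c p)]; this factor
    carries no absolute value because oriented charts have positive Jacobians, and it cancels
    against the one from [cross_mul]. *)
Lemma smooth_cross_form u v : smooth_form setT u -> smooth_form setT v ->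
  smooth_form setT
    (fun p => - (vol g p *: cross (sharp g u p) (sharp g v p))).
Proof.
move=> su sv; have [sg _ _] := lg; apply/smooth_formP => c ac.
have oc := cdom_open ac; rewrite setTI.
have sX (a : oneform M) : smooth_form setT a ->
    smooth_mx (cdom c) (vf_in c (sharp g a)).
  move=> /(smooth_sharp lg openT)/smooth_vfP/(_ c ac).
  by rewrite setTI.
have sgc : smooth_mx (cdom c) (bilin_in c g).
  by move=> i j; have := sg c ac i j; rewrite setTI.
have sd := smooth_det oc sgc.
have dJ p : cdom c p -> \det (bilin_in c g p) = \det (mto c p) ^+ 2 * \det (g p).
  by move=> cp; rewrite /bilin_in !det_mulmx det_tr expr2 -/(mto c p); ring.
have dJ0 p : cdom c p -> 0 < \det (mto c p).
  move=> cp; apply: (atlas_oriented ac (chart_at_atlas p)) => //.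
  exact: chart_at_dom.
have dn p : cdom c p -> 0 < - \det (bilin_in c g p).
  move=> cp; rewrite dJ // oppr_gt0 pmulr_rlt0 ?(det_lorentzian_lt0 lg) //.
  by rewrite exprn_gt0 // dJ0.
have sv' : smooth_on (cdom c) (fun p => Num.sqrt (- \det (bilin_in c g p))).
  by apply: smooth_on_sqrt => //; exact: smooth_onN.
have sc : smooth_mx (cdom c)
    (fun p => cross (vf_in c (sharp g u) p) (vf_in c (sharp g v) p)).
  move=> i j; have sx := sX u su 0; have sy := sX v sv 0.
  have sm (k l : 'I_3) : smooth_on (cdom c) (fun p =>
      vf_in c (sharp g u) p 0 k * vf_in c (sharp g v) p 0 l -
      vf_in c (sharp g u) p 0 l * vf_in c (sharp g v) p 0 k).
    exact: (smooth_onB oc (smooth_onM oc (sx k) (sy l)) (smooth_onM oc (sx l) (sy k))).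
  case: (ord3P j) => ->.
  - by rewrite ord1; apply: smooth_on_ext (sm 1 2%:R) => // p _; rewrite [RHS]mxE.
  - by rewrite ord1; apply: smooth_on_ext (sm 2%:R 0) => // p _; rewrite [RHS]mxE.
  - by rewrite ord1; apply: smooth_on_ext (sm 0 1) => // p _; rewrite [RHS]mxE.
have := smooth_mxZ oc (smooth_on_cst _ (-1)) (smooth_mxZ oc sv' sc).
apply: smooth_mx_ext => // p cp.
rewrite scaleN1r /form_in mulNmx -scalemxAl -/(mto c p); congr (- _).
have E := cross_mul (sharp g u p) (sharp g v p) (mof c p).
have KJ := mofK ac cp.
have -> : cross (vf_in c (sharp g u) p) (vf_in c (sharp g v) p) =
    \det (mof c p) *: (cross (sharp g u p) (sharp g v p) *m (mto c p)^T).
  rewrite scalemxAl -E -mulmxA -trmx_mul.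
  by rewrite mtoK // trmx1 mulmx1.
rewrite dJ // scalerA; congr (_ *: _).
have -> : - (\det (mto c p) ^+ 2 * \det (g p)) =
    \det (mto c p) ^+ 2 * `|\det (g p)|.
  by rewrite ltr0_norm ?mulrN // det_lorentzian_lt0.
rewrite sqrtrM ?sqr_ge0 // sqrtr_sqr gtr0_norm ?dJ0 // /vol mulrAC.
by rewrite -det_mulmx mtoK // det1 mul1r.
Qed.

Section Connection.
Variable D : vfield M -> M -> 'M[R]_3.
Hypothesis mD : metric_connection g D.

Lemma metric_pair_dual_conn a b p (k : R) :
  smooth_form setT a -> smooth_form setT b ->
  (forall q, cogdot g q (a q) (b q) = k) ->
  metric_pair (invmx (g p)) (dual_conn D a p) (dual_conn D b p) (a p) (b p).
Proof.
move=> sa sb ab w; have := metric_dual_connC lg mD openT (I : setT p) sa sb.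
have -> : (fun q => cogdot g q (a q) (b q)) = (fun=> k) by apply/funext.
rewrite dfun_cst trmx0 => /(congr1 (fun x => (w *m invmx (g p) *m x) 0 0)).
by rewrite mulmx0 mulmxDr !mulmxA [in LHS]mxE [in RHS]mxE => /esym.
Qed.

End Connection.

Variable nabla : vfield M -> M -> 'M[R]_3.
Hypothesis nlc : levi_civita g nabla.

(** Each equation is antisymmetrised. The tensor n /\ u is already skew and doubles, which accounts
    for the factor one half in front of du. *)
Lemma covariant_exterior u v n (f : M -> R) (kappa : oneform M) :
  covariant_system nabla u v n f kappa -> exterior_system u v n f kappa.
Proof.
move=> H p; have [Hu Hv Hn] := H p; have [_ tf] := nlc.
have d a := torsion_free_dform a p tf.
split.
- rewrite -d Hu linearZ /= wedgeT scalerN opprK -mulr2n.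
  rewrite -(scaler_nat 2 (f p *: _)) scalerA.
  by rewrite scalerA mulrA mulVf ?mul1r // pnatr_eq0.
- rewrite -d Hv /wedge /tens.
  by apply/matrixP => i j; rewrite !(mxE, big_ord1); ring.
- rewrite -d Hn /wedge /tens.
  by apply/matrixP => i j; rewrite !(mxE, big_ord1); ring.
Qed.

Lemma exterior_covariant u v n (f : M -> R) (kappa : oneform M) :
  null_coframe g u v n ->
  exterior_system u v n f kappa -> covariant_system nabla u v n f kappa.
Proof.
move=> nc H p; have [Hu Hv Hn] := H p; have [mn tf] := nlc.
have gr q := null_coframe_gram q nc.
have [[su sv sn] _ _ _ _] := nc.
have d a := torsion_free_dform a p tf.
have [[uu uv vv] [nn un vn]] := gr p.
set h := invmx (g p).
have pr a b k : smooth_form setT a -> smooth_form setT b ->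
    (forall q, cogdot g q (a q) (b q) = k) ->
    metric_pair h (dual_conn nabla a p) (dual_conn nabla b p) (a p) (b p).
  exact: metric_pair_dual_conn.
(* The prescribed right-hand sides obey the same compatibility relations as the covariant
   derivatives and, by the exterior system, have the same skew parts. The differences are thus
   symmetric and compatible, and [covariant_unique] applies. *)
pose Ru := f p *: wedge (n p) (u p).
pose Rv := tens (kappa p) (n p) - f p *: tens (n p) (v p).
pose Rn := f p *: tens (u p) (v p) - tens (kappa p) (u p).
have sym (A B : 'M[R]_3) : A - A^T = B - B^T -> (A - B)^T = A - B.
  move=> AB; apply/matrixP => i j; have /matrixP/(_ i j) := AB.
  by rewrite !mxE; lra.
have gE := (uu, uv, vv, nn, un, vn, (dotC (v p) (u p) (hs p), uv),
  (dotC (n p) (u p) (hs p), un), (dotC (n p) (v p) (hs p), vn)).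
have [] := covariant_unique (hs p) (gr p)
  (Eu := dual_conn nabla u p - Ru) (Ev := dual_conn nabla v p - Rv)
  (En := dual_conn nabla n p - Rn).
- apply: sym; rewrite d; move/(congr1 (fun x => 2 *: x)): Hu.
  rewrite scalerA divff ?pnatr_eq0 // scale1r => ->.
  rewrite /Ru /wedge; apply/matrixP => i j; rewrite !mxE !big_ord1 !mxE; ring.
- apply: sym; rewrite d Hv /Rv /wedge.
  by apply/matrixP => i j; rewrite !mxE !big_ord1 !mxE; ring.
- apply: sym; rewrite d Hn /Rn /wedge.
  by apply/matrixP => i j; rewrite !mxE !big_ord1 !mxE; ring.
- apply: (metric_pairB (pr u u 0 su su
    (fun q => let: conj (And3 x _ _) _ := gr q in x))) => w.
  by rewrite /Ru /Rv /Rn /wedge !bilE !bil_tens !gE; ring.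
- apply: (metric_pairB (pr v v 0 sv sv
    (fun q => let: conj (And3 _ _ x) _ := gr q in x))) => w.
  by rewrite /Ru /Rv /Rn /wedge !bilE !bil_tens !gE; ring.
- apply: (metric_pairB (pr n n 1 sn sn
    (fun q => let: conj _ (And3 x _ _) := gr q in x))) => w.
  by rewrite /Ru /Rv /Rn /wedge !bilE !bil_tens !gE; ring.
- apply: (metric_pairB (pr u v 1 su sv
    (fun q => let: conj (And3 _ x _) _ := gr q in x))) => w.
  by rewrite /Ru /Rv /Rn /wedge !bilE !bil_tens !gE; ring.
- apply: (metric_pairB (pr u n 0 su sn
    (fun q => let: conj _ (And3 _ x _) := gr q in x))) => w.
  by rewrite /Ru /Rv /Rn /wedge !bilE !bil_tens !gE; ring.
- apply: (metric_pairB (pr v n 0 sv sn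
    (fun q => let: conj _ (And3 _ _ x) := gr q in x))) => w.
  by rewrite /Ru /Rv /Rn /wedge !bilE !bil_tens !gE; ring.
by move=> Eu Ev En; split; apply/eqP; rewrite -subr_eq0; apply/eqP.
Qed.

End NullCoframes.

(** * Linear differential systems *)

Section Gronwall.
Variable R : realType.
Local Notation E := 'rV[R]_3.

(** The integrating factor [expR (- L * t)] turns the inequality into the monotonicity of the
    product. *)
Lemma gronwall_zero (f df : R -> R) (L : R) :
  (forall t : R, 0 <= t <= 1 -> is_derive t 1 f (df t)) ->
  (forall t : R, 0 <= t <= 1 -> df t <= L * f t) -> f 0 <= 0 -> f 1 <= 0.
Proof.
move=> fd dle f0.
pose G t := f t * expR (- L * t).
have Gd (t : R) : 0 <= t <= 1 ->
    is_derive t 1 G ((df t - L * f t) * expR (- L * t)).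
  move=> t01; have fdt := fd t t01.
  have ed : is_derive t 1 (fun t => expR (- L * t)) (- L * expR (- L * t)).
    have l1 : is_derive t 1 (fun t : R => - L * t) (- L).
      have := @is_deriveZ _ _ _ id (- L) t 1 1 (is_derive_id _ _).
      by rewrite /GRing.scale /= mulr1.
    have := @is_derive1_comp _ expR (fun t : R => - L * t) t _ _ (is_derive_expR _) l1.
    by rewrite mulrC.
  apply: (is_derive_eq (is_deriveM fdt ed)).
  rewrite /GRing.scale /=; ring.
have Gc : {within `[0, 1], continuous G}.
  apply: derivable_within_continuous => t; rewrite in_itv /= => t01.
  by have [] := Gd t t01.
have : G 1 <= G 0.
  apply: (@ler0_derive1_nincr _ G 0 1) => // t; rewrite in_itv /= => /andP[t0 t1].
    by have [] := Gd t _; rewrite ?ltW.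
  have t01 : 0 <= t <= 1 by rewrite !ltW.
  have [_ Gt] := Gd t t01.
  rewrite derive1E Gt mulr_le0_ge0 ?expR_ge0 // subr_le0; exact: dle.
rewrite /G mulr0 expR0 mulr1 => /le_trans/(_ f0).
by rewrite pmulr_lle0 ?expR_gt0.
Qed.

Lemma is_derive_line (f : E -> R) (x d : E) (t : R) :
  differentiable f (x + t *: d) ->
  is_derive t 1 (fun t : R => f (x + t *: d)) ('D_d f (x + t *: d)).
Proof.
move=> df; pose ga (t : R) : E := x + t *: d.
have dga : is_diff t ga (0 + ( *:%R ^~ d)).
  exact: is_diffD.
have dg : differentiable ga t by exact: ex_diff.
have dfg : differentiable (f \o ga) t by exact: differentiable_comp.
apply: DeriveDef; first exact: diff_derivable.
rewrite -[LHS]/('D_1 (f \o ga) t) deriveE // diff_comp //= diff_val.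
by rewrite !fctE add0r scale1r deriveE.
Qed.

(** On a segment issuing from [x0], the sum of the squares of the unknowns starts at zero and its
    derivative is bounded by a multiple of itself, so Gronwall's inequality forces it to vanish. *)
Lemma linear_system_zero (W : set E) (S : 'I_2 -> E -> R)
    (a : 'I_3 -> 'I_2 -> 'I_2 -> E -> R) (x0 : E) :
  open W -> W x0 -> (forall i x, W x -> differentiable (S i) x) ->
  (forall k i j, {for x0, continuous (a k i j)}) ->
  (forall k i x, W x -> pderiv (S i) k x = \sum_j a k i j x * S j x) ->
  (forall i, S i x0 = 0) ->
  \forall x \near x0, forall i, S i x = 0.
Proof.
move=> oW Wx0 dS ca pS S0.
(* A crude common bound: the sum over all coefficients dominates each of them, and the added 1
   absorbs their variation near [x0]. *)
pose C : R := \sum_k \sum_i \sum_j (`|a k i j x0| + 1).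
have C0 : 0 <= C by do 3![apply: sumr_ge0 => ? _]; rewrite addr_ge0.
have leC k i j : `|a k i j x0| + 1 <= C.
  rewrite /C (bigD1 k) //= (bigD1 i) //= (bigD1 j) //=.
  move: (`|a k i j x0| + 1) => z; rewrite -!addrA lerDl.
  by rewrite !addr_ge0 //; do ?[apply: sumr_ge0 => ? _]; rewrite ?addr_ge0.
have nW := open_nbhs_nbhs (conj oW Wx0).
have na : \forall x \near x0, forall k i j, `|a k i j x| <= C.
  apply: (@filter_forall _ _ (fun k x => forall i j, `|a k i j x| <= C) (nbhs x0) _) => k.
  apply: (@filter_forall _ _ (fun i x => forall j, `|a k i j x| <= C) (nbhs x0) _) => i.
  apply: (@filter_forall _ _ (fun j x => `|a k i j x| <= C) (nbhs x0) _) => j.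
  have /cvgr_dist_lt/(_ 1 ltr01) := ca k i j.
  apply: filterS => x H; apply: le_trans (leC k i j).
  rewrite -lerBlDl; apply: le_trans (ltW H).
  by rewrite distrC; exact: lerB_dist.
have [r r0 rW] := (nbhs_ballP x0 _).1 (filterI nW na).
(* The radius is at most 1 so that the components of the displacement [d] are bounded by 1. *)
pose rr : R := Num.min r 1.
apply: (nbhs_ballP x0 _).2; exists rr; first by rewrite /= lt_min r0 ltr01.
move=> y; rewrite -ball_normE /= => yr.
pose d := y - x0.
have d1 k : `|d 0 k| <= 1.
  have : `|d| <= 1.
    by rewrite /d distrC ltW // (lt_le_trans yr) // ge_min lexx orbT.
  apply: le_trans; rewrite (_ : `|d| = mx_norm d) // mx_normrE.
  exact: (le_bigmax _ (fun ij : 'I_1 * 'I_3 => `|d ij.1 ij.2|) (0, k)).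
have ga t : 0 <= t <= 1 -> W (x0 + t *: d) /\ forall k i j, `|a k i j (x0 + t *: d)| <= C.
  move=> /andP[t0 t1]; apply: rW; rewrite -ball_normE /= opprD addNKr.
  rewrite normrN normrZ ger0_norm //; apply: le_lt_trans (_ : `|d| < r).
    by rewrite ler_piMl.
  by rewrite /d distrC (lt_le_trans yr) // ge_min lexx.
pose f t := \sum_i S i (x0 + t *: d) ^+ 2.
pose df t := \sum_i (2 * S i (x0 + t *: d) * 'D_d (S i) (x0 + t *: d)).
have f1 : f 1 <= 0.
  (* Summing C (s_i^2 + s_j^2) over two values of i, three of k and two of j counts each square 2 *
     3 * 2 = 12 times. *)
  apply: (@gronwall_zero f df (12 * C)).
  - move=> t t01; have [Wt _] := ga t t01.
    have -> : f = \sum_i (fun t => S i (x0 + t *: d) ^+ 2).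
      by apply/funext => z; rewrite fct_sumE.
    apply: is_derive_sum => i.
    have D := is_derive_line (dS i _ Wt).
    apply: (is_derive_eq (is_deriveM D D)).
    by rewrite /GRing.scale /=; ring.
  - move=> t t01; have [Wt aC] := ga t t01.
    pose s i := S i (x0 + t *: d).
    have -> : df t = \sum_i \sum_k \sum_j
        2 * s i * (d 0 k * (a k i j (x0 + t *: d) * s j)).
      apply: eq_bigr => i _; rewrite derive_pderiv; last exact: dS.
      rewrite mulr_sumr; apply: eq_bigr => k _; rewrite pS //.
      by rewrite mulr_sumr mulr_sumr.
    apply: le_trans (_ : \sum_(i < 2) \sum_(k < 3) \sum_(j < 2)
        C * (s i ^+ 2 + s j ^+ 2) <= _).
      apply: ler_sum => i _; apply: ler_sum => k _; apply: ler_sum => j _.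
      have : `|d 0 k * a k i j (x0 + t *: d)| <= C.
        by rewrite normrM -[leRHS]mul1r ler_pM.
      rewrite ler_norml => /andP[c1 c2].
      move: (d 0 k) (a k i j _) (s i) (s j) c1 c2 => z w x y' c1 c2.
      have -> : 2 * x * (z * (w * y')) = (z * w) * (2 * x * y') by ring.
      (* For |c| <= C, the sum of (C - c)(x + y)^2 and (C + c)(x - y)^2 is 2 C (x^2 + y^2) - 4 c x
         y, which bounds 2 c x y by C (x^2 + y^2). *)
      have p1 : 0 <= (C - z * w) * (x + y') ^+ 2.
        by rewrite mulr_ge0 ?sqr_ge0 ?subr_ge0.
      have p2 : 0 <= (C + z * w) * (x - y') ^+ 2.
        by rewrite mulr_ge0 ?sqr_ge0 // -lerBlDl sub0r.
      rewrite !expr2 in p1 p2 *.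
      lra.
    rewrite /f !big_ord_recl !big_ord0 -/(s _) /s le_eqVlt.
    by apply/orP; left; apply/eqP; ring.
  - by rewrite /f big1 // => i _; rewrite scale0r addr0 S0 expr0n.
move: f1; rewrite /f scale1r /d addrC subrK => f1 i.
have : S i y ^+ 2 <= 0.
  apply: le_trans f1; rewrite (bigD1 i) //= lerDl.
  by apply: sumr_ge0 => j _; exact: sqr_ge0.
by move=> H; apply/eqP; rewrite -(sqrf_eq0 (S i y)) eq_le H sqr_ge0.
Qed.

End Gronwall.

(** * Skew torsion and Dirac currents *)

Section SkewTorsion.
Variables (R : realType) (M : oriented_manifold R) (g : bilin M).
Hypothesis lg : lorentzian g.
Variables nabla D : vfield M -> M -> 'M[R]_3.
Hypotheses (nlc : levi_civita g nabla) (mD : metric_connection g D)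
  (sD : skew_torsion g D).

Lemma gdot_delta p (A : 'M[R]_3) (i l : 'I_3) :
  gdot g p (row i A) (delta_mx 0 l) = (A *m g p) i l.
Proof. by rewrite /gdot -row_mul trmx_delta -colE !mxE. Qed.

Lemma gdotC p (x y : 'rV[R]_3) : gdot g p x y = gdot g p y x.
Proof. exact: (dotC _ _ (lorentzian_sym lg p)). Qed.

(* The difference K of two metric connections, one torsion-free and the other
   with skew torsion, is totally skew. *)
Lemma skew_torsion_killing (u : oneform M) p :
  dual_conn D u p = 0 -> (dual_conn nabla u p)^T = - dual_conn nabla u p.
Proof.
move=> Du; pose dj j := coord_vf (chart_at p) j.
pose A j := D (dj j) p - nabla (dj j) p.
pose K i j l := (A j *m g p) i l.
have ac := chart_at_atlas p; have cp := chart_at_dom p.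
have oc := cdom_open ac.
have sd j : smooth_vf (cdom (chart_at p)) (dj j).
  exact: smooth_coord_vf.
have dE j : dj j p = delta_mx 0 j by exact: coord_vf_id.
have [mn tf] := nlc.
have K1 i j l : K i j l = - K i l j.
  have ED := mD.2 _ oc _ _ (sd j) (sd l) p cp (delta_mx 0 i).
  have EN := mn.2 _ oc _ _ (sd j) (sd l) p cp (delta_mx 0 i).
  rewrite EN -!rowE !dE !(gdotC p (delta_mx 0 j)) !gdot_delta in ED.
  by rewrite /K /A !mulmxBl !mxE; rewrite !mxE in ED; lra.
have K2 i j l : K i j l - K j i l = - (K i l j - K l i j).
  have ED := sD oc (sd i) (sd j) (sd l) cp.
  have T1 j' : torsion nabla (dj i) (dj j') p = 0 by exact: tf oc _ _ (sd i) (sd j') p cp.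
  have T2 j' : torsion D (dj i) (dj j') p = row i (A j') - row j' (A i).
    rewrite -[LHS]subr0 -(T1 j') !torsion_coord /A.
    by apply/rowP => k; rewrite !mxE; ring.
  have GB (x y z : 'rV[R]_3) : gdot g p (x - y) z = gdot g p x z - gdot g p y z.
    by rewrite /gdot !mulmxBl !mxE.
  by rewrite !T2 !dE !GB !gdot_delta in ED.
(* As in Koszul's formula, the torsion relation is taken for three permutations of the indices, [K1]
   serving to reorder the last two. *)
have K3 i j l : K i j l = - K j i l.
  have := K2 i j l; have := K2 l i j; have := K2 j l i.
  rewrite (K1 i l j) (K1 l j i) (K1 j i l) (K1 l i j) (K1 j l i) (K1 i j l). lra.
(* As [u] is parallel for [D], its derivative under [nabla] is the difference of the two dual
   connections, namely [K] with the raised [u] in its last slot. *)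
have E i j : dual_conn nabla u p i j = \sum_l K i j l * sharp g u p 0 l.
  have Dij : dual_conn D u p i j = 0 by rewrite Du mxE.
  have -> : \sum_l K i j l * sharp g u p 0 l = (A j *m (u p)^T) i 0.
    have -> : A j *m (u p)^T = A j *m g p *m (sharp g u p)^T.
      rewrite /sharp trmx_mul (lorentzian_inv_sym lg) -mulmxA (mulmxA (g p)).
      by rewrite mulmxV ?(lorentzian_unit lg) // mul1mx.
    rewrite [RHS]mxE; apply: eq_bigr => l _; congr (_ * _).
    by rewrite [RHS]mxE.
  have -> : (A j *m (u p)^T) i 0 =
      \sum_k D (dj j) p i k * u p 0 k - \sum_k nabla (dj j) p i k * u p 0 k.
    rewrite mxE -sumrB; apply: eq_bigr => k _.
    have -> : A j i k = D (dj j) p i k - nabla (dj j) p i k.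
      by rewrite /A [LHS]mxE [X in _ + X]mxE.
    by rewrite [(u p)^T k 0]mxE mulrBl.
  rewrite -[LHS]subr0 -[X in _ - X = _]Dij [X in X - _]mxE [X in _ - X]mxE /dj. ring.
apply/matrixP => i j; rewrite [LHS]mxE [RHS]mxE !E -sumrN.
by apply: eq_bigr => l _; rewrite K3 mulNr.
Qed.

End SkewTorsion.

(** * Algebra of a paired spinor bundle and the Dirac current *)

Section SpinorAlgebra.
Variables (R : realType) (M : oriented_manifold R) (g : bilin M).
Variable S : paired_spinor_bundle g.
Implicit Types (p : M).

Lemma sum2E (V : nmodType) (F : 'I_2 -> V) : \sum_i F i = F 0 + F 1.
Proof.
by rewrite !big_ord_recl big_ord0 addr0; congr (F _ + F _); exact: val_inj.
Qed.

Lemma ord2P (i : 'I_2) : i = 0 \/ i = 1.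
Proof.
case: i => [[|[|//]] ilt]; [left|right]; exact: val_inj.
Qed.

Lemma pairingZDl p (x : R) (s s' t : fib S p) :
  pairing (x *: s + s') t = x * pairing s t + pairing s' t.
Proof. exact: pairing_linear. Qed.

Lemma pairingZDr p (x : R) (s s' t : fib S p) :
  pairing t (x *: s + s') = x * pairing t s + pairing t s'.
Proof.
by rewrite pairing_skew pairingZDl (pairing_skew s) (pairing_skew s'); ring.
Qed.

Lemma pairing0l p (t : fib S p) : pairing 0 t = 0.
Proof.
by have := pairingZDl 1 0 0 t; rewrite scaler0 addr0; lra.
Qed.

Lemma pairing0r p (t : fib S p) : pairing t 0 = 0.
Proof. by rewrite pairing_skew pairing0l oppr0. Qed.

Lemma pairingZl p (x : R) (s t : fib S p) : pairing (x *: s) t = x * pairing s t.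
Proof. by rewrite -[x *: s]addr0 pairingZDl pairing0l addr0. Qed.

Lemma pairingZr p (x : R) (s t : fib S p) : pairing t (x *: s) = x * pairing t s.
Proof. by rewrite -[x *: s]addr0 pairingZDr pairing0r addr0. Qed.

Lemma pairingDl p (s s' t : fib S p) :
  pairing (s + s') t = pairing s t + pairing s' t.
Proof. by rewrite -[s]scale1r pairingZDl scale1r mul1r. Qed.

Lemma pairingDr p (s s' t : fib S p) :
  pairing t (s + s') = pairing t s + pairing t s'.
Proof. by rewrite -[s]scale1r pairingZDr scale1r mul1r. Qed.

Lemma pairing_self p (s : fib S p) : pairing s s = 0.
Proof. by have := pairing_skew s s; lra. Qed.

(** Two vectors of pairing one form a basis of the plane, and pairing with them reads off the
    coefficients. The local frame of the bundle enters only to express that the fibre has dimension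
    two. *)
Lemma symplectic_decomp p (b0 b1 s : fib S p) : pairing b0 b1 = 1 ->
  s = pairing s b1 *: b0 + pairing b0 s *: b1.
Proof.
move=> b01; have [j jp] := bdom_cover S p.
have coord t : exists x : 'rV[R]_2,
    t = x 0 0 *: bframe j 0 p + x 0 1 *: bframe j 1 p.
  have [x [tE _]] := bframe_basis jp t.
  by exists x; rewrite {1}tE sum2E.
have [x xE] := coord b0; have [y yE] := coord b1; have [z zE] := coord s.
move: b01; rewrite xE yE zE; set f0 := bframe j 0 p; set f1 := bframe j 1 p.
have E (a c d e : R) : pairing (a *: f0 + c *: f1) (d *: f0 + e *: f1) =
    (a * e - c * d) * pairing f0 f1.
  rewrite pairingDl !pairingDr !pairingZl !pairingZr !pairing_self.
  by rewrite (pairing_skew f1 f0); ring.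
rewrite !E; set w := pairing f0 f1 => b01.
rewrite !scalerDr !scalerA addrACA -!scalerDl; congr (_ *: _ + _ *: _).
  rewrite -[LHS]mul1r -b01; ring.
by rewrite -[LHS]mul1r -b01; ring.
Qed.

Lemma clZDr p a (x : R) (s t : fib S p) :
  cl a (x *: s + t) = x *: cl a s + cl a t.
Proof. exact: cl_linearr. Qed.

Lemma cl0r p a : cl a (0 : fib S p) = 0.
Proof.
have := clZDr a 1 (0 : fib S p) 0; rewrite !scale1r addr0.
by move/eqP; rewrite eq_sym -subr_eq0 addrK => /eqP.
Qed.

Lemma clZr p a (x : R) (s : fib S p) : cl a (x *: s) = x *: cl a s.
Proof. by rewrite -[x *: s]addr0 clZDr cl0r addr0. Qed.

Lemma clDr p a (s t : fib S p) : cl a (s + t) = cl a s + cl a t.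
Proof. by rewrite -[s]scale1r clZDr !scale1r. Qed.

Lemma cl0l p (s : fib S p) : cl 0 s = 0.
Proof.
have := cl_linearl 1 0 0 s; rewrite !scale1r addr0.
by move/eqP; rewrite eq_sym -subr_eq0 addrK => /eqP.
Qed.

Lemma cl_sum p (r : seq 'I_3) (x : 'I_3 -> R) (a : 'I_3 -> 'rV[R]_3) (s : fib S p) :
  cl (\sum_(i <- r) x i *: a i) s = \sum_(i <- r) x i *: cl (a i) s.
Proof.
elim: r => [|i r IH]; first by rewrite !big_nil cl0l.
by rewrite !big_cons cl_linearl IH.
Qed.

(* The vector field dual to the Dirac current of a spinor. *)
Definition current (s : forall p, fib S p) : vfield M :=
  fun p => \row_i pairing (s p) (cl (delta_mx 0 i) (s p)).

Lemma current_dot (s : forall p, fib S p) p (a : 'rV[R]_3) :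
  (current s p *m a^T) 0 0 = pairing (s p) (cl a (s p)).
Proof.
rewrite mxE {2}[a]row_sum_delta cl_sum.
have P (r : seq 'I_3) (x : 'I_3 -> R) (t : 'I_3 -> fib S p) :
   pairing (s p) (\sum_(i <- r) x i *: t i) = \sum_(i <- r) x i * pairing (s p) (t i).
  elim: r => [|i r IH]; first by rewrite !big_nil pairing0r.
  by rewrite !big_cons pairingZDr IH.
by rewrite P; apply: eq_bigr => i _; rewrite !mxE mulrC.
Qed.

Lemma smooth_sec_sub (U V : set M) (s : forall p, fib S p) : V `<=` U ->
  smooth_sec U s -> smooth_sec V s.
Proof.
move=> VU ss j; have [a [sa sE]] := ss j; exists a; split=> [i|p /VU].
  by apply: smooth_on_sub (sa i) => q [/VU].
exact: sE.
Qed.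

Lemma smooth_current (s : forall p, fib S p) : smooth_sec setT s ->
  smooth_vf setT (current s).
Proof.
move=> ss c ac j; rewrite setTI; have oc := cdom_open ac.
have ss' : smooth_sec (cdom c) s by exact: smooth_sec_sub ss.
have := pairing_smooth oc ss' (cl_smooth oc (smooth_coord_form j ac) ss').
apply: smooth_on_ext => // p cp; rewrite -current_dot /coord_form.
by rewrite trmx_mul trmxK mulmxA trmx_delta -colE /col [LHS]mxE.
Qed.

End SpinorAlgebra.

(** * Spin frames *)

Section SpinorConnections.
Variables (R : realType) (M : oriented_manifold R) (S : plane_bundle M).
Variable DS : (forall p, fib S p) -> forall p, 'rV[R]_3 -> fib S p.
Hypothesis cDS : is_connection_on DS.
Implicit Types (U : set M) (p q : M) (s t : forall p, fib S p).

Lemma smooth_secD U s t : open U -> smooth_sec U s -> smooth_sec U t ->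
  smooth_sec U (fun q => s q + t q).
Proof.
move=> oU ss st j; have [a [sa aE]] := ss j; have [c [sc cE]] := st j.
have oV := openI oU (@bdom_open _ _ S j).
exists (fun q => a q + c q); split=> [i|p Up jp].
  apply: smooth_on_ext (smooth_onD oV (sa i) (sc i)) => // p _.
  by rewrite mxE.
rewrite aE // cE // -big_split; apply: eq_bigr => i _.
by rewrite mxE scalerDl.
Qed.

Lemma smooth_secZ U (f : M -> R) s : open U -> smooth_on U f ->
  smooth_sec U s -> smooth_sec U (fun q => f q *: s q).
Proof.
move=> oU sf ss j; have [a [sa aE]] := ss j.
have oV := openI oU (@bdom_open _ _ S j).
have sf' : smooth_on (U `&` bdom j) f by apply: smooth_on_sub sf => q [].
exists (fun q => f q *: a q); split=> [i|p Up jp].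
  apply: smooth_on_ext (smooth_onM oV sf' (sa i)) => // p _.
  by rewrite mxE.
rewrite aE // scaler_sumr; apply: eq_bigr => i _.
by rewrite mxE scalerA.
Qed.

(** The same jump cut-off as in [conn_near], applied to sections of the bundle. *)
Lemma spinor_conn_near U s t p w : open U -> U p ->
  smooth_sec U s -> smooth_sec U t -> (forall q, U q -> s q = t q) ->
  DS s p w = DS t p w.
Proof.
move=> oU Up ss st st_; have [_ _ DD DZ] := cDS oU.
pose z q := t q + (-1) *: s q.
have sz : smooth_sec U z.
  by apply: smooth_secD => //; apply: smooth_secZ => //; exact: smooth_on_cst.
have z0 q : U q -> z q = 0 by move=> Uq; rewrite /z st_ // scaleN1r subrr.
pose chi q : R := if `[< U q >] then 0 else 1.
have chi0 q : U q -> chi q = 0 by rewrite /chi => Uq; case: asboolP.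
have sc : smooth_on U chi.
  by apply: smooth_on_ext (smooth_on_cst U 0) => // q /chi0.
have zE : z = (fun q => chi q *: z q).
  apply: functional_extensionality_dep => q; rewrite /chi.
  by case: asboolP => [/z0 ->|_]; rewrite ?scaler0 ?scale1r.
have -> : t = (fun q => s q + z q).
  by apply: functional_extensionality_dep => q; rewrite /z scaleN1r addrC subrK.
rewrite DD // {1}zE DZ // z0 // chi0 // scale0r addr0 scaler0 addr0.
by [].
Qed.

End SpinorConnections.

(** * A spinor and its Dirac current in a spin frame *)

Section SpinFrame.
Variables (R : realType) (M : oriented_manifold R) (g : bilin M).
Hypothesis lg : lorentzian g.
Variable S : paired_spinor_bundle g.
Variables (U : set M) (b : 'I_2 -> forall p, fib S p) (e : M -> 'M[R]_3).
Hypotheses (oU : open U) (fr : spin_frame (S := S) U b e).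
Variable s : forall p, fib S p.
Hypothesis ss : smooth_sec setT s.
Implicit Types (p q : M).

(** The coefficients given by [symplectic_decomp]; written through the pairing, they are visibly
    smooth. *)
Definition spinor_coord (i : 'I_2) : M -> R := fun q =>
  if i == 0 then pairing (s q) (b 1 q) else pairing (b 0 q) (s q).

Local Notation sg := spinor_coord.

Lemma smooth_spinor_coord i : smooth_on U (sg i).
Proof.
have [sb _ _ _ _] := fr.
have ssU : smooth_sec U s by apply: smooth_sec_sub ss.
case: (ord2P i) => ->; rewrite /spinor_coord /=; exact: pairing_smooth.
Qed.

Lemma spinor_coordE q : U q -> s q = sg 0 q *: b 0 q + sg 1 q *: b 1 q.
Proof. by move=> Uq; have [_ _ _ b01 _] := fr; exact/symplectic_decomp/b01. Qed.

(** The quadratic map from spinors to the null cone. Its last component is minus a sum of squares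
    and vanishes only with the spinor; nullity is the identity 4 x^2 y^2 + (x^2 - y^2)^2 = (x^2 +
    y^2)^2. *)
Lemma current_spin_frame q : U q ->
  [/\ (current s q *m (row 0 (e q))^T) 0 0 = - 2 * (sg 0 q * sg 1 q),
      (current s q *m (row 1 (e q))^T) 0 0 = sg 0 q * sg 0 q - sg 1 q * sg 1 q &
      (current s q *m (row 2%:R (e q))^T) 0 0 =
        - (sg 0 q * sg 0 q + sg 1 q * sg 1 q)].
Proof.
move=> Uq; have [_ _ _ b01 clb] := fr.
have b10 : pairing (b 1 q) (b 0 q) = - 1 by rewrite pairing_skew b01.
have E (a : 'I_3) : (current s q *m (row a (e q))^T) 0 0 =
   sg 0 q * (gam R a 1 0 * sg 0 q + gam R a 1 1 * sg 1 q) -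
   sg 1 q * (gam R a 0 0 * sg 0 q + gam R a 0 1 * sg 1 q).
  rewrite current_dot (spinor_coordE Uq) clDr !clZr !clb // !sum2E.
  rewrite !(pairingDl, pairingDr, pairingZl, pairingZr, scalerDr).
  by rewrite !pairing_self b01 // b10; ring.
by split; rewrite E !mxE /=; ring.
Qed.

Lemma orthonormal_expand q (x : 'rV[R]_3) : U q ->
  x = dot (invmx (g q)) x (row 0 (e q)) *: row 0 (e q) +
      dot (invmx (g q)) x (row 1 (e q)) *: row 1 (e q) -
      dot (invmx (g q)) x (row 2%:R (e q)) *: row 2%:R (e q).
Proof.
move=> Uq; have [_ _ /(_ q Uq) on _ _] := fr.
have eta2 : eta R *m eta R = 1%:M.
  apply/matrixP => i j; rewrite !mxE sum3E !mxE.
  by case: (ord3P i) => ->; case: (ord3P j) => -> /=; lra.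
have E : e q *m (invmx (g q) *m (e q)^T *m eta R) = 1%:M.
  by rewrite !mulmxA on eta2.
have := mulmx1C E; rewrite -!mulmxA => /(congr1 (mulmx x)).
rewrite mulmx1 => {1}<-.
have dE (a : 'I_3) : dot (invmx (g q)) x (row a (e q)) =
   (x *m (invmx (g q) *m (e q)^T)) 0 a.
  rewrite /dot tr_row -mulmxA colE !mulmxA -colE /col mxE.
  by [].
rewrite !dE !mulmxA -(mulmxA x); move: (x *m _) => y.
apply/rowP => k; rewrite !mxE !sum3E !mxE !sum3E !mxE /=.
by ring.
Qed.

Definition dirac_form : oneform M := fun q => current s q *m g q.

Lemma dirac_dot q (x : 'rV[R]_3) :
  dot (invmx (g q)) (dirac_form q) x = (current s q *m x^T) 0 0.
Proof.
rewrite /dot /dirac_form -(mulmxA (current s q)) mulmxV ?mulmx1 //.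
exact: lorentzian_unit.
Qed.

Lemma dirac_spin_frame q : U q -> dirac_form q =
  (- 2 * (sg 0 q * sg 1 q)) *: row 0 (e q) +
  ((sg 0 q * sg 0 q - sg 1 q * sg 1 q) *: row 1 (e q) +
  (sg 0 q * sg 0 q + sg 1 q * sg 1 q) *: row 2%:R (e q)).
Proof.
move=> Uq; rewrite {1}(orthonormal_expand (dirac_form q) Uq) !dirac_dot.
have [-> -> ->] := current_spin_frame Uq.
by rewrite scaleNr opprK addrA.
Qed.

Lemma dirac_null q : U q -> dot (invmx (g q)) (dirac_form q) (dirac_form q) = 0.
Proof.
move=> Uq; rewrite dirac_dot (dirac_spin_frame Uq).
have [c0 c1 c2] := current_spin_frame Uq.
rewrite row_dotC !mulmxDl -!scalemxAl !(row_dotC _ (current s q)).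
rewrite [LHS]mxE [X in _ + X]mxE [X in X + _]mxE [X in _ + (X + _)]mxE.
rewrite [X in _ + (_ + X)]mxE c0 c1 c2; ring.
Qed.

Lemma dirac_eq0 q : U q -> dirac_form q = 0 -> s q = 0.
Proof.
move=> Uq d0; have [_ _ c2] := current_spin_frame Uq.
move: c2; rewrite -dirac_dot d0 /dot !mul0mx mxE => c2.
have sq0 (x y : R) : 0 = - (x * x + y * y) -> x = 0 /\ y = 0.
  move/esym/eqP; rewrite oppr_eq0 paddr_eq0 -?expr2 ?sqr_ge0 // !sqrf_eq0.
  by move=> /andP[/eqP-> /eqP->].
have [s0 s1] := sq0 _ _ c2.
by rewrite (spinor_coordE Uq) s0 s1 !scale0r addr0.
Qed.

Variable DS : (forall p, fib S p) -> forall p, 'rV[R]_3 -> fib S p.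
Hypothesis cDS : is_connection_on DS.
Hypothesis ps : forall p w, DS s p w = 0.

(** The Leibniz rule expands the derivative of [s] in the frame, and pairing the vanishing result
    with the two frame spinors isolates each component. *)
Lemma parallel_coord q w (W : 'M[R]_2) : U q ->
  (forall j, DS (b j) q w = \sum_i W i j *: b i q) ->
  forall i, (w *m (dfun (sg i) q)^T) 0 0 = - (W i 0 * sg 0 q + W i 1 * sg 1 q).
Proof.
move=> Uq WE; have [sb _ _ _ _] := fr.
have ssU : smooth_sec U s by apply: smooth_sec_sub ss.
have sm i : smooth_sec U (fun p => sg i p *: b i p).
  by apply: smooth_secZ => //; exact: smooth_spinor_coord.
have [_ _ DD DZ] := cDS oU.
have : DS (fun p => sg 0 p *: b 0 p + sg 1 p *: b 1 p) q w = 0.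
  rewrite -(ps q w); apply: (spinor_conn_near cDS w oU Uq) => //.
    exact: smooth_secD.
  by move=> p Up; rewrite -spinor_coordE.
rewrite DD // !DZ //; [|exact: smooth_spinor_coord..].
rewrite !WE !sum2E => E.
have [_ _ _ b01 _] := fr.
have b10 : pairing (b 1 q) (b 0 q) = - 1 by rewrite pairing_skew b01.
have := congr1 (fun t => pairing t (b 1 q)) E.
have := congr1 (fun t => pairing t (b 0 q)) E.
rewrite /= !pairing0l !(pairingDl, pairingZl, scalerDr).
rewrite !pairing_self b01 // b10 => E0 E1 i.
by case: (ord2P i) => ->; lra.
Qed.

End SpinFrame.

(** The isomorphism of sl(2,R) with so(2,1) in coordinates: the entries of [slash x] determine [x],
    so the commutators with the gamma matrices determine the rows of [O]. *)
Lemma so21_of_sl2 (R : realType) (W : 'M[R]_2) (O : 'M[R]_3) : \tr W = 0 ->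
  (forall a, W *m gam R a - gam R a *m W = slash (row a O)) ->
  [/\ W 1 1 = - W 0 0,
      [/\ O 0 0 = 0, O 0 1 = W 1 0 - W 0 1 & O 0 2%:R = - W 0 1 - W 1 0],
      [/\ O 1 0 = W 0 1 - W 1 0, O 1 1 = 0 & O 1 2%:R = 2 * W 0 0] &
      [/\ O 2%:R 0 = - W 0 1 - W 1 0, O 2%:R 1 = 2 * W 0 0 & O 2%:R 2%:R = 0]].
Proof.
rewrite /mxtrace sum2E => trW comm.
have W11 : W 1 1 = - W 0 0 by lra.
have E a : [/\ 2 * O a 0 = (W *m gam R a - gam R a *m W) 0 0 -
                          (W *m gam R a - gam R a *m W) 1 1,
    2 * O a 1 = (W *m gam R a - gam R a *m W) 0 1 + (W *m gam R a - gam R a *m W) 1 0 &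
    2 * O a 2%:R = (W *m gam R a - gam R a *m W) 0 1 - (W *m gam R a - gam R a *m W) 1 0].
  by rewrite comm /slash !summxE !sum3E !mxE /=; split; ring.
have dbl (x y : R) : 2 * x = 2 * y -> x = y by move=> ?; lra.
have [e0 e1 e2] := E 0; have [f0 f1 f2] := E 1; have [h0 h1 h2] := E 2%:R.
split=> //; split; apply: dbl; rewrite ?e0 ?e1 ?e2 ?f0 ?f1 ?f2 ?h0 ?h1 ?h2;
  rewrite !(mxE, sum2E) /= ?W11; ring.
Qed.

(** * Parallel spinors: parallelism of the current and openness of the zero set *)

Section DiracParallel.
Variables (R : realType) (M : oriented_manifold R) (g : bilin M).
Hypothesis lg : lorentzian g.

Lemma mul_tens (w x y : 'rV[R]_3) : w *m tens x y = (w *m x^T) 0 0 *: y.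
Proof. by rewrite /tens mulmxA {1}[w *m x^T]mx11_scalar mul_scalar_mx. Qed.

Lemma dfunN (U : set M) (f : M -> R) p : U p -> smooth_on U f ->
  dfun (fun q => - f q) p = - dfun f p.
Proof.
move=> Up sf; have -> : (fun q => - f q) = (fun q => -1 * f q).
  by apply/funext => q; rewrite mulN1r.
rewrite (dfunM Up (smooth_on_cst U (-1)) sf) dfun_cst scaler0 addr0.
by rewrite scaleN1r.
Qed.

Lemma cpd_coord_vf (U : set M) c (f : M -> R) k q : atlas c -> open U ->
  smooth_on U f -> U q -> cdom c q ->
  cpd c f k q = (coord_vf c k q *m (dfun f q)^T) 0 0.
Proof.
move=> ac oU sf Uq cq.
rewrite (cpd_change k ac (chart_at_atlas q) oU sf Uq cq (chart_at_dom q)).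
rewrite [RHS]mxE; apply: eq_bigr => j _; rewrite /coord_vf -rowE.
by congr (_ * _); rewrite ?cpd_dfun [RHS]mxE // cpd_dfun.
Qed.

Section Frame.
Variable S : paired_spinor_bundle g.
Variables (U : set M) (b : 'I_2 -> forall p, fib S p) (e : M -> 'M[R]_3).
Hypotheses (oU : open U) (fr : spin_frame (S := S) U b e).
Variable s : forall p, fib S p.
Hypothesis ss : smooth_sec setT s.
Variable DS : (forall p, fib S p) -> forall p, 'rV[R]_3 -> fib S p.
Hypothesis cDS : is_connection_on DS.
Hypothesis ps : forall p w, DS s p w = 0.
Local Notation sg := (spinor_coord b s).

(** Infinitesimal equivariance of the quadratic map of [current_spin_frame]: the components of the
    spinor vary by - W and the coframe by the matrix [O] lying under [W], and the two contributions
    cancel. *)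
Lemma dirac_parallel (D : vfield M -> M -> 'M[R]_3) q w O (W : 'M[R]_2) : U q ->
  (forall a, w *m dual_conn D (fun q => row a (e q)) q = row a O *m e q) ->
  \tr W = 0 ->
  (forall a, W *m gam R a - gam R a *m W = slash (row a O)) ->
  (forall j, DS (b j) q w = \sum_i W i j *: b i q) ->
  w *m dual_conn D (dirac_form s) q = 0.
Proof.
move=> Uq HO trW comm WE; have [_ se _ _ _] := fr.
have sc i := smooth_spinor_coord oU fr ss i.
have sm i j := smooth_onM oU (sc i) (sc j).
have dsg := parallel_coord oU fr ss cDS ps Uq WE.
pose C0 q := - 2 * (sg 0 q * sg 1 q).
pose C1 q := sg 0 q * sg 0 q - sg 1 q * sg 1 q.
pose C2 q := sg 0 q * sg 0 q + sg 1 q * sg 1 q.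
have sC0 : smooth_on U C0 by exact: smooth_onM oU (smooth_on_cst U _) (sm 0 1).
have sC1 : smooth_on U C1 by exact: smooth_onB oU (sm 0 0) (sm 1 1).
have sC2 : smooth_on U C2 by exact: smooth_onD oU (sm 0 0) (sm 1 1).
have dd (x y : 'rV[R]_3) : (w *m (x + y)^T) 0 0 = (w *m x^T) 0 0 + (w *m y^T) 0 0.
  by rewrite linearD mulmxDr mxE.
have dz (k : R) (x : 'rV[R]_3) : (w *m (k *: x)^T) 0 0 = k * (w *m x^T) 0 0.
  by rewrite linearZ -scalemxAr mxE.
have dn (x : 'rV[R]_3) : (w *m (- x)^T) 0 0 = - (w *m x^T) 0 0.
  by rewrite linearN mulmxN mxE.
have dC0 : (w *m (dfun C0 q)^T) 0 0 = - 2 *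
    (sg 0 q * (w *m (dfun (sg 1) q)^T) 0 0 + sg 1 q * (w *m (dfun (sg 0) q)^T) 0 0).
  rewrite /C0 (dfunM Uq (smooth_on_cst U _) (sm 0 1)) dfun_cst scaler0 addr0 dz.
  by rewrite (dfunM Uq (sc 0) (sc 1)) dd !dz.
have d2 i : (w *m (dfun (fun p => sg i p * sg i p) q)^T) 0 0 =
    2 * (sg i q * (w *m (dfun (sg i) q)^T) 0 0).
  by rewrite (dfunM Uq (sc i) (sc i)) dd !dz; ring.
have dC1 : (w *m (dfun C1 q)^T) 0 0 = 2 *
    (sg 0 q * (w *m (dfun (sg 0) q)^T) 0 0 - sg 1 q * (w *m (dfun (sg 1) q)^T) 0 0).
  rewrite /C1 (dfunD Uq (sm 0 0) (smooth_onN oU (sm 1 1))) (dfunN Uq (sm 1 1)).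
  by rewrite dd dn (d2 0) (d2 1) -mulrBr.
have dC2 : (w *m (dfun C2 q)^T) 0 0 = 2 *
    (sg 0 q * (w *m (dfun (sg 0) q)^T) 0 0 + sg 1 q * (w *m (dfun (sg 1) q)^T) 0 0).
  by rewrite /C2 (dfunD Uq (sm 0 0) (sm 1 1)) dd (d2 0) (d2 1) -mulrDr.
have sr f a : smooth_on U f -> smooth_form U (fun p => f p *: row a (e p)).
  by move=> sf; apply: smooth_formZ.
rewrite (@dual_conn_near _ _ D U (dirac_form s) (fun p =>
  C0 p *: row 0 (e p) + (C1 p *: row 1 (e p) + C2 p *: row 2%:R (e p))) q) //;
  last by move=> p Up; exact: (dirac_spin_frame lg fr s Up).
rewrite (dual_connD D Uq (sr _ 0 sC0)
  (smooth_formD oU (sr _ 1 sC1) (sr _ 2%:R sC2))).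
rewrite (dual_connD D Uq (sr _ 1 sC1) (sr _ 2%:R sC2)).
rewrite !(dual_connZ D Uq _ (se _)) // !mulmxDr !mul_tens -!scalemxAr !HO.
rewrite dC0 dC1 dC2 !dsg !mulmx_sum_row !sum3E.
have [W11 [L00 L01 L02] [L10 L11 L12] [L20 L21 L22]] := so21_of_sl2 trW comm.
have rE a k : row a O 0 k = O a k by rewrite mxE.
rewrite !rE L00 L01 L02 L10 L11 L12 L20 L21 L22 W11 /C0 /C1 /C2.
move: (sg 0 q) (sg 1 q) (W 0 0) (W 0 1) (W 1 0) => x y w00 w01 w10.
apply/rowP => k; rewrite !mxE; ring.
Qed.

Lemma parallel_nonzero_open p : U p -> s p != 0 ->
  nbhs p [set q | s q != 0].
Proof.
move=> Up sp.
have [i ci] : exists i, sg i p != 0.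
  apply/not_existsP => H; have sg0 i : sg i p = 0.
    by apply/eqP; apply: contraT => /(H i).
  by move/eqP: sp; apply; rewrite (spinor_coordE fr s Up) !sg0 !scale0r addr0.
have cs := smooth_on_continuous oU Up (smooth_spinor_coord oU fr ss i).
have n0 : nbhs (sg i p) [set x | x != 0].
  by apply: open_nbhs_nbhs; split=> //; exact: open_neq.
have nq : nbhs p (sg i @^-1` [set x | x != 0]) := cs _ n0.
apply: (filterS _ nq) => q /= qi; apply: contraNneq qi => q0.
by rewrite /spinor_coord q0; case: ifP => _; rewrite ?pairing0l ?pairing0r.
Qed.

(** In a chart and a spin frame, parallelism is a homogeneous linear first-order system with
    continuous coefficients, so a zero at one point spreads to a neighbourhood by
    [linear_system_zero]. *)
Lemma parallel_zero_open p : U p -> s p = 0 ->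
  nbhs p [set q | s q = 0].
Proof.
move=> Up sp; set c := chart_at p.
have ac : atlas c := chart_at_atlas p; have cp : cdom c p := chart_at_dom p.
have oV : open (U `&` cdom c) := openI oU (cdom_open ac).
set V := U `&` cdom c in oV *; have Vp : V p by [].
have [sb _ _ b01 _] := fr.
(* The matrices [W] supplied by a lift are chosen point by point and come with no continuity.
   Pairing the derivatives of the frame with the frame itself gives coefficients that are smooth by
   construction. *)
pose wc (k : 'I_3) (i j : 'I_2) q : R :=
  if i == 0 then pairing (DS (b j) q (coord_vf c k q)) (b 1 q)
  else pairing (b 0 q) (DS (b j) q (coord_vf c k q)).
have sbV i : smooth_sec V (b i) by apply: smooth_sec_sub (sb i) => q [].
have sk k : smooth_vf V (coord_vf c k).
  by apply: smooth_vf_sub (smooth_coord_vf k ac) => q [].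
have [sDS _ _ _] := cDS oV.
have swc k i j : smooth_on V (wc k i j).
  have sD := sDS _ _ (sbV j) (sk k).
  by case: (ord2P i) => ->; rewrite /wc /=; exact: pairing_smooth.
have sc i : smooth_on V (sg i).
  by apply: smooth_on_sub (smooth_spinor_coord oU fr ss i) => q [].
have oW := chart_image_open ac oV.
have VV : V `&` cdom c = V by rewrite /V -setIA setIid.
have WE k j q : V q -> DS (b j) q (coord_vf c k q) = \sum_i wc k i j q *: b i q.
  by move=> [Uq _]; rewrite sum2E; exact/symplectic_decomp/b01.
have : \forall x \near cmap c p, forall i, (sg i \o cinv c) x = 0.
  apply: (@linear_system_zero _ (cmap c @` V) (fun i => sg i \o cinv c)
    (fun k i j x => - wc k i j (cinv c x))).
  - by rewrite -VV.
  - by exists p.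
  - move=> i x; rewrite -VV => /(chart_imageP ac)[Vx cx xE].
    have := smooth_on_differentiable ac cx Vx (sc i).
    by rewrite xE.
  - move=> k i j.
    have := smooth_onN oV (swc k i j) => H.
    exact: differentiable_continuous (smooth_on_differentiable ac cp Vp H).
  - move=> k i x; rewrite -VV => /(chart_imageP ac)[Vx cx xE].
    have E := cpd_coord_vf k ac oV (sc i) Vx cx.
    rewrite /cpd xE in E; rewrite E.
    pose W : 'M[R]_2 := \matrix_(i, j) wc k i j (cinv c x).
    have WE' j : DS (b j) (cinv c x) (coord_vf c k (cinv c x)) =
        \sum_i W i j *: b i (cinv c x).
      by rewrite WE //; apply: eq_bigr => l _; rewrite mxE.
    rewrite (parallel_coord oU fr ss cDS ps Vx.1 WE') !mxE.
    by rewrite sum2E /=; ring.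
  - move=> i /=; rewrite cmapK // /spinor_coord sp.
    by case: ifP => _; rewrite ?pairing0l ?pairing0r.
have [_ _ _ cm _] := atlas_chart ac.
move=> n0; have nV := open_nbhs_nbhs (conj oV Vp).
have nE : nbhs p (cmap c @^-1` [set x | forall i, (sg i \o cinv c) x = 0]).
  exact: (cm p cp _ n0).
apply: (filterS _ (filterI nE nV)) => q [/= H [Uq cq]].
rewrite (spinor_coordE fr s Uq).
have H0 := H 0; have H1 := H 1; rewrite /= cmapK // in H0 H1.
by rewrite H0 H1 !scale0r addr0.
Qed.

End Frame.

End DiracParallel.

(** * From a parallel spinor to a null coframe *)

Section Forward.
Variables (R : realType) (M : oriented_manifold R) (g : bilin M).
Hypothesis lg : lorentzian g.

Let hs p : (invmx (g p))^T = invmx (g p) := lorentzian_inv_sym lg p.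

Lemma parallel_nowhere_zero (S : paired_spinor_bundle g)
    (D : vfield M -> M -> 'M[R]_3)
    (DS : (forall p, fib S p) -> forall p, 'rV[R]_3 -> fib S p)
    (s : forall p, fib S p) :
  is_lift D DS -> smooth_sec setT s -> (exists p, s p != 0) ->
  (forall p w, DS s p w = 0) -> forall p, s p != 0.
Proof.
move=> [cDS loc] ss [p0 sp0] ps.
pose B := [set p | s p != 0].
have oB : open B.
  rewrite openE => p Bp; have [U [b [e [oU Up fr _]]]] := loc p.
  exact: (parallel_nonzero_open oU fr ss Up Bp).
have oC : open (~` B).
  rewrite openE => p Bp; have [U [b [e [oU Up fr _]]]] := loc p.
  have sp : s p = 0 by apply/eqP/negPn/negP.
  have := parallel_zero_open oU fr ss cDS ps Up sp.
  by rewrite /interior; apply: filterS => q /= q0; apply/negP/negPn/eqP.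
have BT : B = setT.
  apply: (@mconnected _ M).
  - by exists p0.
  - by exists B => //; rewrite setTI.
  - by exists B; rewrite ?setTI // -[B]setCK; exact: open_closedC.
by move=> p; have : setT p by []; rewrite -BT.
Qed.

Variable t : vfield M.
Hypothesis gt : time_orientation g t.

(* The null form conjugate to u in the plane spanned by u and the timelike
   form dual to t. *)
Definition conjugate_null (u : oneform M) : oneform M := fun p =>
  ((u p *m (t p)^T) 0 0)^-1 *: (t p *m g p) +
  (- gdot g p (t p) (t p) * ((2 * ((u p *m (t p)^T) 0 0) ^+ 2)^-1)) *: u p.

Section Conjugate.
Variable u : oneform M.
Hypotheses (su : smooth_form setT u) (u0 : forall p, u p != 0)
  (uu : forall p, cogdot g p (u p) (u p) = 0).

Lemma null_timelike_neq0 p : (u p *m (t p)^T) 0 0 != 0.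
Proof.
have [_ tt] := gt; have [_ _ /(_ p)[P uP PG]] := lg.
have sg : u p *m invmx (g p) *m g p = u p.
  by rewrite -mulmxA mulVmx ?(lorentzian_unit lg) // mulmx1.
apply/eqP => ut; have : u p *m invmx (g p) = 0.
  apply: (timelike_null_orth uP PG (t := t p)); last exact: tt.
    by rewrite sg trmx_mul hs mulmxA; exact: uu.
  by rewrite sg.
move=> /(congr1 (fun x => x *m g p)); rewrite sg mul0mx.
exact/eqP/u0.
Qed.

(** The coefficient of the form dual to [t] is fixed by g(u, v) = 1, and then that of [u] by the
    nullity of v. *)
Lemma conjugate_nullE p :
  cogdot g p (u p) (conjugate_null u p) = 1 /\
  cogdot g p (conjugate_null u p) (conjugate_null u p) = 0.
Proof.
have y0 := null_timelike_neq0 p; have uup := uu p.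
have DE x z : cogdot g p x z = dot (invmx (g p)) x z by [].
rewrite !DE /conjugate_null in uup *; set y := (u p *m _) 0 0 in y0 *.
set k := - _ * _.
have dZD (a c : R) (x z w : 'rV[R]_3) : dot (invmx (g p)) w (a *: x + c *: z) =
    a * dot (invmx (g p)) w x + c * dot (invmx (g p)) w z.
  by rewrite /dot linearD !linearZ /= mulmxDr -!scalemxAr !mxE.
have ut : dot (invmx (g p)) (u p) (t p *m g p) = y.
  rewrite /dot trmx_mul (lorentzian_sym lg) mulmxA mulmxKV ?(lorentzian_unit lg) //.
have tt : dot (invmx (g p)) (t p *m g p) (t p *m g p) = gdot g p (t p) (t p).
  rewrite /dot trmx_mul (lorentzian_sym lg) mulmxA mulmxKV ?(lorentzian_unit lg) //.
split; first by rewrite dZD ut uup mulr0 addr0 mulVf.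
rewrite dZD !(dotC _ (u p) (hs p)) !(dotC (_ + _) _ (hs p)) !dZD uup ut tt.
rewrite (dotC _ (u p) (hs p)) ut /k; field.
exact: y0.
Qed.

Lemma smooth_conjugate_null : smooth_form setT (conjugate_null u).
Proof.
have oT := @openT M; have [st _] := gt.
have sy := smooth_contract oT su st.
have stf := smooth_flat lg oT st.
have sn : smooth_on setT (fun p => ((u p *m (t p)^T) 0 0)^-1).
  by apply: smooth_onV => // p _; exact: null_timelike_neq0.
apply: smooth_formD => //; apply: smooth_formZ => //.
apply: smooth_onM => //.
  apply: smooth_onN => //.
  exact: (smooth_contract oT stf st).
apply: smooth_onV => // [p _|].
  by rewrite mulf_neq0 ?pnatr_eq0 // expf_neq0 // null_timelike_neq0.
apply: smooth_onZ => //.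
exact: (smooth_onM oT sy sy).
Qed.

End Conjugate.

Variable nabla : vfield M -> M -> 'M[R]_3.
Hypothesis nlc : levi_civita g nabla.

(** The skewness assumed of [nabla u] is the Killing equation for the vector field dual to [u]. The
    spinor enters the construction of the coframe only through this property of its current. *)
Lemma null_coframe_of_killing (u : oneform M) :
  smooth_form setT u -> (forall p, u p != 0) ->
  (forall p, cogdot g p (u p) (u p) = 0) ->
  (forall p, (dual_conn nabla u p)^T = - dual_conn nabla u p) ->
  exists (v n : oneform M) (f : M -> R) (kappa : oneform M),
   [/\ null_coframe g u v n, smooth_on [set: M] f, smooth_form [set: M] kappa &
       covariant_system nabla u v n f kappa].
Proof.
move=> su u0 uu ku; have oT := @openT M; have [mn _] := nlc.
pose v := conjugate_null u.
have sv : smooth_form setT v by exact: smooth_conjugate_null.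
have uv p : cogdot g p (u p) (v p) = 1 by case: (conjugate_nullE u0 uu p).
have vv p : cogdot g p (v p) (v p) = 0 by case: (conjugate_nullE u0 uu p).
pose n : oneform M := fun p => - (vol g p *: cross (sharp g u p) (sharp g v p)).
have sn : smooth_form setT n by exact: smooth_cross_form.
have nc : null_coframe g u v n.
  split=> //; apply/(hodge2_wedgeP lg) => p; by rewrite /n opprK.
have sX (a : oneform M) : smooth_form setT a -> smooth_vf setT (sharp g a).
  exact: smooth_sharp.
have sd (a : oneform M) : smooth_form setT a -> smooth_bilin setT (dual_conn nabla a).
  by move=> sa; apply: smooth_dual_conn => //; case: mn.
(* Both coefficients are forced: evaluating f n /\ u on the duals of [n] and [v] returns f, and
   kappa(w) has to be the inner product of the derivative of [v] along w with [n]. *)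
pose f p := bil (invmx (g p)) (dual_conn nabla u p) (n p) (v p).
pose kappa : oneform M := fun p =>
  (dual_conn nabla v p *m invmx (g p) *m (n p)^T)^T.
exists v, n, f, kappa; split=> //.
- have := smooth_contract oT
    (smooth_bilin_contract oT (sd u su) (sX v sv)) (sX n sn).
  apply: smooth_on_ext => // p _.
  rewrite row_dotC trmxK /f /bil /sharp trmx_mul hs !mulmxA.
  by [].
- apply: smooth_form_ext (smooth_bilin_contract oT (sd v sv) (sX n sn)) => // p _.
  by rewrite /kappa /sharp [(n p *m _)^T]trmx_mul hs mulmxA.
move=> p; have gr := null_coframe_gram lg p nc.
have pr a b k : smooth_form setT a -> smooth_form setT b ->
    (forall q, cogdot g q (a q) (b q) = k) ->
    metric_pair (invmx (g p)) (dual_conn nabla a p) (dual_conn nabla b p) (a p) (b p).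
  exact: metric_pair_dual_conn.
have gn q := null_coframe_gram lg q nc.
(* Half the derivative of g(u, u) = 0: the second slot of [nabla u] annihilates the dual of [u]. *)
have Bu : dual_conn nabla u p *m invmx (g p) *m (u p)^T = 0.
  have := metric_dual_connC lg mn oT (I : setT p) su su.
  have -> : (fun q => cogdot g q (u q) (u q)) = (fun=> 0) by apply/funext.
  rewrite dfun_cst trmx0 => /esym E; apply/colP => i.
  by have /colP/(_ i) := E; rewrite [LHS]mxE !mxE; lra.
have Nu : dual_conn nabla u p = f p *: wedge (n p) (u p).
  exact: (skew_null_wedge (hs p) gr (ku p) Bu).
have [Nv Nn] := covariant_of_metric (hs p) gr Nu
  (pr v v 0 sv sv vv)
  (pr n n 1 sn sn (fun q => let: conj _ (And3 x _ _) := gn q in x))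
  (pr u v 1 su sv uv)
  (pr u n 0 su sn (fun q => let: conj _ (And3 _ x _) := gn q in x))
  (pr v n 0 sv sn (fun q => let: conj _ (And3 _ _ x) := gn q in x)).
by split.
Qed.

Lemma skew_torsion_parallel_spinor_coframe :
  admits_skew_torsion_parallel_spinor g ->
  exists (u v n : oneform M) (f : M -> R) (kappa : oneform M),
   [/\ null_coframe g u v n, smooth_on [set: M] f, smooth_form [set: M] kappa &
       covariant_system nabla u v n f kappa].
Proof.
move=> [S [D [DS [s [mD sD lift [ss s0] ps]]]]]; have [cDS loc] := lift.
have nz := parallel_nowhere_zero lift ss s0 ps.
exists (dirac_form s); apply: null_coframe_of_killing.
- exact: (smooth_flat lg (@openT M) (smooth_current ss)).
- move=> p; have [U [b [e [oU Up fr _]]]] := loc p.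
  apply: contra (nz p) => /eqP d0; apply/eqP.
  exact: (dirac_eq0 lg fr Up d0).
- move=> p; have [U [b [e [oU Up fr _]]]] := loc p.
  exact: (dirac_null lg fr s Up).
- move=> p; apply: (skew_torsion_killing lg nlc mD sD).
  have [U [b [e [oU Up fr H]]]] := loc p.
  apply/row_matrixP => i; rewrite rowE row0.
  have [Om [W [HO trW comm WE]]] := H p Up (delta_mx 0 i).
  exact: (dirac_parallel lg oU fr ss cDS ps Up HO trW comm WE).
Qed.

End Forward.

(** * Spinors from a coframe *)

Section TrivialBundle.
Variables (R : realType) (M : oriented_manifold R).

Let tfib : M -> lmodType R := fun=> 'rV[R]_2.

Fact trivial_basis (j : unit) (p : M) : [set: M] p -> forall s : tfib p,
  exists! a : 'rV[R]_2, s = \sum_i a 0 i *: (delta_mx 0 i : 'rV[R]_2).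
Proof.
move=> _ s; exists s; split; first exact: row_sum_delta.
by move=> a ->; rewrite -row_sum_delta.
Qed.

Fact trivial_smooth (j k : unit) : exists A : M -> 'M[R]_2,
  (forall i l, smooth_on ([set: M] `&` [set: M]) (fun p => A p i l)) /\
  (forall p : M, [set: M] p -> [set: M] p -> forall i,
     delta_mx 0 i = \sum_l A p i l *: (delta_mx 0 l : 'rV[R]_2)).
Proof.
exists (fun=> 1%:M); split=> [i l|p _ _ i]; first exact: smooth_on_cst.
rewrite [LHS]row_sum_delta; apply: eq_bigr => l _.
by rewrite !mxE eqxx eq_sym.
Qed.

Definition trivial_plane : plane_bundle M :=
  @PlaneBundle R M tfib unit (fun=> setT) (fun _ i _ => delta_mx 0 i)
    (fun=> openT) (fun p => ex_intro _ tt I) trivial_basis trivial_smooth.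

Lemma smooth_trivial_sec (U : set M) (s : M -> 'rV[R]_2) : open U ->
  smooth_sec (S := trivial_plane) U s <-> smooth_mx U s.
Proof.
move=> oU; split=> [/(_ tt)[a [sa aE]] i j|ss j]; last first.
  exists s; split=> [i|p _ _]; last exact: row_sum_delta.
  by apply: smooth_on_sub (ss 0 i) => q [].
rewrite ord1; apply: smooth_on_ext (smooth_on_sub _ (sa j)) => //.
by move=> p Up; rewrite [s p]aE // -row_sum_delta.
Qed.

End TrivialBundle.

(** * The spinor bundle of a global orthonormal coframe *)

Section CoframeBundle.
Variables (R : realType) (M : oriented_manifold R) (g : bilin M).
Hypothesis lg : lorentzian g.
Variables (e : M -> 'M[R]_3).
Hypotheses (oe : forall p, Defs.orthonormal g p (e p))
  (se : forall a, smooth_form setT (fun p => row a (e p))).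

(** The components of [a] in the coframe [e]: inner products with its rows, with [eta R] correcting
    the sign of the timelike one. *)
Definition coframe_coord p (a : 'rV[R]_3) : 'rV[R]_3 :=
  a *m invmx (g p) *m (e p)^T *m eta R.

Lemma eta_sqr : eta R *m eta R = 1%:M.
Proof.
apply/matrixP => i j; rewrite !mxE sum3E !mxE.
by case: (ord3P i) => ->; case: (ord3P j) => -> /=; lra.
Qed.

Lemma eta_tr : (eta R)^T = eta R.
Proof. exact: tr_diag_mx. Qed.

Lemma coframe_coord_row p a : coframe_coord p (row a (e p)) = delta_mx 0 a.
Proof.
rewrite /coframe_coord -!row_mul (oe p) eta_sqr.
by rewrite rowE mulmx1.
Qed.

Lemma coframe_coord_norm p a :
  (coframe_coord p a *m eta R *m (coframe_coord p a)^T) 0 0 = cogdot g p a a.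
Proof.
have E : e p *m (invmx (g p) *m (e p)^T *m eta R) = 1%:M.
  by rewrite !mulmxA (oe p) eta_sqr.
have E' := mulmx1C E.
rewrite /coframe_coord !trmx_mul eta_tr trmxK (lorentzian_inv_sym lg) !mulmxA.
rewrite -(mulmxA _ (eta R) (eta R)) eta_sqr mulmx1 /cogdot.
congr (fun_of_matrix _ 0 0); rewrite -!mulmxA; congr (_ *m _).
by rewrite !mulmxA E' mul1mx.
Qed.

Lemma slash_linear (x : R) (a b : 'rV[R]_3) :
  slash (x *: a + b) = x *: slash a + slash b.
Proof.
rewrite /slash scaler_sumr -big_split; apply: eq_bigr => i _.
by rewrite !mxE scalerDl scalerA.
Qed.

Lemma slashE (x : 'rV[R]_3) :
  [/\ slash x 0 0 = x 0 0, slash x 0 1 = x 0 1 + x 0 2%:R,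
      slash x 1 0 = x 0 1 - x 0 2%:R & slash x 1 1 = - x 0 0].
Proof. by split; rewrite /slash summxE sum3E !mxE /=; ring. Qed.

Lemma slash_sqr (x : 'rV[R]_3) :
  slash x *m slash x = ((x *m eta R *m x^T) 0 0)%:M.
Proof.
have [s00 s01 s10 s11] := slashE x.
apply/matrixP => i j; rewrite mxE sum2E.
case: (ord2P i) => ->; case: (ord2P j) => ->;
  rewrite ?s00 ?s01 ?s10 ?s11 !(mxE, sum3E) /=; ring.
Qed.

Lemma slash_delta (a : 'I_3) : slash (delta_mx 0 a) = gam R a.
Proof.
rewrite /slash (bigD1 a) //= big1 => [|i ia]; first by rewrite mxE !eqxx scale1r addr0.
by rewrite mxE (negbTE ia) scale0r.
Qed.

Let tp := trivial_plane M.

(** Spinors are row vectors, so the gamma matrices act on the right through their transposes. *)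
Definition trivial_cl p (a : 'rV[R]_3) (s : fib tp p) : fib tp p :=
  (s : 'rV[R]_2) *m (slash (coframe_coord p a))^T.

(** The determinant of two rows. Trace-free matrices, hence all [slash x], are skew-adjoint for
    it. *)
Definition trivial_pairing p (s t : fib tp p) : R :=
  (s : 'rV[R]_2) 0 0 * (t : 'rV[R]_2) 0 1 - (s : 'rV[R]_2) 0 1 * (t : 'rV[R]_2) 0 0.

Fact trivial_cl_linearl p (x : R) a b (s : fib tp p) :
  trivial_cl (x *: a + b) s = x *: trivial_cl a s + trivial_cl b s.
Proof.
rewrite /trivial_cl /coframe_coord !mulmxDl -!scalemxAl slash_linear.
by rewrite linearD linearZ /= mulmxDr -scalemxAr.
Qed.

Fact trivial_cl_linearr p (x : R) a (s t : fib tp p) :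
  trivial_cl a (x *: s + t) = x *: trivial_cl a s + trivial_cl a t.
Proof. by rewrite /trivial_cl mulmxDl -scalemxAl. Qed.

Fact trivial_cl_sq p a (s : fib tp p) :
  trivial_cl a (trivial_cl a s) = cogdot g p a a *: s.
Proof.
rewrite /trivial_cl -mulmxA -trmx_mul slash_sqr tr_scalar_mx.
by rewrite coframe_coord_norm mul_mx_scalar.
Qed.

(** [gam R 0] is diag(1, -1), so adding or subtracting its action projects a nonzero vector of [W]
    onto a coordinate axis, and [gam R 1] exchanges the two axes. *)
Fact trivial_cl_irreducible p : irreducible_module (@trivial_cl p).
Proof.
move=> W W0 WD WZ Wcl.
have gW a (s : 'rV[R]_2) : W s -> W (s *m (gam R a)^T).
  by move=> /(Wcl (row a (e p))); rewrite /trivial_cl coframe_coord_row slash_delta.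
have g1 i : (delta_mx 0 i : 'rV[R]_2) *m (gam R 1)^T =
    (delta_mx 0 (if i == 0 then 1 else 0) : 'rV[R]_2).
  apply/rowP => j; rewrite !(mxE, sum2E).
  by case: (ord2P i) => ->; case: (ord2P j) => -> /=; ring.
have full i : W (delta_mx 0 i : 'rV[R]_2) -> W = setT.
  move=> Wi; have Wi' := gW 1 _ Wi; rewrite g1 in Wi'.
  have [Wa Wb] : W (delta_mx 0 0 : 'rV[R]_2) /\ W (delta_mx 0 1 : 'rV[R]_2).
    by move: Wi Wi'; case: (ord2P i) => -> /=.
  apply/seteqP; split=> // s _; rewrite [s]row_sum_delta sum2E.
  by apply: WD; exact: WZ.
case: (pselect (exists2 s, W s & s != 0)) => [[s Ws s0]|H]; last first.
  left; apply/seteqP; split=> [s Ws|s -> //]; apply/eqP; apply: contraT => s0.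
  by case: H; exists s.
right; have Wg := gW 0 s Ws.
have E0 : (s + s *m (gam R 0)^T : 'rV[R]_2) = (2 * s 0 0) *: delta_mx 0 0.
  apply/rowP => j; rewrite !(mxE, sum2E).
  by case: (ord2P j) => -> /=; ring.
have E1 : (s + (-1) *: (s *m (gam R 0)^T) : 'rV[R]_2) = (2 * s 0 1) *: delta_mx 0 1.
  apply/rowP => j; rewrite !(mxE, sum2E).
  by case: (ord2P j) => -> /=; ring.
have D0 := WD _ _ Ws Wg; have D1 := WD _ _ Ws (WZ (-1) _ Wg).
have [s00|s00] := eqVneq (s 0 0) 0; last first.
  apply: (full 0); have := WZ (2 * s 0 0)^-1 _ D0; rewrite E0 scalerA mulVf ?scale1r //.
  by rewrite mulf_neq0 ?pnatr_eq0.
have s01 : s 0 1 != 0.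
  apply: contra s0 => /eqP s01; apply/eqP/rowP => j; rewrite [RHS]mxE.
  by case: (ord2P j) => ->.
apply: (full 1); have := WZ (2 * s 0 1)^-1 _ D1; rewrite E1 scalerA mulVf ?scale1r //.
by rewrite mulf_neq0 ?pnatr_eq0.
Qed.

Fact trivial_cl_smooth (U : set M) : open U ->
  forall a (s : forall p, fib tp p), smooth_form U a -> smooth_sec U s ->
  smooth_sec U (fun p => trivial_cl (a p) (s p)).
Proof.
move=> oU a s sa ss; apply/(smooth_trivial_sec _ oU).
have {}ss : smooth_mx U (s : M -> 'rV[R]_2) by exact/smooth_trivial_sec.
apply: (smooth_mxM oU ss); apply: (smooth_mxT oU) => i j.
have sx k : smooth_on U (fun p => coframe_coord p (a p) 0 k).
  have se' : smooth_form U (fun p => row k (e p)) by apply: smooth_form_sub (se k).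
  have := smooth_onM oU (smooth_on_cst U (eta R k k)) (smooth_cogdot lg oU sa se').
  apply: smooth_on_ext => // p _.
  rewrite /coframe_coord /cogdot tr_row [RHS]mxE (bigD1 k) //= big1 ?addr0 => [|l lk].
    rewrite mulrC; congr (_ * _).
    by rewrite colE mulmxA -colE [LHS]mxE.
  by rewrite /eta [X in _ * X]mxE (negbTE lk) mulr0n mulr0.
have := smooth_on_sum (index_enum 'I_3) oU
  (fun k => smooth_onM oU (sx k) (smooth_on_cst U (gam R k i j))).
by apply: smooth_on_ext => // p _; rewrite /slash summxE;
  apply: eq_bigr => k _; rewrite [RHS]mxE.
Qed.

Fact trivial_pairing_linear p (x : R) (s s' t : fib tp p) :
  trivial_pairing (x *: s + s') t = x * trivial_pairing s t + trivial_pairing s' t.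
Proof. by rewrite /trivial_pairing !mxE; ring. Qed.

Fact trivial_pairing_skew p (s t : fib tp p) :
  trivial_pairing s t = - trivial_pairing t s.
Proof. by rewrite /trivial_pairing; ring. Qed.

Fact trivial_pairing_nondeg p (s : fib tp p) :
  (forall t, trivial_pairing s t = 0) -> s = 0.
Proof.
move=> H; apply/rowP => j.
have := H (delta_mx 0 0 : 'rV[R]_2); have := H (delta_mx 0 1 : 'rV[R]_2).
rewrite /trivial_pairing !mxE /=.
by case: (ord2P j) => ->; lra.
Qed.

Fact trivial_pairing_smooth (U : set M) : open U ->
  forall s t : forall p, fib tp p, smooth_sec U s -> smooth_sec U t ->
  smooth_on U (fun p => trivial_pairing (s p) (t p)).
Proof.
move=> oU s t /(smooth_trivial_sec _ oU) ss /(smooth_trivial_sec _ oU) st.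
exact: (smooth_onB oU (smooth_onM oU (ss 0 0) (st 0 1))
  (smooth_onM oU (ss 0 1) (st 0 0))).
Qed.

Fact trivial_cl_skew p a (s t : fib tp p) :
  trivial_pairing (trivial_cl a s) t = - trivial_pairing s (trivial_cl a t).
Proof.
have [s00 s01 s10 s11] := slashE (coframe_coord p a).
rewrite /trivial_pairing /trivial_cl; move: s00 s01 s10 s11.
move: (slash _) => A A00 A01 A10 A11.
rewrite !(mxE, sum2E) A00 A01 A10 A11; ring.
Qed.

Definition coframe_bundle : paired_spinor_bundle g :=
  @PairedSpinorBundle R M g tp trivial_cl trivial_cl_linearl trivial_cl_linearr
    trivial_cl_sq trivial_cl_irreducible trivial_cl_smooth trivial_pairing
    trivial_pairing_linear trivial_pairing_skew trivial_pairing_nondeg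
    trivial_pairing_smooth trivial_cl_skew.

Lemma coframe_spin_frame :
  spin_frame (S := coframe_bundle) setT (fun i _ => (delta_mx 0 i : 'rV[R]_2)) e.
Proof.
split=> //.
- by move=> i; apply/(smooth_trivial_sec _ openT); exact: smooth_mx_cst.
- by move=> p _; rewrite /pairing /= /trivial_pairing !mxE /=; ring.
move=> p _ a j; rewrite /cl /= /trivial_cl coframe_coord_row slash_delta.
rewrite -rowE; apply/rowP => k; rewrite summxE !mxE (bigD1 k) //= big1.
  by rewrite !mxE !eqxx mulr1 addr0.
by move=> l lk; rewrite [LHS]mxE [X in _ * X]mxE eqxx /= eq_sym (negbTE lk) mulr0.
Qed.

End CoframeBundle.

(** * The skew-torsion connection of a null coframe *)

Section DotAlgebra.
Variable R : realType.
Implicit Types (h : 'M[R]_3) (x y z : 'rV[R]_3).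

Lemma dotDl h x y z : dot h (x + y) z = dot h x z + dot h y z.
Proof. by rewrite /dot !mulmxDl mxE. Qed.

Lemma dotDr h x y z : dot h z (x + y) = dot h z x + dot h z y.
Proof. by rewrite /dot linearD mulmxDr mxE. Qed.

Lemma dotZl h k x z : dot h (k *: x) z = k * dot h x z.
Proof. by rewrite /dot -!scalemxAl mxE. Qed.

Lemma dotZr h k x z : dot h z (k *: x) = k * dot h z x.
Proof. by rewrite /dot linearZ -scalemxAr mxE. Qed.

End DotAlgebra.

Section Backward.
Variables (R : realType) (M : oriented_manifold R) (g : bilin M).
Hypothesis lg : lorentzian g.
Variable nabla : vfield M -> M -> 'M[R]_3.
Hypothesis nlc : levi_civita g nabla.
Variables (u v n : oneform M) (f : M -> R) (kappa : oneform M).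
Hypotheses (nc : null_coframe g u v n) (sf : smooth_on [set: M] f)
  (sk : smooth_form [set: M] kappa)
  (cov : covariant_system nabla u v n f kappa).

Let hs p : (invmx (g p))^T = invmx (g p) := lorentzian_inv_sym lg p.
Let oT : open [set: M] := openT.

Lemma smooth_endo_bilin (U : set M) (b : bilin M) : open U -> smooth_bilin U b ->
  smooth_endo U (fun p => b p *m invmx (g p)).
Proof.
move=> oU sb c ac i j; have oV := openI oU (cdom_open ac).
have [sg _ _] := lg.
have ub p : (U `&` cdom c) p -> bilin_in c g p \in unitmx.
  move=> [_ cp]; rewrite /bilin_in -/(mto c p) !unitmx_mul unitmx_tr.
  by rewrite (lorentzian_unit lg) (mulmx1_unit (mtoK ac cp)).1.
have sg' : smooth_mx (U `&` cdom c) (bilin_in c g).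
  by move=> k l; apply: smooth_on_sub (sg c ac k l) => q [].
have := smooth_mxM oV (sb c ac) (smooth_invmx oV ub sg') i j.
apply: smooth_on_ext => // p [_ cp].
rewrite invmx_bilin_in // /bilin_in /endo_in -/(mto c p) -/(mof c p).
move: (mto c p) (mof c p) (mofK ac cp) => J K KJ.
by rewrite !mulmxA -(mulmxA (J *m b p)) -trmx_mul KJ trmx1 mulmx1.
Qed.

(* The volume form u /\ v /\ n with x in its middle slot, up to sign. *)
Definition vol_form p (x : 'rV[R]_3) : 'M[R]_3 :=
  (u p *m x^T) 0 0 *: wedge (v p) (n p) +
  ((v p *m x^T) 0 0 *: wedge (n p) (u p) + (n p *m x^T) 0 0 *: wedge (u p) (v p)).

(** Spelled out as a determinant, the form shows its skewness in every pair of slots to [ring]. *)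
Lemma vol_formE p (w x y : 'rV[R]_3) : (w *m vol_form p x *m y^T) 0 0 =
  let d (a z : 'rV[R]_3) := (a *m z^T) 0 0 in
  d (u p) x * (d (v p) w * d (n p) y - d (n p) w * d (v p) y) +
  d (v p) x * (d (n p) w * d (u p) y - d (u p) w * d (n p) y) +
  d (n p) x * (d (u p) w * d (v p) y - d (v p) w * d (u p) y).
Proof.
have wE (a b : 'rV[R]_3) : (w *m wedge a b *m y^T) 0 0 =
   (a *m w^T) 0 0 * (b *m y^T) 0 0 - (b *m w^T) 0 0 * (a *m y^T) 0 0.
  rewrite /wedge mulmxBr mulmxBl !mul_tens -!scalemxAl.
  rewrite [LHS]mxE [X in _ + X]mxE [X in X - _]mxE [X in _ - X]mxE.
  by rewrite !(row_dotC w).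
rewrite /vol_form !mulmxDr !mulmxDl -!scalemxAr -!scalemxAl.
rewrite [LHS]mxE [X in _ + X]mxE [X in X + _]mxE [X in _ + (X + _)]mxE.
by rewrite [X in _ + (_ + X)]mxE !wE /=; ring.
Qed.

(** The coefficient - f is the one for which the dual connection, applied to [u], gains exactly - f
    n /\ u and so cancels the derivative prescribed by the covariant system. *)
Definition skew_conn (X : vfield M) (p : M) : 'M[R]_3 :=
  nabla X p - f p *: (vol_form p (X p) *m invmx (g p)).

Lemma vol_formD p x y : vol_form p (x + y) = vol_form p x + vol_form p y.
Proof.
have E (a : 'rV[R]_3) :
    (a *m (x + y)^T) 0 0 = (a *m x^T) 0 0 + (a *m y^T) 0 0.
  by rewrite linearD mulmxDr mxE.
by rewrite /vol_form !E !scalerDl [RHS]addrACA [X in _ = _ + X]addrACA.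
Qed.

Lemma vol_formZ p k x : vol_form p (k *: x) = k *: vol_form p x.
Proof.
have E (a : 'rV[R]_3) : (a *m (k *: x)^T) 0 0 = k * (a *m x^T) 0 0.
  by rewrite linearZ -scalemxAr mxE.
by rewrite /vol_form !E !scalerDr !scalerA.
Qed.

Lemma smooth_wedge (U : set M) (a b : oneform M) : open U ->
  smooth_form U a -> smooth_form U b ->
  smooth_bilin U (fun p => wedge (a p) (b p)).
Proof.
move=> oU sa sb c ac i j; have oV := openI oU (cdom_open ac).
apply: smooth_on_ext (smooth_onB oV (smooth_tens oU sa sb ac i j)
   (smooth_tens oU sb sa ac i j)) => // p _.
by rewrite /wedge /bilin_in mulmxBr mulmxBl [RHS]mxE [X in _ = _ + X]mxE.
Qed.

Lemma skew_conn_connection : is_connection skew_conn.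
Proof.
have [[cn _] _] := nlc; have [[su sv sn] _ _ _ _] := nc.
move=> U oU; have [nS nD nZ] := cn U oU.
have sub (a : oneform M) : smooth_form setT a -> smooth_form U a.
  exact: smooth_form_sub.
split=> [X sX|X Y sX sY p Up|k X sk' sX p Up].
- have sT : smooth_bilin U (fun p => f p *: vol_form p (X p)).
    apply: smooth_bilinZ => //; first exact: smooth_on_sub sf.
    have sC (a b d : oneform M) : smooth_form setT a -> smooth_form setT b ->
        smooth_form setT d ->
        smooth_bilin U (fun p => (a p *m (X p)^T) 0 0 *: wedge (b p) (d p)).
      move=> sa sb sd; apply: smooth_bilinZ => //.
        exact: (smooth_contract oU (sub _ sa) sX).
      by apply: smooth_wedge => //; exact: sub.
    by apply: smooth_bilinD => //; [exact: sC|apply: smooth_bilinD => //; exact: sC].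
  have sB := smooth_endo_bilin oU sT.
  move=> c ac i j; have oV := openI oU (cdom_open ac).
  apply: smooth_on_ext (smooth_onB oV (nS X sX c ac i j) (sB c ac i j)) => // p _.
  rewrite /endo_in /skew_conn mulmxBr mulmxBl [RHS]mxE [X in _ = _ + X]mxE.
  by rewrite -!scalemxAl.
- rewrite /skew_conn nD // vol_formD mulmxDl scalerDr opprD.
  by rewrite addrACA.
- rewrite /skew_conn nZ // vol_formZ -!scalemxAl scalerBr addrA.
  by rewrite !scalerA mulrC.
Qed.

Lemma gdotBl p x y z : gdot g p (x - y) z = gdot g p x z - gdot g p y z.
Proof. by rewrite /gdot !mulmxBl !mxE. Qed.

Lemma gdotBr p x y z : gdot g p z (x - y) = gdot g p z x - gdot g p z y.
Proof. by rewrite !(gdotC lg p z) gdotBl. Qed.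

Lemma gdot_vol p (k : R) w x y :
  gdot g p (w *m (k *: (vol_form p x *m invmx (g p)))) y =
  k * (w *m vol_form p x *m y^T) 0 0.
Proof.
rewrite /gdot -scalemxAr -!scalemxAl mulmxA mulmxKV ?(lorentzian_unit lg) //.
by rewrite [LHS]mxE.
Qed.

(** Compatibility uses the skewness of the volume form in the two slots that hold the differentiated
    field and the field paired with its derivative. *)
Lemma skew_conn_metric : metric_connection g skew_conn.
Proof.
split; first exact: skew_conn_connection.
have [[_ mn] _] := nlc.
move=> U oU X Y sX sY p Up w; rewrite (mn U oU X Y sX sY p Up w).
rewrite /skew_conn !mulmxBr gdotBl gdotBr gdot_vol.
rewrite (gdotC lg p (X p) (w *m (_ *: _))) gdot_vol !vol_formE /=; ring.
Qed.

(** The torsion is the antisymmetrised correction, hence a multiple of the volume form once its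
    index is lowered. *)
Lemma skew_conn_torsion : skew_torsion g skew_conn.
Proof.
have [_ tf] := nlc.
move=> U oU X Y Z sX sY sZ p Up.
have T Y' : smooth_vf U Y' -> torsion skew_conn X Y' p =
    Y' p *m (f p *: (vol_form p (X p) *m invmx (g p))) -
    X p *m (f p *: (vol_form p (Y' p) *m invmx (g p))).
  move=> sY'; rewrite -[RHS]addr0 -(tf U oU X Y' sX sY' p Up).
  rewrite /torsion /skew_conn !mulmxBr.
  by apply/rowP => i; rewrite !mxE; ring.
by rewrite !T // !gdotBl !gdot_vol !vol_formE /=; ring.
Qed.

(** Duality reverses the sign of the correction. In this form [a] enters only through contractions
    with wedges of the coframe, so the Gram relations suffice to evaluate it on [u], [v] and [n]. *)
Lemma dual_skew_conn (a : oneform M) p :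
  dual_conn skew_conn a p = dual_conn nabla a p +
    f p *: (tens (a p *m invmx (g p) *m (wedge (v p) (n p))^T) (u p) +
    (tens (a p *m invmx (g p) *m (wedge (n p) (u p))^T) (v p) +
     tens (a p *m invmx (g p) *m (wedge (u p) (v p))^T) (n p))).
Proof.
set h := invmx (g p); set c := chart_at p.
have E i j : dual_conn skew_conn a p i j = dual_conn nabla a p i j +
    f p * (vol_form p (delta_mx 0 j) *m h *m (a p)^T) i 0.
  have dcE D : dual_conn D a p i j =
      pd p (fun q => form_in c a q 0 j) i - (D (coord_vf c j) p *m (a p)^T) i 0.
    rewrite [LHS]mxE; congr (_ - _); rewrite [RHS]mxE.
    by apply: eq_bigr => k _; rewrite [(a p)^T k 0]mxE.
  rewrite !dcE /skew_conn mulmxBl coord_vf_id -scalemxAl -/h.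
  by rewrite [X in _ - X]mxE [X in _ - (_ + X)]mxE [X in _ - (_ - X)]mxE; ring.
apply/matrixP => i j; rewrite E [RHS]mxE; congr (_ + _); rewrite [RHS]mxE; congr (_ * _).
have wE (b d : 'rV[R]_3) : wedge b d *m h *m (a p)^T = (a p *m h *m (wedge b d)^T)^T.
  by rewrite !trmx_mul trmxK hs mulmxA.
rewrite /vol_form !mulmxDl -!scalemxAl !wE.
move: (_ *m (wedge (v p) (n p))^T) (_ *m (wedge (n p) (u p))^T)
  (_ *m (wedge (u p) (v p))^T).
move=> x y z; rewrite !trmx_delta -!colE !mxE !big_ord1 !mxE.
ring.
Qed.

(** As g(u, v) = 1, the forms u/2 + v and u/2 - v have norms 1 and -1; the timelike one comes last,
    as in [eta]. The last two rows add up to [u], and by [dirac_spin_frame] that sum is the Dirac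
    current of the first vector of a spin frame over this coframe. *)
Definition null_ortho p : 'M[R]_3 :=
  \matrix_i frame3 (n p) (2^-1 *: u p + v p) (2^-1 *: u p - v p) i.

Lemma null_ortho_orthonormal p : Defs.orthonormal g p (null_ortho p).
Proof.
have [[uu uv vv] [nn un vn]] := null_coframe_gram lg p nc.
have gE := (uu, uv, vv, nn, un, vn, (dotC (v p) (u p) (hs p), uv),
  (dotC (n p) (u p) (hs p), un), (dotC (n p) (v p) (hs p), vn)).
apply/matrixP => i j.
have -> : (null_ortho p *m invmx (g p) *m (null_ortho p)^T) i j =
    dot (invmx (g p)) (row i (null_ortho p)) (row j (null_ortho p)).
  rewrite /dot -row_mul [LHS]mxE [RHS]mxE; apply: eq_bigr => k _.
  by congr (_ * _); [rewrite [RHS]mxE|rewrite [LHS]mxE [RHS]mxE [RHS]mxE].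
have A (k1 k2 k3 k4 : R) : dot (invmx (g p)) (k1 *: u p + k2 *: v p)
    (k3 *: u p + k4 *: v p) = k1 * k4 + k2 * k3.
  have -> : dot (invmx (g p)) (k1 *: u p + k2 *: v p) (k3 *: u p + k4 *: v p) =
      k1 * k3 * dot (invmx (g p)) (u p) (u p) +
      k1 * k4 * dot (invmx (g p)) (u p) (v p) +
      (k2 * k3 * dot (invmx (g p)) (v p) (u p) +
       k2 * k4 * dot (invmx (g p)) (v p) (v p)).
    by rewrite !dotDl !dotDr !dotZl !dotZr; ring.
  by rewrite !gE; ring.
have B (k1 k2 : R) : dot (invmx (g p)) (k1 *: u p + k2 *: v p) (n p) = 0.
  by rewrite dotDl !dotZl un vn !mulr0 addr0.
have B' (k1 k2 : R) : dot (invmx (g p)) (n p) (k1 *: u p + k2 *: v p) = 0.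
  by rewrite dotC.
have E1 : 2^-1 *: u p + v p = 2^-1 *: u p + 1 *: v p by rewrite scale1r.
have E2 : 2^-1 *: u p - v p = 2^-1 *: u p + (-1) *: v p by rewrite scaleN1r.
rewrite !rowK E1 E2 !mxE.
case: (ord3P i) => ->; case: (ord3P j) => ->; rewrite /frame3 /=;
  rewrite ?A ?B ?B' ?nn //; lra.
Qed.


Let kap : oneform M := fun p => kappa p + - f p *: v p.

(** The correction turns f n (x) v into f v (x) n, up to sign, and removes the derivative of [u].
    The connection form is left in the line of so(2,1) that annihilates [u], with the single
    coefficient kappa - f v. *)
Lemma skew_conn_frame p :
  [/\ dual_conn skew_conn u p = 0, dual_conn skew_conn v p = tens (kap p) (n p) &
      dual_conn skew_conn n p = - tens (kap p) (u p)].
Proof.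
have [[uu uv vv] [nn un vn]] := null_coframe_gram lg p nc.
have gE := (uu, uv, vv, nn, un, vn, (dotC (v p) (u p) (hs p), uv),
  (dotC (n p) (u p) (hs p), un), (dotC (n p) (v p) (hs p), vn)).
have [Hu Hv Hn] := cov p.
have wE (a b d : 'rV[R]_3) : a *m invmx (g p) *m (wedge b d)^T =
    dot (invmx (g p)) a d *: b - dot (invmx (g p)) a b *: d.
  by rewrite wedgeT /wedge opprB mulmxBr !mul_tens.
rewrite !dual_skew_conn Hu Hv Hn !wE !gE !(scale0r, scale1r, subr0, sub0r, subrr).
have T0 (x : 'rV[R]_3) : tens 0 x = 0 by rewrite /tens trmx0 mul0mx.
have TN (x y : 'rV[R]_3) : tens (- x) y = - tens x y by rewrite -scaleN1r tensZl scaleN1r.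
rewrite !(T0, TN) /kap tensDl tensZl /wedge tensDl tensZl.
move: (tens _ _) (tens (n p) (u p)) (tens (u p) (n p)) (tens (n p) (v p)) => *.
by split; apply/matrixP => i j; rewrite !mxE; ring.
Qed.

End Backward.

Lemma addmxE (R : realType) m n (A B : 'M[R]_(m, n)) i j :
  (A + B) i j = A i j + B i j.
Proof. by rewrite mxE. Qed.

Lemma scalemxE (R : realType) m n (k : R) (A : 'M[R]_(m, n)) i j :
  (k *: A) i j = k * A i j.
Proof. by rewrite mxE. Qed.

(** * The spinor connection on the trivial bundle *)

Section TrivialSpinorConnection.
Variables (R : realType) (M : oriented_manifold R) (kap : oneform M).
Hypothesis skap : smooth_form setT kap.
Let tp := trivial_plane M.

(* In the constant frame (b_0, b_1) this connection has b_0 parallel and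
   D b_1 = kap (x) b_0. *)
Definition null_spinor_conn (s : forall p, fib tp p) (p : M) (w : 'rV[R]_3) :
    fib tp p :=
  (\row_i (w *m (dfun (fun q => (s q : 'rV[R]_2) 0 i) p)^T) 0 0 : 'rV[R]_2) +
  ((w *m (kap p)^T) 0 0 * (s p : 'rV[R]_2) 0 1) *: (delta_mx 0 0 : 'rV[R]_2).

Lemma null_spinor_connE s p w i : (null_spinor_conn s p w : 'rV[R]_2) 0 i =
  (w *m (dfun (fun q => (s q : 'rV[R]_2) 0 i) p)^T) 0 0 +
  (w *m (kap p)^T) 0 0 * (s p : 'rV[R]_2) 0 1 * (i == 0)%:R.
Proof.
rewrite [LHS]mxE [X in X + _]mxE [X in _ + X]mxE [delta_mx _ _ _ _]mxE.
by rewrite eqxx.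
Qed.

Lemma null_spinor_conn_connection : is_connection_on (S := tp) null_spinor_conn.
Proof.
move=> U oU; have sk : smooth_form U kap by exact: smooth_form_sub skap.
split.
- move=> s X /(smooth_trivial_sec _ oU) ss sX; apply/(smooth_trivial_sec _ oU).
  move=> i j; rewrite ord1.
  have sd := smooth_contract oU (smooth_dfun oU (ss 0 j)) sX.
  have sK := smooth_onM oU (smooth_onM oU (smooth_contract oU sk sX) (ss 0 1))
    (smooth_on_cst U (j == 0)%:R).
  apply: smooth_on_ext (smooth_onD oU sd sK) => // p _.
  by rewrite null_spinor_connE !(row_dotC (X p)).
- move=> s _ p _ x w w'; apply/rowP => i.
  rewrite [RHS]mxE [X in _ = X + _]mxE !null_spinor_connE !mulmxDl -!scalemxAl.
  rewrite !addmxE !scalemxE; ring.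
- move=> s t /(smooth_trivial_sec _ oU) ss /(smooth_trivial_sec _ oU) st p Up w.
  apply/rowP => i; rewrite [RHS]mxE !null_spinor_connE.
  have -> : (fun q => (s q + t q : 'rV[R]_2) 0 i) =
      (fun q => (s q : 'rV[R]_2) 0 i + (t q : 'rV[R]_2) 0 i).
    by apply/funext => q; rewrite mxE.
  rewrite (dfunD Up (ss 0 i) (st 0 i)) linearD mulmxDr !addmxE; ring.
move=> f s sf /(smooth_trivial_sec _ oU) ss p Up w.
apply/rowP => i.
rewrite [RHS]mxE [X in _ = X + _]mxE [X in _ = _ + X]mxE !null_spinor_connE.
have -> : (fun q => (f q *: s q : 'rV[R]_2) 0 i) =
    (fun q => f q * (s q : 'rV[R]_2) 0 i).
  by apply/funext => q; rewrite mxE.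
rewrite (dfunM Up sf (ss 0 i)) linearD !linearZ /= mulmxDr -!scalemxAr.
rewrite !addmxE !scalemxE; ring.
Qed.

End TrivialSpinorConnection.

(** * From a null coframe to a parallel spinor *)

Section Backward.
Variables (R : realType) (M : oriented_manifold R) (g : bilin M).
Hypothesis lg : lorentzian g.
Variable nabla : vfield M -> M -> 'M[R]_3.
Hypothesis nlc : levi_civita g nabla.
Variables (u v n : oneform M) (f : M -> R) (kappa : oneform M).
Hypotheses (nc : null_coframe g u v n) (sf : smooth_on [set: M] f)
  (sk : smooth_form [set: M] kappa)
  (cov : covariant_system nabla u v n f kappa).

Lemma smooth_null_ortho a : smooth_form setT (fun p => row a (null_ortho u v n p)).
Proof.
have oT := @openT M; have [[su sv sn] _ _ _ _] := nc.
have s2 : smooth_form setT (fun p => 2^-1 *: u p).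
  by apply: smooth_formZ => //; exact: smooth_on_cst.
have sv' : smooth_form setT (fun p => - v p).
  apply: smooth_form_ext (smooth_formZ oT (smooth_on_cst _ (-1)) sv) => // p _.
  by rewrite scaleN1r.
case: (ord3P a) => ->.
- by apply: smooth_form_ext sn => // p _; rewrite rowK.
- by apply: smooth_form_ext (smooth_formD oT s2 sv) => // p _; rewrite rowK.
- by apply: smooth_form_ext (smooth_formD oT s2 sv') => // p _; rewrite rowK.
Qed.

Lemma coframe_skew_torsion_parallel_spinor :
  admits_skew_torsion_parallel_spinor g.
Proof.
have oT := @openT M; have [[su sv sn] _ _ _ _] := nc.
pose e := null_ortho u v n.
have oe p : Defs.orthonormal g p (e p) by exact: null_ortho_orthonormal.
have se a : smooth_form setT (fun p => row a (e p)) by exact: smooth_null_ortho.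
pose kap : oneform M := fun p => kappa p + - f p *: v p.
have skap : smooth_form setT kap.
  by apply: smooth_formD => //; apply: smooth_formZ => //; exact: smooth_onN.
pose D := skew_conn g nabla u v n f.
exists (coframe_bundle lg oe se), D, (null_spinor_conn kap).
exists (fun=> (delta_mx 0 0 : 'rV[R]_2)); split.
- exact: (skew_conn_metric lg nlc nc sf).
- exact: (skew_conn_torsion lg nlc).
- split; first exact: null_spinor_conn_connection.
  move=> p0; exists setT, (fun i _ => (delta_mx 0 i : 'rV[R]_2)), e.
  split=> //; first exact: coframe_spin_frame.
  move=> p _ w; pose x := (w *m (kap p)^T) 0 0.
  (* The connection form of [D] in the coframe [e], read off from [skew_conn_frame] with [u] equal
     to the sum of rows 1 and 2. The matrix [W] below is the nilpotent element of sl(2,R) lying over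
     it: it kills b_0 and sends b_1 to x b_0. *)
  pose Om : 'M[R]_3 := \matrix_i frame3
    (- x *: (delta_mx 0 1 + delta_mx 0 2%:R)) (x *: delta_mx 0 0)
    (- x *: delta_mx 0 0) i.
  pose W : 'M[R]_2 := x *: delta_mx 0 1.
  have [Du Dv Dn] := skew_conn_frame lg nc cov p.
  exists Om, W; split.
  + have cst_ (k : R) : smooth_on setT (fun=> k : R) by exact: smooth_on_cst.
    (* As [u] is parallel for [D], only the multiple of [v] contributes; k = 1 and k = -1 give the
       last two rows of the coframe. *)
    have d2 k : dual_conn D (fun q => 2^-1 *: u q + k *: v q) p =
        k *: tens (kap p) (n p).
      rewrite (@dual_connD _ _ D setT (fun q => 2^-1 *: u q) (fun q => k *: v q)) //;
        [|exact: smooth_formZ..].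
      rewrite !(@dual_connZ _ _ D setT) // !dfun_cst Du Dv scaler0 addr0.
      by rewrite /tens !trmx0 !mul0mx !add0r.
    have rE a : row a Om *m e p = \sum_b Om a b *: row b (e p).
      by rewrite mulmx_sum_row; apply: eq_bigr => b _; rewrite mxE.
    have E1 : dual_conn D (fun q => row 1 (e q)) p = tens (kap p) (n p).
      rewrite -[RHS]scale1r -d2; apply: (@dual_conn_near _ _ D setT) => // q _.
      by rewrite rowK scale1r.
    have E2 : dual_conn D (fun q => row 2%:R (e q)) p = - tens (kap p) (n p).
      rewrite -scaleN1r -d2; apply: (@dual_conn_near _ _ D setT) => // q _.
      by rewrite rowK scaleN1r.
    have E0 : dual_conn D (fun q => row 0 (e q)) p = - tens (kap p) (u p).
      by rewrite -Dn; apply: (@dual_conn_near _ _ D setT) => // q _; rewrite rowK.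
    move=> a; rewrite rE sum3E !rowK /frame3 /=.
    case: (ord3P a) => ->; rewrite ?E0 ?E1 ?E2 ?mulmxN mul_tens -/x !mxE /=;
      apply/rowP => k; rewrite !mxE; lra.
  + by rewrite /mxtrace sum2E !mxE /=; ring.
  + move=> a; have [s00 s01 s10 s11] := slashE (row a Om).
    apply/matrixP => i j.
    case: (ord2P i) => ->; case: (ord2P j) => ->; rewrite ?s00 ?s01 ?s10 ?s11;
      case: (ord3P a) => ->; rewrite /W !(mxE, sum2E) /=; ring.
  + move=> j; apply/rowP => i; rewrite null_spinor_connE -/x.
    rewrite dfun_cst trmx0 mulmx0 sum2E.
    by case: (ord2P j) => ->; case: (ord2P i) => ->; rewrite !mxE /=; ring.
- split; first by apply/(smooth_trivial_sec _ oT); exact: smooth_mx_cst.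
  have [p _] := mnonempty M; exists p.
  apply/eqP => /rowP/(_ 0); rewrite !mxE /= => /eqP.
  by rewrite oner_eq0.
- move=> p w; apply/rowP => i; rewrite null_spinor_connE.
  by rewrite dfun_cst trmx0 mulmx0 !mxE /=; ring.
Qed.

End Backward.

Theorem corollary4p8 (R : realType) (M : oriented_manifold R) (g : bilin M)
    (t : vfield M) (nabla : vfield M -> M -> 'M[R]_3)
    (g_lorentzian : lorentzian g) (g_time_oriented : time_orientation g t)
    (g_strongly_spin : strongly_spin g) (nabla_lc : levi_civita g nabla) :
  (admits_skew_torsion_parallel_spinor g <->
   exists (u v n : oneform M) (f : M -> R) (kappa : oneform M),
   [/\ null_coframe g u v n, smooth_on [set: M] f, smooth_form [set: M] kappa &
       covariant_system nabla u v n f kappa])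
  /\
  (forall (u v n : oneform M) (f : M -> R) (kappa : oneform M),
   null_coframe g u v n -> smooth_on [set: M] f ->
   smooth_form [set: M] kappa ->
   (covariant_system nabla u v n f kappa <-> exterior_system u v n f kappa)).
Proof.
split.
  split; first exact: (skew_torsion_parallel_spinor_coframe g_lorentzian
    g_time_oriented nabla_lc).
  move=> [u [v [n [f [kappa [nc sf sk cov]]]]]].
  exact: (coframe_skew_torsion_parallel_spinor g_lorentzian nabla_lc nc sf sk cov).
move=> u v n f kappa nc sf sk; split; first exact: (covariant_exterior nabla_lc).
exact: (exterior_covariant g_lorentzian nabla_lc nc).
Qed.
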